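(* Let $\Omega\subset\mathbb{R}^N$ be an open bounded domain, $1\le j\le N$, and $x_0\in\Omega$. Then there exist $g\in C(\partial\Omega)$ and $u_0\in C(\overline\Omega)$ with $u_0|_{\partial\Omega}=g$, and constants $\mu_1>0$, $k>0$, such that the viscosity solution $u$ of $u_t-\lambda_j(D^2u)=0$ in $\Omega\times(0,\infty)$, $u=g$ on $\partial\Omega\times(0,\infty)$, $u(\cdot,0)=u_0$ in $\Omega$, and the viscosity solution $z$ of $\lambda_j(D^2z)=0$ in $\Omega$, $z=g$ on $\partial\Omega$, satisfy \[ u(x_0,t)\ge z(x_0)+ke^{-\mu_1t}\quad\text{for all }t>0. \] (Analogously, $g,u_0$ can be chosen so that $u(x_0,t)\le z(x_0)-ke^{-\mu_1 t}$ for all $t>0$.)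
   Context: $\lambda_j(A)$ is the $j$-th smallest eigenvalue of a symmetric $N\times N$ matrix $A$, $\lambda_j(A)=\inf_{\dim S=j}\sup_{v\in S,|v|=1}\langle Av,v\rangle$. Solutions are viscosity solutions continuous up to the boundary and attaining the data pointwise. *)

(* Defs.v *)
From mathcomp Require Import ssreflect ssrfun ssrbool eqtype ssrnat seq fintype.
From Stdlib Require Import Reals ClassicalEpsilon.
Open Scope R_scope.

Definition vec (N : nat) := 'I_N -> R.
Definition sumI {n : nat} (f : 'I_n -> R) : R :=
  List.fold_right Rplus 0 (List.map f (enum 'I_n)).
Definition vadd {N} (x y : vec N) : vec N := fun i => x i + y i.
Definition vsub {N} (x y : vec N) : vec N := fun i => x i - y i.
Definition vscale {N} (s : R) (x : vec N) : vec N := fun i => s * x i.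
Definition ebasis {N} (i : 'I_N) : vec N := fun k => if k == i then 1 else 0.
Definition dot {N} (x y : vec N) : R := sumI (fun i => x i * y i).
Definition vnorm {N} (x : vec N) : R := sqrt (dot x x).
Definition vdist {N} (x y : vec N) : R := vnorm (vsub x y).

Definition mat (N : nat) := 'I_N -> 'I_N -> R.
Definition symmetric {N} (A : mat N) : Prop := forall i k, A i k = A k i.
Definition matvec {N} (A : mat N) (v : vec N) : vec N :=
  fun i => sumI (fun k => A i k * v k).

Definition Sup (E : R -> Prop) : R := epsilon (inhabits 0) (is_lub E).
Definition Inf (E : R -> Prop) : R := - Sup (fun r => E (- r)).

(* v : 'I_j -> vec N is a family of j linearly independent vectors;
   the j-dimensional subspaces of R^N are exactly their spans. *)
Definition lincomb {N j} (v : 'I_j -> vec N) (c : 'I_j -> R) : vec N :=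
  fun i => sumI (fun k => c k * v k i).
Definition lin_indep {N j} (v : 'I_j -> vec N) : Prop :=
  forall c : 'I_j -> R, (forall i, lincomb v c i = 0) -> forall k, c k = 0.

Definition rayleigh_sup {N j} (A : mat N) (v : 'I_j -> vec N) : R :=
  Sup (fun r => exists c : 'I_j -> R,
         vnorm (lincomb v c) = 1 /\ r = dot (matvec A (lincomb v c)) (lincomb v c)).

Definition lambda {N} (j : nat) (A : mat N) : R :=
  Inf (fun s => exists v : 'I_j -> vec N, lin_indep v /\ s = rayleigh_sup A v).

Definition is_open {N} (O : vec N -> Prop) : Prop :=
  forall x, O x -> exists r, 0 < r /\ forall y, vdist y x < r -> O y.
Definition bounded_set {N} (O : vec N -> Prop) : Prop :=
  exists M, forall x, O x -> vnorm x <= M.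
Definition connected {N} (O : vec N -> Prop) : Prop :=
  forall U V : vec N -> Prop, is_open U -> is_open V ->
    (forall x, O x <-> (U x \/ V x)) -> (forall x, ~ (U x /\ V x)) ->
    (exists x, U x) -> (exists x, V x) -> False.
Definition is_domain {N} (O : vec N -> Prop) : Prop :=
  is_open O /\ connected O /\ (exists x, O x).
Definition clos {N} (O : vec N -> Prop) (x : vec N) : Prop :=
  forall r, 0 < r -> exists y, O y /\ vdist y x < r.
Definition bdry {N} (O : vec N -> Prop) (x : vec N) : Prop :=
  clos O x /\ ~ O x.

Definition cont_on {N} (S : vec N -> Prop) (f : vec N -> R) : Prop :=
  forall x, S x -> forall eps, 0 < eps -> exists del, 0 < del /\
    forall y, S y -> vdist y x < del -> Rabs (f y - f x) < eps.
Definition cont_on2 {N} (S : vec N -> R -> Prop) (f : vec N -> R -> R) : Prop :=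
  forall x t, S x t -> forall eps, 0 < eps -> exists del, 0 < del /\
    forall y s, S y s -> vdist y x < del -> Rabs (s - t) < del ->
      Rabs (f y s - f x t) < eps.

Definition has_partial {N} (f : vec N -> R) (i : 'I_N) (x : vec N) (l : R) : Prop :=
  derivable_pt_lim (fun s => f (vadd x (vscale s (ebasis i)))) 0 l.

Definition C2_hess {N} (phi : vec N -> R) (H : vec N -> mat N) : Prop :=
  exists G : 'I_N -> vec N -> R,
    (forall i x, has_partial phi i x (G i x)) /\
    (forall i k x, has_partial (G i) k x (H x i k)) /\
    (forall i k, cont_on (fun _ => True) (fun x => H x i k)).

Definition C21 {N} (phi : vec N -> R -> R) (H : vec N -> R -> mat N)
  (T : vec N -> R -> R) : Prop :=
  exists G : 'I_N -> vec N -> R -> R,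
    (forall i x t, has_partial (fun y => phi y t) i x (G i x t)) /\
    (forall i k x t, has_partial (fun y => G i y t) k x (H x t i k)) /\
    (forall x t, derivable_pt_lim (fun s => phi x s) t (T x t)) /\
    (forall i k, cont_on2 (fun _ _ => True) (fun x t => H x t i k)) /\
    cont_on2 (fun _ _ => True) T.

(* Elliptic: lambda_j(D^2 z) = 0 in O, z = g on the bdry, written as
   F(D^2 z) = 0 with the degenerate elliptic F(X) = - lambda_j(X). *)
Definition visc_sol_ell {N} (j : nat) (O : vec N -> Prop) (g z : vec N -> R) : Prop :=
  cont_on (clos O) z /\
  (forall x, bdry O x -> z x = g x) /\
  (forall x phi H, O x -> C2_hess phi H ->
     (exists r, 0 < r /\ forall y, O y -> vdist y x < r -> z y - phi y <= z x - phi x) ->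
     0 <= lambda j (H x)) /\
  (forall x phi H, O x -> C2_hess phi H ->
     (exists r, 0 < r /\ forall y, O y -> vdist y x < r -> z y - phi y >= z x - phi x) ->
     lambda j (H x) <= 0).

Definition visc_sol_par {N} (j : nat) (O : vec N -> Prop) (g u0 : vec N -> R)
  (u : vec N -> R -> R) : Prop :=
  cont_on2 (fun x t => clos O x /\ 0 <= t) u /\
  (forall x t, bdry O x -> 0 < t -> u x t = g x) /\
  (forall x, O x -> u x 0 = u0 x) /\
  (forall x t phi H T, O x -> 0 < t -> C21 phi H T ->
     (exists r, 0 < r /\ forall y s, O y -> 0 < s -> vdist y x < r -> Rabs (s - t) < r ->
        u y s - phi y s <= u x t - phi x t) ->
     T x t - lambda j (H x t) <= 0) /\
  (forall x t phi H T, O x -> 0 < t -> C21 phi H T ->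
     (exists r, 0 < r /\ forall y s, O y -> 0 < s -> vdist y x < r -> Rabs (s - t) < r ->
        u y s - phi y s >= u x t - phi x t) ->
     T x t - lambda j (H x t) >= 0).

(* Main.v *)
Require Import Defs.
From mathcomp Require Import ssreflect ssrfun ssrbool eqtype ssrnat seq fintype.
From Stdlib Require Import Reals Lra Lia FunctionalExtensionality Classical ClassicalEpsilon.
Open Scope R_scope.
Set Implicit Arguments.
Unset Strict Implicit.

(** Only three properties of [lambda j] matter (the record [elliptic]). They are
    stable under [Lam A |-> - Lam (- A)], which exchanges [j] with [N + 1 - j]
    and the two halves of the theorem, so only the lower bound on [u] is at stake.

    The domain has no regularity, so the data are chosen together with Lipschitz
    stationary barriers [Lb <= u0 <= Ub] that coincide outside the domain;
    Perron's method between [max (Lb, u0 - C t)] and [min (Ub, u0 + C t)] then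
    gives solutions.

    If [j < N], split the coordinates around [x0] into the first [j] ones, [x_P],
    and the others, [x_W]. Near [x0] the stationary datum is [sum_W |x_i|], which
    is [lambda_j]-harmonic because it is constant in [x_P] and convex, and [u0] adds
    a bump. Linear or quadratic subsolutions show that [u >= sum_W |x_i|] persists
    on a box, where [exp (- mu t) (rho^2 - |x_P|^2)^2] is then a subsolution: test
    with the directions of [x_W] and the radial one of [x_P]. Smoothing [|x_i|]
    gives [z x0 <= 0]. For [j = 1] a single concave direction is enough for [Ub], an
    infimum of cones with vertices outside the domain. For [1 < j < N] the datum is
    folded far from [x0] so that a compactly supported perturbation of it is still
    a supersolution.

    If [j = N], the data are [rho^2 - |x - c|^2] for a ball [B(c, rho)] inside the
    domain such that [x0] is in the convex hull of the boundary points on the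
    sphere. There [u = 0], and along chords [u] dominates a positive solution of a
    one dimensional heat equation, whereas [z <= 0]. *)

(** The conclusion concerns all viscosity solutions, so each bound on [u] or [z] is drawn from the
    definition itself, by testing with a smooth function at an extremum; no comparison between two
    viscosity solutions is ever made. Nonsmooth functions therefore enter these bounds only through
    smooth ones that are adjusted to a given point.

    No eigenvalue is computed either. An upper bound on the operator needs a subspace of dimension j
    along which second differences are small, a lower bound one of dimension N + 1 - j. A cone is
    affine along a single line, so infima of cones are barriers from above exactly when one
    direction suffices, j = 1, and suprema of reversed cones are barriers from below when j = N.
    Strictly between, cones offer too few directions on either side, which is why the datum must be
    its own barrier away from a compact perturbation.

    In Perron's method a translation argument makes the supremum Lipschitz, hence continuous up to
    the boundary, so that no semicontinuous envelopes arise. *)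

(** * Finite sums and Euclidean geometry *)

Lemma sumI_ext n (f g : 'I_n -> R) : (forall i, f i = g i) -> sumI f = sumI g.
Proof. by move=> H; congr sumI; apply: functional_extensionality. Qed.

Lemma sumI_add n (f g : 'I_n -> R) : sumI (fun i => f i + g i) = sumI f + sumI g.
Proof. rewrite /sumI; elim: (enum _) => [|a l IH] /=; lra. Qed.

Lemma sumI_scal n (c : R) (f : 'I_n -> R) : sumI (fun i => c * f i) = c * sumI f.
Proof. rewrite /sumI; elim: (enum _) => [|a l IH] /=; [lra|rewrite IH; lra]. Qed.

Lemma sumI_le n (f g : 'I_n -> R) : (forall i, f i <= g i) -> sumI f <= sumI g.
Proof.
move=> H; rewrite /sumI; elim: (enum _) => [|a l IH] /=; first lra.
by move: (H a); lra.
Qed.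

Lemma sumI_0 n (f : 'I_n -> R) : (forall i, f i = 0) -> sumI f = 0.
Proof.
move=> H; rewrite /sumI; elim: (enum _) => [|a l IH] //=.
by rewrite H IH; lra.
Qed.

Lemma sumI_ge0 n (f : 'I_n -> R) : (forall i, 0 <= f i) -> 0 <= sumI f.
Proof.
by move=> H; rewrite -(@sumI_0 n (fun=> 0)) //; apply: sumI_le.
Qed.

Lemma sumI_opp n (f : 'I_n -> R) : sumI (fun i => - f i) = - sumI f.
Proof. rewrite /sumI; elim: (enum _) => [|a l IH] /=; lra. Qed.

Lemma sumI_abs n (f : 'I_n -> R) : Rabs (sumI f) <= sumI (fun i => Rabs (f i)).
Proof.
rewrite /sumI; elim: (enum _) => [|a l IH] /=; first by rewrite Rabs_R0; lra.
by apply: Rle_trans (Rabs_triang _ _) _; lra.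
Qed.

Lemma sumI_exch n m (f : 'I_n -> 'I_m -> R) :
  sumI (fun i => sumI (fun k => f i k)) = sumI (fun k => sumI (fun i => f i k)).
Proof.
have H (l : seq 'I_n) :
    List.fold_right Rplus 0 (List.map (fun i => sumI (fun k => f i k)) l)
    = sumI (fun k => List.fold_right Rplus 0 (List.map (fun i => f i k) l)).
  by elim: l => [|a l IH] /=; [rewrite sumI_0|rewrite sumI_add IH].
exact: H.
Qed.

Lemma sumI_delta n (i : 'I_n) (f : 'I_n -> R) :
  sumI (fun k => if k == i then f k else 0) = f i.
Proof.
have H (l : seq 'I_n) : uniq l ->
    List.fold_right Rplus 0 (List.map (fun k => if k == i then f k else 0) l)
    = if i \in l then f i else 0.
  elim: l => [|a l IH] //= /andP[Ha /IH ->]; rewrite in_cons eq_sym.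
  case: (i =P a) => [E|_] /=; last by lra.
  by subst a; rewrite (negbTE Ha); lra.
by rewrite /sumI H ?enum_uniq // mem_enum.
Qed.

Lemma sumI_term n (f : 'I_n -> R) i : (forall k, 0 <= f k) -> f i <= sumI f.
Proof.
move=> H; rewrite -{1}(sumI_delta i f); apply: sumI_le => k.
by case: eqP => _; [lra|exact: H].
Qed.

Lemma sumI_const_le n (f : 'I_n -> R) c : (forall i, f i <= c) -> sumI f <= INR n * c.
Proof.
have H (l : seq 'I_n) : (forall i, f i <= c) ->
    List.fold_right Rplus 0 (List.map f l) <= INR (size l) * c.
  move=> Hf; elim: l => [|a l IH]; first by rewrite /=; lra.
  rewrite [size _]/= S_INR /=; move: (Hf a); lra.
by move=> Hf; rewrite -{2}(size_enum_ord n); apply: H.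
Qed.

Lemma dotC N (x y : vec N) : dot x y = dot y x.
Proof. by apply: sumI_ext => i; lra. Qed.
Lemma dot_addl N (x y z : vec N) : dot (vadd x y) z = dot x z + dot y z.
Proof. by rewrite /dot -sumI_add; apply: sumI_ext => i; rewrite /vadd; lra. Qed.
Lemma dot_scall N c (x z : vec N) : dot (vscale c x) z = c * dot x z.
Proof. by rewrite /dot -sumI_scal; apply: sumI_ext => i; rewrite /vscale; lra. Qed.
Lemma dot_addr N (x y z : vec N) : dot z (vadd x y) = dot z x + dot z y.
Proof. by rewrite !(dotC z) dot_addl. Qed.
Lemma dot_scalr N c (x z : vec N) : dot z (vscale c x) = c * dot z x.
Proof. by rewrite !(dotC z) dot_scall. Qed.

Lemma vsubE N (x y : vec N) : vsub x y = vadd x (vscale (-1) y).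
Proof. by apply: functional_extensionality => i; rewrite /vsub /vadd /vscale; lra. Qed.
Lemma dot_subl N (x y z : vec N) : dot (vsub x y) z = dot x z - dot y z.
Proof. by rewrite vsubE dot_addl dot_scall; lra. Qed.
Lemma dot_subr N (x y z : vec N) : dot z (vsub x y) = dot z x - dot z y.
Proof. by rewrite !(dotC z) dot_subl. Qed.

Lemma dot_ge0 N (x : vec N) : 0 <= dot x x.
Proof. by apply: sumI_ge0 => i; nra. Qed.

Lemma coord_le_dot N (x : vec N) i : x i * x i <= dot x x.
Proof. by apply: (@sumI_term N (fun i => x i * x i)) => k; nra. Qed.

Lemma vnorm_ge0 N (x : vec N) : 0 <= vnorm x.
Proof. exact: sqrt_pos. Qed.

Lemma vnorm_sq N (x : vec N) : vnorm x * vnorm x = dot x x.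
Proof. by rewrite /vnorm sqrt_sqrt //; apply: dot_ge0. Qed.

Lemma coord_le N (x : vec N) i : Rabs (x i) <= vnorm x.
Proof.
rewrite -(sqrt_Rsqr_abs (x i)); apply: sqrt_le_1_alt; exact: coord_le_dot.
Qed.

Lemma quadratic_discr a b c : (forall s, 0 <= a + 2 * s * b + s * s * c) -> b * b <= a * c.
Proof.
move=> key.
have Hc : 0 <= c.
  apply: Rnot_lt_le => Hc.
  have [s Hs] : exists s, a + 2 * s * b + s * s * c < 0.
    (* The summand 1 forces s >= 1, so that s * s * (- c) >= s * (1 + |a| + 2 |b|) beats both a and
       2 s b. *)
    exists ((1 + Rabs a + 2 * Rabs b) / - c + 1).
    set s := (_ / _ + 1).
    have H1 : 0 <= Rabs a by exact: Rabs_pos.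
    have H2 : 0 <= Rabs b by exact: Rabs_pos.
    have Ha := Rle_abs a; have Hb := Rle_abs b.
    have E : (s - 1) * - c = 1 + Rabs a + 2 * Rabs b by rewrite /s; field; lra.
    have Hs : 1 <= s by nra.
    have : s * (s * - c) >= s * (1 + Rabs a + 2 * Rabs b) by nra.
    nra.
  by move: (key s); lra.
case: (Req_dec c 0) => Hc0.
  apply: Rnot_lt_le => H.
  have Hb : b <> 0 by nra.
  move: (key (- (a + 1) / (2 * b))); rewrite Hc0.
  have -> : 2 * (- (a + 1) / (2 * b)) * b = - (a + 1) by field.
  lra.
move: (key (- b / c)).
have -> : a + 2 * (- b / c) * b + - b / c * (- b / c) * c = (a * c - b * b) / c by field.
move=> H; apply: Rnot_lt_le => H1.
have : 0 < (b * b - a * c) / c by apply: Rdiv_lt_0_compat; lra.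
have -> : (b * b - a * c) / c = - ((a * c - b * b) / c) by field.
lra.
Qed.

Lemma cauchy_schwarz N (x y : vec N) : dot x y <= vnorm x * vnorm y.
Proof.
have : dot x y * dot x y <= dot x x * dot y y.
  apply: quadratic_discr => s; have := dot_ge0 (vadd x (vscale s y)).
  rewrite !dot_addl !dot_addr !dot_scall !dot_scalr (dotC y x); lra.
rewrite -!vnorm_sq => H.
have Hx := vnorm_ge0 x; have Hy := vnorm_ge0 y.
apply: Rnot_lt_le => H1.
have : 0 <= vnorm x * vnorm y by nra.
nra.
Qed.

Lemma vnorm_triang N (x y : vec N) : vnorm (vadd x y) <= vnorm x + vnorm y.
Proof.
have Hx := vnorm_ge0 x; have Hy := vnorm_ge0 y; have Hxy := vnorm_ge0 (vadd x y).
have := vnorm_sq (vadd x y); rewrite dot_addl !dot_addr -!vnorm_sq (dotC y x).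
have := cauchy_schwarz x y; nra.
Qed.

Lemma vnorm_scale N c (x : vec N) : vnorm (vscale c x) = Rabs c * vnorm x.
Proof.
rewrite /vnorm dot_scall dot_scalr -Rmult_assoc sqrt_mult_alt; last by nra.
by rewrite -/(Rsqr c) sqrt_Rsqr_abs.
Qed.

Lemma vnorm0_eq N (x : vec N) : vnorm x = 0 -> forall i, x i = 0.
Proof.
move=> H i; have := coord_le x i; rewrite H => K.
by case: (Req_dec (x i) 0) => // /Rabs_pos_lt; lra.
Qed.

Lemma vdist_sym N (x y : vec N) : vdist x y = vdist y x.
Proof.
rewrite /vdist /vnorm; congr sqrt; apply: sumI_ext => i; rewrite /vsub; ring.
Qed.
Lemma vdist_ge0 N (x y : vec N) : 0 <= vdist x y.
Proof. exact: vnorm_ge0. Qed.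
Lemma vdist_triang N (x y z : vec N) : vdist x z <= vdist x y + vdist y z.
Proof.
rewrite /vdist; have -> : vsub x z = vadd (vsub x y) (vsub y z).
  by apply: functional_extensionality => i; rewrite /vsub /vadd; lra.
exact: vnorm_triang.
Qed.
Lemma vdist_self N (x : vec N) : vdist x x = 0.
Proof.
rewrite /vdist /vnorm /dot sumI_0 ?sqrt_0 // => i; rewrite /vsub; ring.
Qed.
Lemma vdist_eq0 N (x y : vec N) : vdist x y = 0 -> x = y.
Proof.
move=> H; apply: functional_extensionality => i.
by have := vnorm0_eq H i; rewrite /vsub; lra.
Qed.
Lemma vdist_addr N (x v : vec N) : vdist (vadd x v) x = vnorm v.
Proof.
rewrite /vdist; congr vnorm; apply: functional_extensionality => i.
by rewrite /vsub /vadd; lra.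
Qed.
Lemma vdist_transl N (x y h : vec N) : vdist (vadd x h) (vadd y h) = vdist x y.
Proof.
rewrite /vdist; congr vnorm; apply: functional_extensionality => i.
by rewrite /vsub /vadd; lra.
Qed.
Lemma vdist_coord N (x y : vec N) i : Rabs (x i - y i) <= vdist x y.
Proof. exact: (coord_le (vsub x y) i). Qed.

Lemma vnorm_le_coord N (v : vec N) c :
  0 <= c -> (forall i, Rabs (v i) <= c) -> vnorm v <= (INR N + 1) * c.
Proof.
move=> Hc H.
have HN : 0 <= INR N by exact: pos_INR.
have E : dot v v <= INR N * (c * c).
  apply: sumI_const_le => i; have := H i.
  by rewrite -(Rabs_mult_self (v i)) || (move=> Hi; have := Rabs_pos (v i);
    have : v i * v i = Rabs (v i) * Rabs (v i) by rewrite -Rabs_mult Rabs_pos_eq //; nra); nra.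
apply: Rnot_lt_le => Hlt.
have : ((INR N + 1) * c) * ((INR N + 1) * c) < vnorm v * vnorm v.
  by apply: Rmult_le_0_lt_compat => //; nra.
rewrite vnorm_sq; nra.
Qed.

Ltac vec_ring := apply: functional_extensionality => ?; rewrite /vadd /vsub /vscale; ring.

Lemma Rabs_sq a : Rabs a * Rabs a = a * a.
Proof. by rewrite -Rabs_mult Rabs_pos_eq //; exact: Rle_0_sqr. Qed.

Lemma vadd0 N (x v : vec N) : vadd x (vscale 0 v) = x.
Proof. by apply: functional_extensionality => i; rewrite /vadd /vscale; lra. Qed.

Lemma Rabs_le_both a b : Rabs a <= b -> - b <= a /\ a <= b.
Proof. by rewrite /Rabs; case: Rcase_abs => ? ?; split; lra. Qed.

Lemma Rabs_lt_sq a r : 0 < r -> a * a < r * r -> Rabs a < r.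
Proof. by move=> Hr H; rewrite -(Rabs_pos_eq r); [apply: Rsqr_lt_abs_0|lra]. Qed.

(** * Linear dependence and [lambda j] *)

Lemma sumI_split m n (f : 'I_(m + n) -> R) :
  sumI f = sumI (fun i => f (lshift n i)) + sumI (fun i => f (rshift m i)).
Proof.
have E : enum 'I_(m + n) = (map (lshift n) (enum 'I_m) ++ map (@rshift m n) (enum 'I_n))%SEQ.
  apply: (inj_map val_inj); rewrite val_enum_ord map_cat -(map_comp val (lshift n)) -(map_comp val (@rshift m n)).
  rewrite iotaD; congr cat.
    rewrite -(val_enum_ord m). by apply: eq_map.
  by rewrite add0n -(addn0 m) iotaDl -(val_enum_ord n) -map_comp addn0; apply: eq_map.
rewrite /sumI E; elim: (enum 'I_m) => [|a l IH] /=; last by rewrite IH; lra.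
by rewrite Rplus_0_l; elim: (enum 'I_n) => [|a l IH] //=; rewrite IH.
Qed.

(** Gaussian elimination, one coordinate of [l] at a time. The set [S] of available vectors loses
    its pivot at each elimination, so the invariant is that [S] stays longer than [l]. *)
Lemma linear_dependence_aux N m (l : seq 'I_N) : forall (u : 'I_m -> vec N) (S : seq 'I_m),
  uniq S -> (size l < size S)%nat ->
  exists c : 'I_m -> R, (forall k, k \notin S -> c k = 0) /\ (exists k, c k <> 0) /\
    forall i, i \in l -> lincomb u c i = 0.
Proof.
elim: l => [|a l IH] u S HS Hsz.
  case: S HS Hsz => [|p S] // HS _.
  exists (fun k => if k == p then 1 else 0); split; last split => //.
    by move=> k; rewrite in_cons; case: eqP.
  by exists p; rewrite eqxx; lra.
case: (classic (exists p, p \in S /\ u p a <> 0)) => [[p [pS Hp]]|H0]; last first.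
  have [|c [Hc1 [Hc2 Hc3]]] := IH u S HS; first exact: ltn_trans Hsz.
  exists c; split => //; split => // i; rewrite in_cons; case: eqP => [-> _|_] /=; last exact: Hc3.
  apply: sumI_0 => k; case: (boolP (k \in S)) => Hk; last by rewrite Hc1 //; lra.
  have -> : u k a = 0 by apply: NNPP => H; apply: H0; exists k.
  lra.
(* Subtracting multiples of the pivot [u p] kills coordinate [a]; the coefficient of [u p] in the
   final combination is [d] below. *)
pose u' k : vec N := fun i => u k i - u k a / u p a * u p i.
have [||c [Hc1 [[q Hq] Hc3]]] := IH u' (rem p S); first exact: rem_uniq.
  rewrite size_rem //; move: Hsz => /=; case: (size S) => //= n; by rewrite ltnS.
have Hcp : c p = 0 by apply: Hc1; rewrite mem_rem_uniqF.
pose d := - sumI (fun k => c k * u k a / u p a).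
exists (fun k => c k + (if k == p then d else 0)); split; last split.
- move=> k Hk; rewrite Hc1; last by apply: contra Hk => /mem_rem.
  case: eqP => [E|]; last by lra.
  by rewrite E pS in Hk.
- exists q; case: eqP => [E|]; last by rewrite Rplus_0_r.
  by rewrite E Hcp in Hq.
have key i : lincomb u (fun k => c k + (if k == p then d else 0)) i = lincomb u' c i.
  have E1 : lincomb u (fun k => c k + (if k == p then d else 0)) i
      = sumI (fun k => c k * u k i) + d * u p i.
    rewrite -(sumI_delta p (fun k => d * u k i)) -sumI_add; apply: sumI_ext => k.
    by case: eqP => _; ring.
  rewrite E1 /d -Ropp_mult_distr_l Rmult_comm -sumI_scal -sumI_opp -sumI_add.
  by apply: sumI_ext => k; rewrite /u'; field.
move=> i; rewrite key in_cons; case: eqP => [-> _|_] /=; last exact: Hc3.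
by apply: sumI_0 => k; rewrite /u'; field.
Qed.

Lemma linear_dependence N m (u : 'I_m -> vec N) : (N < m)%nat ->
  exists c : 'I_m -> R, (exists k, c k <> 0) /\ forall i, lincomb u c i = 0.
Proof.
move=> H.
have [||c [_ [Hc1 Hc2]]] := @linear_dependence_aux N m (enum 'I_N) u (enum 'I_m).
- exact: enum_uniq.
- by rewrite !size_enum_ord.
by exists c; split => // i; apply: Hc2; rewrite mem_enum.
Qed.

Definition form N (A : mat N) (v : vec N) : R := dot (matvec A v) v.

Lemma form_opp N (A : mat N) v : form (fun i k => - A i k) v = - form A v.
Proof.
rewrite /form -sumI_opp; apply: sumI_ext => i.
by rewrite /matvec Ropp_mult_distr_l -sumI_opp; congr Rmult; apply: sumI_ext => k; ring.
Qed.

Lemma form_bound N (A : mat N) (K : R) v : 0 <= K -> (forall i k, Rabs (A i k) <= K) ->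
  Rabs (form A v) <= INR N * INR N * K * dot v v.
Proof.
move=> HK HA; rewrite -vnorm_sq; have Hv := vnorm_ge0 v.
apply: Rle_trans (sumI_abs _) _.
have -> : INR N * INR N * K * (vnorm v * vnorm v)
  = INR N * (INR N * (K * vnorm v) * vnorm v) by ring.
apply: sumI_const_le => i; rewrite Rabs_mult.
apply: Rmult_le_compat; try exact: Rabs_pos; last exact: coord_le.
apply: Rle_trans (sumI_abs _) _; apply: sumI_const_le => k; rewrite Rabs_mult.
by apply: Rmult_le_compat; try exact: Rabs_pos; [exact: HA|exact: coord_le].
Qed.

Lemma mat_bound N (A : mat N) : exists K, 0 <= K /\ forall i k, Rabs (A i k) <= K.
Proof.
exists (sumI (fun i => sumI (fun k => Rabs (A i k)))); split.
  by apply: sumI_ge0 => i; apply: sumI_ge0 => k; exact: Rabs_pos.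
move=> i k; apply: Rle_trans (sumI_term (f := fun i => sumI (fun k => Rabs (A i k))) i _).
  by apply: (sumI_term (f := fun k => Rabs (A i k))) => ?; exact: Rabs_pos.
by move=> ?; apply: sumI_ge0 => ?; exact: Rabs_pos.
Qed.

Lemma lincomb_scale N n (v : 'I_n -> vec N) c r :
  lincomb v (fun k => r * c k) = vscale r (lincomb v c).
Proof.
apply: functional_extensionality => i; rewrite /vscale /lincomb -sumI_scal.
by apply: sumI_ext => k; ring.
Qed.

Lemma lincomb_delta N n (v : 'I_n -> vec N) k :
  lincomb v (fun l => if l == k then 1 else 0) = v k.
Proof.
apply: functional_extensionality => i; rewrite /lincomb.
rewrite -(sumI_delta k (fun l => v l i)); apply: sumI_ext => l.
by case: eqP => _; ring.
Qed.

Lemma vnorm_pos N (v : vec N) i : v i <> 0 -> 0 < vnorm v.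
Proof.
by move=> H; apply: Rlt_le_trans (coord_le v i); apply: Rabs_pos_lt.
Qed.

Lemma unit_rescale N (v : vec N) : 0 < vnorm v -> vnorm (vscale (/ vnorm v) v) = 1.
Proof.
move=> H; rewrite vnorm_scale Rabs_pos_eq; first by field; lra.
by left; apply: Rinv_0_lt_compat.
Qed.

Lemma unit_in_span N n (v : 'I_n -> vec N) c : (exists i, lincomb v c i <> 0) ->
  exists c', vnorm (lincomb v c') = 1.
Proof.
move=> [i Hi]; exists (fun k => / vnorm (lincomb v c) * c k).
by rewrite lincomb_scale unit_rescale //; apply: vnorm_pos Hi.
Qed.

Lemma lin_indep_ex N n (v : 'I_n -> vec N) c : lin_indep v -> (exists k, c k <> 0) ->
  exists i, lincomb v c i <> 0.
Proof.
move=> Hv [k Hk]; apply: NNPP => H; apply: Hk; apply: Hv => i.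
by apply: NNPP => Hi; apply: H; exists i.
Qed.

(** [Sup] is a choice operator and carries information only for nonempty sets bounded above; hence
    the two side conditions that recur wherever it is used. *)
Lemma Sup_lub (E : R -> Prop) : (exists r, E r) -> (exists M, forall r, E r -> r <= M) ->
  is_lub E (Sup E).
Proof.
move=> H1 [M HM]; apply: (epsilon_spec (inhabits 0)).
have [|s Hs] := completeness E _ H1; last by exists s.
by exists M.
Qed.

Lemma Inf_le (E : R -> Prop) M r : (forall s, E s -> M <= s) -> E r -> Inf E <= r.
Proof.
move=> HM Hr; rewrite /Inf.
have [|| H _] := @Sup_lub (fun r => E (- r)).
- by exists (- r); rewrite Ropp_involutive.
- by exists (- M) => s /HM; lra.
have := H (- r); rewrite Ropp_involutive => /(_ Hr); lra.
Qed.

Lemma Inf_ge (E : R -> Prop) M : (exists r, E r) -> (forall s, E s -> M <= s) -> M <= Inf E.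
Proof.
move=> [r Hr] HM; rewrite /Inf.
have [|| _ H] := @Sup_lub (fun r => E (- r)).
- by exists (- r); rewrite Ropp_involutive.
- by exists (- M) => s /HM; lra.
have := H (- M); move=> /(_ _); rewrite /is_upper_bound => H1.
suff: Sup (fun r => E (- r)) <= - M by lra.
by apply: H1 => s /HM; lra.
Qed.

Section Rayleigh.
Context (N j : nat).
Implicit Types (A B : mat N) (v : 'I_j -> vec N).

Let RQ A v r := exists c : 'I_j -> R,
         vnorm (lincomb v c) = 1 /\ r = dot (matvec A (lincomb v c)) (lincomb v c).

Lemma rayleigh_le A v m : (exists c, vnorm (lincomb v c) = 1) ->
  (forall c, vnorm (lincomb v c) = 1 -> form A (lincomb v c) <= m) -> rayleigh_sup A v <= m.
Proof.
move=> [c0 Hc0] H.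
have [||_ H1] := @Sup_lub (RQ A v); [by exists (form A (lincomb v c0)), c0|by exists m => r [c [/H K ->]]|].
by apply: H1 => r [c [/H K ->]].
Qed.

Lemma rayleigh_ge A v c : vnorm (lincomb v c) = 1 -> form A (lincomb v c) <= rayleigh_sup A v.
Proof.
move=> Hc; have [K [K0 HK]] := mat_bound A.
have [||H1 _] := @Sup_lub (RQ A v); [by exists (form A (lincomb v c)), c| |by apply: H1; exists c].
exists (INR N * INR N * K) => r [c' [E ->]].
have := form_bound (lincomb v c') K0 HK; rewrite -vnorm_sq E => H.
by apply: Rle_trans (Rle_abs _) _; apply: Rle_trans H _; lra.
Qed.

Lemma lin_indep_unit v : (1 <= j)%nat -> lin_indep v -> exists c, vnorm (lincomb v c) = 1.
Proof.
move=> Hj Hv; apply: (@unit_in_span _ _ _ (fun=> 1)); apply: lin_indep_ex => //.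
by exists (Ordinal Hj); lra.
Qed.

(** The infimum is genuine because [form_bound] bounds all Rayleigh suprema below by one constant
    depending on the entries of [A]. *)
Lemma lambda_le A v : (1 <= j)%nat -> lin_indep v -> lambda j A <= rayleigh_sup A v.
Proof.
move=> Hj Hv; have [K [K0 HK]] := mat_bound A.
apply: (@Inf_le _ (- (INR N * INR N * K))); last by exists v.
move=> s [v' [Hv' ->]]; have [c Hc] := lin_indep_unit Hj Hv'.
apply: Rle_trans (rayleigh_ge A Hc).
have := form_bound (lincomb v' c) K0 HK; rewrite -vnorm_sq Hc.
by have := Rle_abs (- form A (lincomb v' c)); rewrite Rabs_Ropp; lra.
Qed.

Lemma ex_lin_indep : (j <= N)%nat -> exists v : 'I_j -> vec N, lin_indep v.
Proof.
move=> H; exists (fun k => ebasis (widen_ord H k)) => c Hc k.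
rewrite -(Hc (widen_ord H k)) /lincomb -{1}(sumI_delta k c).
apply: sumI_ext => l; rewrite /ebasis.
rewrite (_ : (widen_ord H k == widen_ord H l) = (l == k)); last by rewrite eq_sym.
by case: eqP => _; ring.
Qed.

Lemma lambda_ge A m : (j <= N)%nat ->
  (forall v, lin_indep v -> m <= rayleigh_sup A v) -> m <= lambda j A.
Proof.
move=> HjN H; apply: Inf_ge; last by move=> s [v [Hv ->]]; exact: H.
by have [v Hv] := ex_lin_indep HjN; exists (rayleigh_sup A v), v.
Qed.
End Rayleigh.

(** The two halves of the Courant-Fischer principle, then monotonicity and Lipschitz dependence in
    one inequality. The dimension [n] is a variable tied to [j] by an equation, so that subtractions
    such as N + 1 - j need no casts. *)
Record elliptic N (j : nat) (Lam : mat N -> R) : Prop := {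
  ell_up : forall n (v : 'I_n -> vec N) A m, n = j -> lin_indep v ->
    (forall c, form A (lincomb v c) <= m * dot (lincomb v c) (lincomb v c)) -> Lam A <= m;
  ell_lo : forall n (v : 'I_n -> vec N) A m, (n + j)%nat = N.+1 -> lin_indep v ->
    (forall c, m * dot (lincomb v c) (lincomb v c) <= form A (lincomb v c)) -> m <= Lam A;
  ell_cont : forall A B e, (forall v, form A v <= form B v + e * dot v v) -> Lam A <= Lam B + e }.

Lemma lambda_elliptic N j : (1 <= j)%nat -> (j <= N)%nat -> elliptic j (@lambda N j).
Proof.
move=> Hj HjN; split.
- move=> n v A m E; subst n => Hv H.
  apply: Rle_trans (lambda_le A Hj Hv) _; apply: rayleigh_le; first exact: lin_indep_unit.
  by move=> c Hc; apply: Rle_trans (H c) _; rewrite -vnorm_sq Hc; lra.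
- move=> n u A m En Hu H; apply: lambda_ge => // v Hv.
  (* Together the two families have N + 1 members, so a dependence between them yields a vector
     common to both spans. *)
  have [|c [[k Hk] Hc]] :=
      @linear_dependence N (j + n) (fun k => match fintype.split k with inl a => v a | inr b => u b end).
    by rewrite addnC En.
  pose c1 a := c (lshift n a); pose c2 b := - c (rshift j b).
  have E : lincomb v c1 = lincomb u c2.
    apply: functional_extensionality => i; have := Hc i; rewrite /lincomb sumI_split.
    set p1 := sumI _; set p2 := sumI _ => E0.
    have -> : sumI (fun k => c1 k * v k i) = p1.
      by apply: sumI_ext => a; rewrite (unsplitK (inl a)).
    have -> : sumI (fun k => c2 k * u k i) = - p2.
      by rewrite -sumI_opp; apply: sumI_ext => b; rewrite (unsplitK (inr b)) /c2; ring.
    lra.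
  have [c' Hc'] : exists r, vnorm (vscale r (lincomb v c1)) = 1.
    suff [i Hi] : exists i, lincomb v c1 i <> 0.
      by exists (/ vnorm (lincomb v c1)); apply: unit_rescale; apply: vnorm_pos Hi.
    (* The common vector is nonzero: a nonvanishing coefficient belongs to one of the two families,
       and that family is independent. *)
    rewrite -(splitK k) in Hk; case: (fintype.split k) Hk => [a|b] /= Hk.
      by apply: lin_indep_ex => //; exists a.
    by rewrite E; apply: lin_indep_ex => //; exists b; rewrite /c2; lra.
  have Hc1 := Hc'; rewrite -lincomb_scale in Hc'; apply: Rle_trans (rayleigh_ge A Hc').
  rewrite lincomb_scale E -lincomb_scale; apply: Rle_trans (H _).
  by rewrite lincomb_scale -E -vnorm_sq Hc1; lra.
move=> A B e H.
suff: lambda j A - e <= lambda j B by lra.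
apply: lambda_ge => // v Hv.
suff: rayleigh_sup A v <= rayleigh_sup B v + e by have := lambda_le A Hj Hv; lra.
apply: rayleigh_le; first exact: lin_indep_unit.
move=> c Hc; apply: Rle_trans (H _) _; rewrite -vnorm_sq Hc.
by have := rayleigh_ge B Hc; lra.
Qed.

Definition dual_op N (Lam : mat N -> R) : mat N -> R := fun A => - Lam (fun i k => - A i k).

Lemma dual_elliptic N j (Lam : mat N -> R) : (1 <= j)%nat -> (j <= N)%nat ->
  elliptic j Lam -> elliptic (N.+1 - j) (dual_op Lam).
Proof.
move=> Hj HjN [H1 H2 H3]; split; rewrite /dual_op.
- move=> n v A m E Hv H.
  suff: - m <= Lam (fun i k => - A i k) by lra.
  apply: (H2 n v) => //; first by rewrite E subnK // ltnW.
  by move=> c; rewrite form_opp; have := H c; lra.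
- move=> n v A m E Hv H.
  suff: Lam (fun i k => - A i k) <= - m by lra.
  apply: (H1 n v) => //.
    have Hj1 : (j <= N.+1)%nat by apply: ltnW.
    by apply/eqP; rewrite -(eqn_add2r (N.+1 - j)) E subnKC.
  by move=> c; rewrite form_opp; have := H c; lra.
move=> A B e H.
suff: Lam (fun i k => - B i k) <= Lam (fun i k => - A i k) + e by lra.
by apply: H3 => v; rewrite !form_opp; have := H v; lra.
Qed.

(** * Subspaces and compactness *)

(** [V] need not be a subspace, only contain one; test directions can thus be described by whatever
    condition a computation uses. *)
Definition dim_ge N (n : nat) (V : vec N -> Prop) : Prop :=
  exists v : 'I_n -> vec N, lin_indep v /\ forall c, V (lincomb v c).

Lemma dim_ge_weaken N n (V V' : vec N -> Prop) :
  dim_ge n V -> (forall v, V v -> V' v) -> dim_ge n V'.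
Proof. by move=> [v [H1 H2]] H; exists v; split => // c; apply: H. Qed.

(* The subspace is the graph of a linear map, of matrix [a], from the coordinates in [S] to the others. *)
Lemma dim_ge_graph N (S : pred 'I_N) (a : 'I_N -> 'I_N -> R) n : (n <= #|S|)%nat ->
  dim_ge n (fun y : vec N =>
    forall k, ~~ S k -> y k = sumI (fun i => if S i then y i * a i k else 0)).
Proof.
move=> Hn; pose sg (m : 'I_n) : 'I_N := enum_val (widen_ord Hn m).
have sgS m : S (sg m) by have := enum_valP (widen_ord Hn m).
have sgI m m' : (sg m == sg m') = (m == m').
  by rewrite (inj_eq enum_val_inj).
pose v (m : 'I_n) : vec N := fun k => if S k then (if k == sg m then 1 else 0) else a (sg m) k.
exists v; split.
  move=> c Hc m; rewrite -(Hc (sg m)) /lincomb -{1}(sumI_delta m c).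
  apply: sumI_ext => m'; rewrite /v sgS sgI eq_sym; case: eqP => _; ring.
move=> c k Hk; rewrite /lincomb.
rewrite (sumI_ext (g := fun i => sumI (fun m => if i == sg m then c m * a (sg m) k else 0))).
  rewrite sumI_exch; apply: sumI_ext => m.
  rewrite (sumI_delta (sg m) (fun=> c m * a (sg m) k)) /v.
  by rewrite (negbTE Hk).
move=> i; case: (boolP (S i)) => Hi.
  rewrite Rmult_comm -sumI_scal; apply: sumI_ext => m; rewrite /v Hi.
  by case: eqP => [->|_]; ring.
rewrite sumI_0 // => m; case: eqP => // E.
by rewrite E sgS in Hi.
Qed.

Lemma card_ge_inj (n N : nat) (S : pred 'I_N) (sg : 'I_n -> 'I_N) :
  injective sg -> (forall m, S (sg m)) -> (n <= #|S|)%nat.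
Proof.
move=> sgI sgS; rewrite -{1}(card_ord n) -(card_codom sgI); apply: subset_leq_card.
by apply/subsetP => i /codomP [m ->]; exact: sgS.
Qed.

Lemma BW_real (u : nat -> R) M : (forall n, Rabs (u n) <= M) ->
  exists (l : R) (p : nat -> nat), (forall n, (p n < p n.+1)%coq_nat) /\ Un_cv (fun n => u (p n)) l.
Proof.
move=> Hu.
have [||l Hl] := @Bolzano_Weierstrass u (fun x => - M <= x <= M).
- exact: compact_P3.
- by move=> n; have := Hu n; rewrite /Rabs; case: Rcase_abs => ?; split; lra.
have step (n0 : nat) (e : R) : 0 < e -> exists p, (n0 < p)%coq_nat /\ Rabs (u p - l) < e.
  move=> He; have [|p [Hp1 Hp2]] := Hl (disc l (mkposreal e He)) n0.+1.
    by exists (mkposreal e He) => x.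
  by exists p; split; first lia.
have He n : 0 < / (INR n + 1) by apply: Rinv_0_lt_compat; have := pos_INR n; lra.
pose nxt n q := epsilon (inhabits 0%nat) (fun p => (q < p)%coq_nat /\ Rabs (u p - l) < / (INR n + 1)).
have nxtP n q : (q < nxt n q)%coq_nat /\ Rabs (u (nxt n q) - l) < / (INR n + 1).
  exact: (epsilon_spec (inhabits 0%nat) (fun p => (q < p)%coq_nat /\ Rabs (u p - l) < / (INR n + 1)) (step q _ (He n))).
pose p := fix p n := match n with O => nxt O O | S m => nxt m.+1 (p m) end.
exists l, p; split; first by move=> n; have [] := nxtP n.+1 (p n).
have Hp n : Rabs (u (p n) - l) < / (INR n + 1) by case: n => [|n]; [exact: (nxtP O O).2|exact: (nxtP n.+1 (p n)).2].
move=> eps Heps; have [n0 [Hn0 Hn0']] := archimed_cor1 eps Heps.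
exists n0 => n Hn; rewrite /R_dist; apply: Rlt_trans (Hp n) _; apply: Rle_lt_trans Hn0.
apply: Rinv_le_contravar; first by apply: lt_0_INR.
by have := le_INR _ _ Hn; lra.
Qed.

(** Successive extraction. A list is used so that coordinates, times and convex weights can all be
    made to converge along one subsequence. *)
Lemma BW_list (us : list (nat -> R)) M : (forall u, List.In u us -> forall n, Rabs (u n) <= M) ->
  exists p : nat -> nat, (forall n, (p n < p n.+1)%coq_nat) /\
    forall u, List.In u us -> exists l, Un_cv (fun n => u (p n)) l.
Proof.
elim: us => [|u us IH] H; first by exists (fun n => n); split => // n; lia.
have [|p [Hp1 Hp2]] := IH; first by move=> w Hw; apply: H; right.
have [|l [q [Hq1 Hq2]]] := @BW_real (fun n => u (p n)) M; first by move=> n; apply: H; left.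
have pm a b : (a < b)%coq_nat -> (p a < p b)%coq_nat.
  by elim: b => [|b IHb] Hab; [lia|have := Hp1 b; case: (Nat.eq_dec a b) => [->|]; lia].
have Hq n : (n <= q n)%coq_nat by elim: n => [|n IHn]; [lia|have := Hq1 n; lia].
exists (fun n => p (q n)); split; first by move=> n; apply: pm.
move=> w /= [<-|Hw]; first by exists l.
have [l' Hl'] := Hp2 w Hw; exists l' => e He; have [n0 Hn0] := Hl' e He.
by exists n0 => n Hn; apply: Hn0; have := Hq n; lia.
Qed.

Lemma Un_cv_finite (I : finType) (u : nat -> I -> R) (l : I -> R) e :
  (forall i, Un_cv (fun n => u n i) (l i)) -> 0 < e ->
  exists n0, forall n i, (n0 <= n)%coq_nat -> Rabs (u n i - l i) < e.
Proof.
move=> H He.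
have [n0 Hn0] : exists n0, forall n i, i \in enum I -> (n0 <= n)%coq_nat -> Rabs (u n i - l i) < e.
  elim: (enum I) => [|a s [n0 IH]]; first by exists O.
  have [n1 Hn1] := H a e He; exists (max n0 n1) => n i.
  by rewrite in_cons => /orP[/eqP ->|Hi] Hn; [apply: Hn1|apply: IH] => //; lia.
by exists n0 => n i Hn; apply: Hn0 => //; rewrite mem_enum.
Qed.

Lemma BW_vec N (x : nat -> vec N) (t : nat -> R) M :
  (forall n, vnorm (x n) <= M) -> (forall n, Rabs (t n) <= M) ->
  exists (y : vec N) (s : R), forall e, 0 < e -> forall n0, exists n, (n0 <= n)%coq_nat /\
     vdist (x n) y < e /\ Rabs (t n - s) < e.
Proof.
move=> Hx Ht.
pose us := (t :: map (fun i n => x n i) (enum 'I_N))%SEQ.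
have Hus i : List.In (fun n => x n i) us.
  right; have : i \in enum 'I_N by rewrite mem_enum.
  elim: (enum 'I_N) => [|a s IH] //=; rewrite in_cons => /orP[/eqP ->|/IH H]; by [left|right].
have [|p [Hp1 Hp2]] := @BW_list us M.
  move=> u [<- //|]; elim: (enum 'I_N) => [|a s IH] //= [<- n|/IH //].
  exact: Rle_trans (coord_le _ _) (Hx n).
have [s Hs] := Hp2 t (or_introl (erefl t)).
pose y : vec N := fun i => epsilon (inhabits 0) (fun l => Un_cv (fun n => x (p n) i) l).
have Hy i : Un_cv (fun n => x (p n) i) (y i).
  exact: (epsilon_spec (inhabits 0) (fun l => Un_cv (fun n => x (p n) i) l) (Hp2 _ (Hus i))).
exists y, s => e He n0.
have HN : 0 <= INR N := pos_INR N.
have He' : 0 < e / (2 * (INR N + 1)) by apply: Rdiv_lt_0_compat; lra.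
have [n1 Hn1] := Un_cv_finite (u := fun n => x (p n)) Hy He'.
have [n2 Hn2] := Hs e He.
have Hp n : (n <= p n)%coq_nat by elim: n => [|n IH]; [lia|have := Hp1 n; lia].
pose n := max n0 (max n1 n2); exists (p n); split; last split.
- by have := Hp n; rewrite /n; lia.
- have : vdist (x (p n)) y <= (INR N + 1) * (e / (2 * (INR N + 1))).
    apply: vnorm_le_coord; first by lra.
    by move=> i; left; apply: Hn1; rewrite /n; lia.
  have -> : (INR N + 1) * (e / (2 * (INR N + 1))) = e / 2 by field; lra.
  lra.
by apply: Hn2; rewrite /n; lia.
Qed.

(* Composing with [atan] makes the supremum finite before compactness is used. *)
Lemma EVT_max N (K : vec N -> R -> Prop) (f : vec N -> R -> R) M :
  (exists x t, K x t) -> (forall x t, K x t -> vnorm x <= M /\ Rabs t <= M) ->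
  (forall x t, (forall e, 0 < e -> exists y s, K y s /\ vdist y x < e /\ Rabs (s - t) < e) -> K x t) ->
  cont_on2 K f ->
  exists x t, K x t /\ forall y s, K y s -> f y s <= f x t.
Proof.
move=> [x0 [t0 H0]] HM Hcl Hf.
pose E r := exists x t, K x t /\ r = atan (f x t).
have [||HS1 HS2] := @Sup_lub E; [by exists (atan (f x0 t0)), x0, t0| |].
  by exists (PI / 2) => r [x [t [_ ->]]]; have := atan_bound (f x t); lra.
set m := Sup E in HS1 HS2.
have He n : 0 < / (INR n + 1) by apply: Rinv_0_lt_compat; have := pos_INR n; lra.
have Hn n : exists q : vec N * R, K q.1 q.2 /\ m - / (INR n + 1) < atan (f q.1 q.2).
  apply: NNPP => H; have : m <= m - / (INR n + 1).
    apply: HS2 => r [x [t [Hxt ->]]]; apply: Rnot_lt_le => Hl.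
    by apply: H; exists (x, t).
  by have := He n; lra.
pose q n := epsilon (inhabits (x0, t0)) (fun q : vec N * R => K q.1 q.2 /\ m - / (INR n + 1) < atan (f q.1 q.2)).
have Hq n : K (q n).1 (q n).2 /\ m - / (INR n + 1) < atan (f (q n).1 (q n).2).
  exact: (epsilon_spec (inhabits (x0, t0)) (fun q : vec N * R => K q.1 q.2 /\ m - / (INR n + 1) < atan (f q.1 q.2)) (Hn n)).
have [||x [t Hxt]] := @BW_vec N (fun n => (q n).1) (fun n => (q n).2) M.
- by move=> n; have [] := HM _ _ (Hq n).1.
- by move=> n; have [] := HM _ _ (Hq n).1.
have Kxt : K x t.
  apply: Hcl => e He'; have [n [_ Hn']] := Hxt e He' O.
  by exists (q n).1, (q n).2; split => //; have [] := Hq n.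
suff Hm : m <= atan (f x t).
  exists x, t; split => // y s Hys; apply: Rnot_lt_le => /atan_increasing.
  suff : atan (f y s) <= m by lra.
  by apply: HS1; exists y, s.
apply: Rnot_lt_le => Hlt; pose r := (m - atan (f x t)) / 3.
have [d [Hd1 Hd2]] : exists d, 0 < d /\ forall z, Rabs (z - f x t) < d -> Rabs (atan z - atan (f x t)) < r.
  have Hr : r > 0 by rewrite /r; lra.
  have [d [Hd1 Hd2]] := derivable_continuous_pt _ _ (derivable_pt_atan (f x t)) r Hr.
  exists d; split => // z Hz; case: (Req_dec z (f x t)) => [->|Hne].
    by rewrite Rminus_diag Rabs_R0; lra.
  by apply: Hd2; split => //; split => //; apply: not_eq_sym.
have [d' [Hd1' Hd2']] := Hf x t Kxt d Hd1.
have [|n0 [Hn0 Hn0']] := archimed_cor1 r; first by rewrite /r; lra.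
have [n [Hn1 [Hn2 Hn3]]] := Hxt d' Hd1' n0.
have := Hd2 _ (Hd2' _ _ (Hq n).1 Hn2 Hn3).
have := (Hq n).2.
have : / (INR n + 1) < r.
  apply: Rle_lt_trans Hn0; apply: Rinv_le_contravar; first exact: lt_0_INR.
  by have := le_INR _ _ Hn1; lra.
rewrite /r /Rabs; case: Rcase_abs; lra.
Qed.

Lemma EVT_min N (K : vec N -> R -> Prop) (f : vec N -> R -> R) M :
  (exists x t, K x t) -> (forall x t, K x t -> vnorm x <= M /\ Rabs t <= M) ->
  (forall x t, (forall e, 0 < e -> exists y s, K y s /\ vdist y x < e /\ Rabs (s - t) < e) -> K x t) ->
  cont_on2 K f ->
  exists x t, K x t /\ forall y s, K y s -> f x t <= f y s.
Proof.
move=> H1 H2 H3 H4.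
have [|x [t [Hx H]]] := @EVT_max N K (fun x t => - f x t) M H1 H2 H3.
  move=> x t Hx e He; have [d [Hd Hd']] := H4 x t Hx e He; exists d; split => // y s Hy Hyx Hs.
  have -> : - f y s - - f x t = - (f y s - f x t) by ring.
  by rewrite Rabs_Ropp; apply: Hd'.
by exists x, t; split => // y s /H; lra.
Qed.

(** * Second differences of test functions *)

Lemma cont_on2_sub N (S S' : vec N -> R -> Prop) f :
  (forall x t, S x t -> S' x t) -> cont_on2 S' f -> cont_on2 S f.
Proof.
move=> H Hf x t Hxt e He; have [d [Hd Hd']] := Hf x t (H _ _ Hxt) e He.
by exists d; split => // y s Hys; apply: Hd'; apply: H.
Qed.

Lemma cont_on2_op2 N (S : vec N -> R -> Prop) (F : R -> R -> R) f g :
  (forall a b e, 0 < e -> exists d, 0 < d /\ forall a' b',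
     Rabs (a' - a) < d -> Rabs (b' - b) < d -> Rabs (F a' b' - F a b) < e) ->
  cont_on2 S f -> cont_on2 S g -> cont_on2 S (fun x t => F (f x t) (g x t)).
Proof.
move=> HF Hf Hg x t Hxt e He; have [d [Hd HFd]] := HF (f x t) (g x t) e He.
have [d1 [Hd1 H1]] := Hf x t Hxt d Hd; have [d2 [Hd2 H2]] := Hg x t Hxt d Hd.
exists (Rmin d1 d2); split; first exact: Rmin_pos.
move=> y s Hys Hy Hs; have := Rmin_l d1 d2; have := Rmin_r d1 d2 => ? ?.
by apply: HFd; [apply: H1|apply: H2] => //; lra.
Qed.

Lemma cont_on2_const N (S : vec N -> R -> Prop) c : cont_on2 S (fun _ _ => c).
Proof.
by move=> x t _ e He; exists 1; split; [lra|move=> *; rewrite Rminus_diag Rabs_R0].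
Qed.

Lemma cont_on2_plus N (S : vec N -> R -> Prop) f g :
  cont_on2 S f -> cont_on2 S g -> cont_on2 S (fun x t => f x t + g x t).
Proof.
apply: cont_on2_op2 => a b e He; exists (e / 2); split; first lra.
move=> a' b'; rewrite /Rabs; do !case: Rcase_abs; lra.
Qed.

Lemma cont_on2_minus N (S : vec N -> R -> Prop) f g :
  cont_on2 S f -> cont_on2 S g -> cont_on2 S (fun x t => f x t - g x t).
Proof.
apply: (cont_on2_op2 (F := Rminus)) => a b e He; exists (e / 2); split; first lra.
move=> a' b'; rewrite /Rabs; do !case: Rcase_abs; lra.
Qed.

Lemma cont_on2_max N (S : vec N -> R -> Prop) f g :
  cont_on2 S f -> cont_on2 S g -> cont_on2 S (fun x t => Rmax (f x t) (g x t)).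
Proof.
apply: cont_on2_op2 => a b e He; exists e; split => // a' b'.
rewrite /Rabs /Rmax; do !case: Rcase_abs; do !case: Rle_dec; lra.
Qed.

Lemma cont_on2_mult N (S : vec N -> R -> Prop) f g :
  cont_on2 S f -> cont_on2 S g -> cont_on2 S (fun x t => f x t * g x t).
Proof.
apply: cont_on2_op2 => a b e He.
have Ha := Rabs_pos a; have Hb := Rabs_pos b.
pose K := Rabs a + Rabs b + 1.
exists (Rmin 1 (e / K)); split.
  by apply: Rmin_pos; [lra|apply: Rdiv_lt_0_compat; rewrite /K; lra].
move=> a' b' H1 H2.
have L1 := Rmin_l 1 (e / K); have L2 := Rmin_r 1 (e / K).
have -> : a' * b' - a * b = (a' - a) * b + a * (b' - b) + (a' - a) * (b' - b) by ring.
set d := Rmin _ _ in H1 H2 L1 L2.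
have Hd : d * K <= e.
  have -> : e = e / K * K by field; rewrite /K; lra.
  by apply: Rmult_le_compat_r => //; rewrite /K; lra.
apply: Rle_lt_trans (Rabs_triang _ _) _; rewrite !Rabs_mult.
have := Rabs_triang ((a' - a) * b) (a * (b' - b)); rewrite !Rabs_mult => T.
apply: Rle_lt_trans (Rplus_le_compat_r _ _ _ T) _.
apply: Rlt_le_trans Hd; rewrite /K.
have P1 := Rabs_pos (a' - a); have P2 := Rabs_pos (b' - b).
by nra.
Qed.

Lemma cont_on2_comp N (S : vec N -> R -> Prop) (F : R -> R) f :
  continuity F -> cont_on2 S f -> cont_on2 S (fun x t => F (f x t)).
Proof.
move=> HF Hf; apply: (cont_on2_op2 (F := fun a _ => F a) _ Hf Hf) => a b e He.
have [d [Hd Hd']] := HF a e He; exists d; split => // a' _ Ha _.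
case: (Req_dec a' a) => [->|Hne]; first by rewrite Rminus_diag Rabs_R0.
by apply: Hd'; split => //; split => //; apply: not_eq_sym.
Qed.

Lemma cont_on2_coord N (S : vec N -> R -> Prop) i : cont_on2 S (fun x _ => x i).
Proof.
move=> x t _ e He; exists e; split => // y s _ Hy _.
by apply: Rle_lt_trans Hy; apply: vdist_coord.
Qed.

Lemma cont_on2_time N (S : vec N -> R -> Prop) f : continuity f -> cont_on2 S (fun _ t => f t).
Proof.
move=> Hf; apply: (cont_on2_comp Hf) => x t _ e He.
by exists e; split => // y s _ _ Hs.
Qed.

Lemma cont_on2_sum N n (S : vec N -> R -> Prop) (f : 'I_n -> vec N -> R -> R) :
  (forall i, cont_on2 S (f i)) -> cont_on2 S (fun x t => sumI (fun i => f i x t)).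
Proof.
move=> Hf; rewrite /sumI; elim: (enum _) => [|a l IH] /=; first exact: cont_on2_const.
exact: cont_on2_plus.
Qed.

Lemma cont_on_static N (S : vec N -> Prop) (K : vec N -> R -> Prop) f :
  (forall x t, K x t -> S x) -> cont_on S f -> cont_on2 K (fun x _ => f x).
Proof.
move=> H Hf x t Hx e He; have [d [Hd Hd']] := Hf x (H _ _ Hx) e He.
by exists d; split => // y s /H Hy Hyx _; apply: Hd'.
Qed.

Lemma cont_on_slice N (S : vec N -> Prop) (K : vec N -> R -> Prop) (f : vec N -> R -> R) t :
  (forall x, S x -> K x t) -> cont_on2 K f -> cont_on S (fun x => f x t).
Proof.
move=> H Hf x Hx e He; have [d [Hd Hd']] := Hf x t (H _ Hx) e He.
exists d; split => // y Hy Hyx; apply: Hd' => //; first exact: H.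
by rewrite Rminus_diag Rabs_R0.
Qed.

Lemma mvt (f f' : R -> R) a b : (forall c, derivable_pt_lim f c (f' c)) ->
  exists c, f b - f a = f' c * (b - a) /\ Rabs (c - a) <= Rabs (b - a).
Proof.
move=> H; case: (Rtotal_order a b) => [Hab|[->|Hab]].
- have [c [Hc1 Hc2]] := MVT_cor2 f f' a b Hab (fun c _ => H c).
  by exists c; split => //; rewrite !Rabs_pos_eq; lra.
- by exists b; rewrite !Rminus_diag; split; lra.
have [c [Hc1 Hc2]] := MVT_cor2 f f' b a Hab (fun c _ => H c).
exists c; split; last by rewrite !Rabs_left1; lra.
have -> : f b - f a = - (f a - f b) by ring.
by rewrite Hc1; ring.
Qed.

(** * Differential calculus from continuous partial derivatives *)

Section Calculus.
Context (N : nat).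
Implicit Types (f : vec N -> R) (x v : vec N).

Lemma partial_line f F i x s : (forall y, has_partial f i y (F y)) ->
  derivable_pt_lim (fun r => f (vadd x (vscale r (ebasis i)))) s (F (vadd x (vscale s (ebasis i)))).
Proof.
move=> H e He; have [d Hd] := H (vadd x (vscale s (ebasis i))) e He; exists d => h Hh Hhd.
have := Hd h Hh Hhd; rewrite vadd0 Rplus_0_l.
have -> : vadd (vadd x (vscale s (ebasis i))) (vscale h (ebasis i))
   = vadd x (vscale (s + h) (ebasis i)).
  by vec_ring.
by [].
Qed.

(** Continuous partial derivatives give differentiability: go from x to x + v one coordinate at a
    time and use the mean value theorem on each leg. This produces the error in the l1 norm of v. *)
Lemma differential f (F : 'I_N -> vec N -> R) x e :
  (forall i y, has_partial f i y (F i y)) -> (forall i, cont_on (fun _ => True) (F i)) -> 0 < e ->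
  exists d, 0 < d /\ forall v, vnorm v < d ->
    Rabs (f (vadd x v) - f x - sumI (fun i => v i * F i x)) <= e * sumI (fun i => Rabs (v i)).
Proof.
move=> Hf HF He.
have [d [Hd HFd]] : exists d, 0 < d /\ forall i y, vdist y x < d -> Rabs (F i y - F i x) < e.
  have [d [Hd H]] : exists d, 0 < d /\ forall i, i \in enum 'I_N -> forall y, vdist y x < d -> Rabs (F i y - F i x) < e.
    elim: (enum _) => [|a l [d [Hd IH]]]; first by exists 1; split; [lra|].
    have [d' [Hd' H]] := HF a x I e He.
    exists (Rmin d d'); split; first exact: Rmin_pos.
    have := Rmin_l d d'; have := Rmin_r d d' => ? ? i; rewrite in_cons => /orP[/eqP -> |Hi] y Hy.
      by apply: H => //; lra.
    by apply: IH => //; lra.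
  by exists d; split => // i; apply: H; rewrite mem_enum.
exists d; split => // v Hv.
(* The point reached once the coordinates in [l] have been moved. *)
pose tr (l : seq 'I_N) : vec N := fun i => if i \in l then v i else 0.
have trn l : vnorm (tr l) <= vnorm v.
  apply: sqrt_le_1_alt; apply: sumI_le => i; rewrite /tr; case: (i \in l); nra.
have key (l : seq 'I_N) : uniq l ->
    Rabs (f (vadd x (tr l)) - f x - List.fold_right Rplus 0 (List.map (fun i => v i * F i x) l))
    <= e * List.fold_right Rplus 0 (List.map (fun i => Rabs (v i)) l).
  elim: l => [|a l IH] /=.
    have -> : vadd x (tr [::]) = x by apply: functional_extensionality => i; rewrite /vadd /tr /=; lra.
    by move=> _; rewrite Rminus_diag Rminus_0_r Rabs_R0; lra.
  move=> /andP[Ha /IH {}IH].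
  pose p := vadd x (tr l).
  have [c [Hc1 Hc2]] := mvt 0 (v a) (fun s => @partial_line f (F a) a p s (Hf a)).
  have E : vadd x (tr (a :: l)) = vadd p (vscale (v a) (ebasis a)).
    apply: functional_extensionality => i; rewrite /p /vadd /tr /vscale /ebasis in_cons.
    case: eqP => [->|_] /=; last lra.
    by rewrite (negbTE Ha); lra.
  rewrite E; move: Hc1; rewrite vadd0 Rminus_0_r => Hc1.
  set q := vadd p (vscale c (ebasis a)) in Hc1.
  (* The intermediate point differs from x by at most |v i| in every coordinate, hence lies within
     vnorm v < d of x. *)
  have Hq : Rabs (F a q - F a x) < e.
    apply: HFd; apply: Rle_lt_trans Hv.
    apply: sqrt_le_1_alt; apply: sumI_le => i.
    rewrite /q /p /vsub /vadd /tr /vscale /ebasis; rewrite !Rminus_0_r in Hc2.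
    case: eqP => [->|_].
      rewrite (negbTE Ha).
      have -> : x a + 0 + c * 1 - x a = c by ring.
      by rewrite -(Rabs_pos_eq (c * c)) ?Rabs_mult; [have := Rabs_pos c;
        have : v a * v a = Rabs (v a) * Rabs (v a) by rewrite -Rabs_mult Rabs_pos_eq //; nra|]; nra.
    by case: (i \in l); nra.
  have -> : f (vadd p (vscale (v a) (ebasis a))) = f p + F a q * v a by lra.
  set S := List.fold_right _ _ _ in IH *; set S' := List.fold_right _ _ _ in IH *.
  have -> : f p + F a q * v a - f x - (v a * F a x + S) = (f p - f x - S) + (F a q - F a x) * v a by ring.
  apply: Rle_trans (Rabs_triang _ _) _; rewrite Rabs_mult Rmult_plus_distr_l Rplus_comm.
  by apply: Rplus_le_compat => //; apply: Rmult_le_compat_r; [exact: Rabs_pos|lra].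
have := key (enum 'I_N) (enum_uniq _).
have -> : vadd x (tr (enum 'I_N)) = vadd x v.
  by apply: functional_extensionality => i; rewrite /vadd /tr mem_enum.
by [].
Qed.

Lemma sumI_abs_le_norm v : sumI (fun i => Rabs (v i)) <= INR N * vnorm v.
Proof. by apply: sumI_const_le => i; apply: coord_le. Qed.

(** [C2_hess] states continuity for second derivatives only; this lemma passes it down to the
    gradient and then to the function. *)
Lemma partial_continuous f (F : 'I_N -> vec N -> R) :
  (forall i y, has_partial f i y (F i y)) -> (forall i, cont_on (fun _ => True) (F i)) ->
  cont_on (fun _ => True) f.
Proof.
move=> Hf HF x _ e He; have [d [Hd H]] := differential x Hf HF Rlt_0_1.
pose K := sumI (fun i => Rabs (F i x)).
have HK : 0 <= K by apply: sumI_ge0 => i; exact: Rabs_pos.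
have HN := pos_INR N.
have HC : 0 < (K + INR N + 1) by lra.
exists (Rmin d (e / (K + INR N + 1))); split.
  by apply: Rmin_pos => //; apply: Rdiv_lt_0_compat.
have := Rmin_l d (e / (K + INR N + 1)); have := Rmin_r d (e / (K + INR N + 1)) => L1 L2 y _ Hy.
have E : y = vadd x (vsub y x) by vec_ring.
have Hv : vnorm (vsub y x) < d by rewrite -/(vdist y x); lra.
have := H _ Hv; rewrite -E; set S := sumI _; set S' := sumI _ => H1.
have HS' : S' <= INR N * vdist y x by exact: sumI_abs_le_norm.
have HS : Rabs S <= K * vdist y x.
  apply: Rle_trans (sumI_abs _) _; rewrite /K Rmult_comm -sumI_scal; apply: sumI_le => i.
  by rewrite Rabs_mult; apply: Rmult_le_compat_r; [exact: Rabs_pos|exact: vdist_coord].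
have -> : f y - f x = (f y - f x - S) + S by ring.
apply: Rle_lt_trans (Rabs_triang _ _) _.
have Hd0 := vdist_ge0 y x.
have : (K + INR N + 1) * vdist y x < e.
  have -> : e = (K + INR N + 1) * (e / (K + INR N + 1)) by field; lra.
  by apply: Rmult_lt_compat_l => //; lra.
nra.
Qed.

Lemma directional f (F : 'I_N -> vec N -> R) x v s :
  (forall i y, has_partial f i y (F i y)) -> (forall i, cont_on (fun _ => True) (F i)) ->
  derivable_pt_lim (fun r => f (vadd x (vscale r v))) s
     (sumI (fun i => v i * F i (vadd x (vscale s v)))).
Proof.
move=> Hf HF e He; set p := vadd x (vscale s v).
pose C := sumI (fun i => Rabs (v i)) + 1.
have HC : 1 <= C by have : 0 <= sumI (fun i => Rabs (v i)); [apply: sumI_ge0 => i; exact: Rabs_pos|rewrite /C; lra].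
have He' : 0 < e / (2 * C) by apply: Rdiv_lt_0_compat; lra.
have [d [Hd H]] := differential p Hf HF He'.
have Hn := vnorm_ge0 v.
have Hd' : 0 < d / (vnorm v + 1) by apply: Rdiv_lt_0_compat; lra.
exists (mkposreal _ Hd') => h Hh /= Hhd.
have -> : vadd x (vscale (s + h) v) = vadd p (vscale h v).
  by apply: functional_extensionality => k; rewrite /p /vadd /vscale; ring.
have Hv : vnorm (vscale h v) < d.
  rewrite vnorm_scale.
  have : Rabs h * (vnorm v + 1) < d.
    have -> : d = d / (vnorm v + 1) * (vnorm v + 1) by field; lra.
    by apply: Rmult_lt_compat_r; lra.
  by have := Rabs_pos_lt h Hh; nra.
have := H _ Hv.
have -> : sumI (fun i => vscale h v i * F i p) = h * sumI (fun i => v i * F i p).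
  by rewrite -sumI_scal; apply: sumI_ext => i; rewrite /vscale; ring.
have -> : sumI (fun i => Rabs (vscale h v i)) = Rabs h * (C - 1).
  have -> : C - 1 = sumI (fun i => Rabs (v i)) by rewrite /C; ring.
  by rewrite -sumI_scal; apply: sumI_ext => i; rewrite /vscale Rabs_mult.
set S := sumI _ => H1.
have -> : (f (vadd p (vscale h v)) - f p) / h - S = (f (vadd p (vscale h v)) - f p - h * S) / h by field.
rewrite /Rdiv Rabs_mult Rabs_inv.
have Hp := Rabs_pos_lt h Hh.
apply: (Rmult_lt_reg_r (Rabs h)) => //.
rewrite Rmult_assoc Rinv_l ?Rmult_1_r; last lra.
apply: Rle_lt_trans H1 _.
have -> : e / (2 * C) * (Rabs h * (C - 1)) = e * Rabs h * ((C - 1) / (2 * C)) by field; lra.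
have : (C - 1) / (2 * C) < 1.
  apply: (Rmult_lt_reg_r (2 * C)); first lra.
  by rewrite /Rdiv Rmult_assoc Rinv_l; lra.
have : 0 < e * Rabs h by apply: Rmult_lt_0_compat.
nra.
Qed.

(** Symmetric second difference. First order terms cancel, so functions that touch at x can be
    compared through it without knowing their gradients. *)
Definition sd f x v : R := f (vadd x v) + f (vsub x v) - 2 * f x.

Lemma derivable_sum n (g g' : 'I_n -> R -> R) s :
  (forall i, derivable_pt_lim (g i) s (g' i s)) ->
  derivable_pt_lim (fun r => sumI (fun i => g i r)) s (sumI (fun i => g' i s)).
Proof.
move=> H; rewrite /sumI; elim: (enum _) => [|a l IH] /=; first exact: derivable_pt_lim_const.
exact: derivable_pt_lim_plus.
Qed.

(** The mean value theorem is used twice: on [0, r] for the even function [g], which already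
    contains the expected quadratic term, and on [- s1, s1] for the directional derivative. *)
Lemma sd_limit f H x v e : C2_hess f H -> 0 < e ->
  exists d, 0 < d /\ forall r, 0 < r < d ->
    Rabs (sd f x (vscale r v) - r * r * form (H x) v) <= e * (r * r).
Proof.
move=> [G [HG [HH cH]]] He.
pose h' s := sumI (fun i => v i * G i (vadd x (vscale s v))).
pose h'' s := form (H (vadd x (vscale s v))) v.
have cG i : cont_on (fun _ => True) (G i).
  by apply: (@partial_continuous (G i) (fun k y => H y i k)) => [k y|k]; [exact: HH|exact: cH].
have D1 s : derivable_pt_lim (fun r => f (vadd x (vscale r v))) s (h' s).
  exact: directional.
have D2 s : derivable_pt_lim h' s (h'' s).
  rewrite /h'' /form /dot /matvec.
  apply: (derivable_sum (g' := fun i s => sumI (fun k => H (vadd x (vscale s v)) i k * v k) * v i)) => i; rewrite Rmult_comm; apply: derivable_pt_lim_scal.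
  rewrite (sumI_ext (g := fun k => v k * H (vadd x (vscale s v)) i k)); last by move=> k; ring.
  by apply: (@directional (G i) (fun k y => H y i k)) => [k y|k]; [exact: HH|exact: cH].
have C2 : exists d, 0 < d /\ forall s, Rabs s < d -> Rabs (h'' s - form (H x) v) < e / 2.
  have [d [Hd Hd']] : exists d, 0 < d /\ forall y, True -> vdist y x < d -> Rabs (form (H y) v - form (H x) v) < e / 2.
    suff : cont_on (fun _ => True) (fun y => form (H y) v) by move=> /(_ x I (e / 2)); apply; lra.
    apply: (@cont_on_slice N _ (fun _ _ => True) (fun y _ => form (H y) v) 0) => //.
    apply: cont_on2_sum => i; apply: cont_on2_mult; last exact: cont_on2_const.
    apply: cont_on2_sum => k; apply: cont_on2_mult; last exact: cont_on2_const.
    exact: (@cont_on_static N (fun _ => True)).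
  have Hn := vnorm_ge0 v.
  exists (d / (vnorm v + 1)); split; first by apply: Rdiv_lt_0_compat; lra.
  move=> s Hs; apply: Hd' => //; rewrite vdist_addr vnorm_scale.
  have : Rabs s * (vnorm v + 1) < d.
    have -> : d = d / (vnorm v + 1) * (vnorm v + 1) by field; lra.
    by apply: Rmult_lt_compat_r; lra.
  by have := Rabs_pos s; nra.
have [d [Hd HC]] := C2; exists d; split => // r Hr.
pose c := form (H x) v.
pose g s := f (vadd x (vscale s v)) + f (vadd x (vscale (- s) v)) - s * s * c.
  have Dg s : derivable_pt_lim g s (h' s + h' (- s) * - 1 - 2 * s * c).
    apply: derivable_pt_lim_minus; first apply: derivable_pt_lim_plus => //.
      apply: (derivable_pt_lim_comp (fun s => - s) (fun r => f (vadd x (vscale r v)))) => //.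
      by rewrite -[X in derivable_pt_lim _ _ X]/(- (1)); apply: derivable_pt_lim_opp; exact: derivable_pt_lim_id.
    rewrite (_ : 2 * s * c = (1 * s + s * 1) * c + s * s * 0); last ring.
    apply: derivable_pt_lim_mult; last exact: derivable_pt_lim_const.
    by apply: derivable_pt_lim_mult; exact: derivable_pt_lim_id.
  have [s1 [E1 Hs1]] := MVT_cor2 g _ 0 r (proj1 Hr) (fun s _ => Dg s).
(* The symmetric interval turns h'(s1) - h'(- s1) into 2 s1 h''(s2); with 0 < s1 < r the total error
   is at most 2 r s1 (e / 2) <= e r^2. *)
have [|s2 [E2 Hs2]] := MVT_cor2 h' h'' (- s1) s1 _ (fun s _ => D2 s); first lra.
have E : sd f x (vscale r v) - r * r * c = 2 * r * s1 * (h'' s2 - c).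
  have -> : 2 * r * s1 * (h'' s2 - c) = g r - g 0 by rewrite E1; nra.
  rewrite /g /sd Ropp_0 !vadd0.
  have -> : vsub x (vscale r v) = vadd x (vscale (- r) v).
    by vec_ring.
  ring.
rewrite E Rabs_mult Rabs_pos_eq; last nra.
have := HC s2 => /(_ _)/Rlt_le.
have Hs : Rabs s2 < d by rewrite /Rabs; case: Rcase_abs; lra.
move=> /(_ Hs) K; apply: Rle_trans (Rmult_le_compat_l _ _ _ _ K) _; first nra.
have : 0 <= e * r * (r - s1) by apply: Rmult_le_pos; nra.
lra.
Qed.
End Calculus.

Section SecondDifferences.
Context (N : nat).
Implicit Types (f g : vec N -> R) (x v : vec N).

(* Viscosity inequalities without Hessians: [sdle j f x m] (resp. [sdge (N + 1 - j) f x m])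
   bounds [Lam (D^2 phi x)] by [m] from above (resp. below) for every [C^2] function
   [phi] touching [f] at [x] from below (resp. above). *)
Definition sdle (n : nat) f x (m : R) : Prop :=
  exists V, dim_ge n V /\ exists d, 0 < d /\
    forall v, V v -> vnorm v < d -> sd f x v <= m * dot v v.
Definition sdge (n : nat) f x (m : R) : Prop :=
  exists V, dim_ge n V /\ exists d, 0 < d /\
    forall v, V v -> vnorm v < d -> m * dot v v <= sd f x v.

Lemma vdist_subr x v : vdist (vsub x v) x = vnorm v.
Proof.
have -> : vsub x v = vadd x (vscale (-1) v) by exact: vsubE.
by rewrite vdist_addr vnorm_scale Rabs_Ropp Rabs_R1 Rmult_1_l.
Qed.

Lemma sdle_touch n f g x m : sdle n f x m ->
  (exists d, 0 < d /\ forall y, vdist y x < d -> g y - g x <= f y - f x) -> sdle n g x m.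
Proof.
move=> [V [HV [d [Hd H]]]] [d' [Hd' H']]; exists V; split => //.
exists (Rmin d d'); split; first exact: Rmin_pos.
have := Rmin_l d d'; have := Rmin_r d d' => ? ? v Vv Hv.
apply: Rle_trans (H v Vv _); last lra.
have H1 := H' (vadd x v); have H2 := H' (vsub x v).
rewrite vdist_addr in H1; rewrite vdist_subr in H2; rewrite /sd.
have := H1 ltac:(lra); have := H2 ltac:(lra); lra.
Qed.

Lemma sd_opp f x v : sd (fun y => - f y) x v = - sd f x v.
Proof. rewrite /sd; ring. Qed.

Lemma sdle_opp n f x m : sdle n f x m <-> sdge n (fun y => - f y) x (- m).
Proof.
split=> -[V [HV [d [Hd H]]]]; exists V; split => //; exists d; split => // v Vv Hv;
 have := H v Vv Hv; rewrite sd_opp; lra.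
Qed.

Lemma sdge_touch n f g x m : sdge n f x m ->
  (exists d, 0 < d /\ forall y, vdist y x < d -> f y - f x <= g y - g x) -> sdge n g x m.
Proof.
move=> [V [HV [d [Hd H]]]] [d' [Hd' H']]; exists V; split => //.
exists (Rmin d d'); split; first exact: Rmin_pos.
have := Rmin_l d d'; have := Rmin_r d d' => ? ? v Vv Hv.
apply: Rle_trans (H v Vv _) _; first lra.
have H1 := H' (vadd x v); have H2 := H' (vsub x v).
rewrite vdist_addr in H1; rewrite vdist_subr in H2; rewrite /sd.
have := H1 ltac:(lra); have := H2 ltac:(lra); lra.
Qed.

Lemma small_multiple v d : 0 < d -> exists d', 0 < d' /\ forall r, 0 < r < d' -> vnorm (vscale r v) < d.
Proof.
move=> Hd; have Hn := vnorm_ge0 v.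
exists (d / (vnorm v + 1)); split; first by apply: Rdiv_lt_0_compat; lra.
move=> r Hr; rewrite vnorm_scale Rabs_pos_eq; last lra.
have : r * (vnorm v + 1) < d.
  have -> : d = d / (vnorm v + 1) * (vnorm v + 1) by field; lra.
  by apply: Rmult_lt_compat_r; lra.
nra.
Qed.

Lemma form_cmp_sd f1 H1 f2 H2 x v m : C2_hess f1 H1 -> C2_hess f2 H2 ->
  (exists d, 0 < d /\ forall r, 0 < r < d ->
     sd f1 x (vscale r v) <= sd f2 x (vscale r v) + m * (r * r)) ->
  form (H1 x) v <= form (H2 x) v + m.
Proof.
move=> C1 C2 [d [Hd H]]; apply: Rnot_lt_le => Hlt.
(* A third of the excess: the two expansions cost e r^2 each and leave a contradiction. *)
pose e := (form (H1 x) v - form (H2 x) v - m) / 3.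
have He : 0 < e by rewrite /e; lra.
have [d1 [Hd1 K1]] := sd_limit x v C1 He; have [d2 [Hd2 K2]] := sd_limit x v C2 He.
pose r := Rmin d (Rmin d1 d2) / 2.
have := Rmin_l d (Rmin d1 d2); have := Rmin_r d (Rmin d1 d2).
have := Rmin_l d1 d2; have := Rmin_r d1 d2.
have : 0 < Rmin d (Rmin d1 d2) by do !apply: Rmin_pos.
move=> ? ? ? ? ?.
have := H r ltac:(rewrite /r; lra); have := K1 r ltac:(rewrite /r; lra).
have := K2 r ltac:(rewrite /r; lra).
have Hr : 0 < r * r by rewrite /r; nra.
move=> /Rabs_le_both [_ L2] /Rabs_le_both [L1 _] L.
have : form (H1 x) v * (r * r) <= (form (H2 x) v + m + 2 * e) * (r * r) by nra.
move=> /(Rmult_le_reg_r _ _ _ Hr); rewrite /e; lra.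
Qed.

Lemma C2_hess_const c : C2_hess (fun _ : vec N => c) (fun _ _ _ => 0).
Proof.
exists (fun _ _ => 0); split; last split; try by move=> *; exact: derivable_pt_lim_const.
by move=> i k x _ e He; exists 1; split; [lra|move=> *; rewrite Rminus_diag Rabs_R0].
Qed.

Lemma form0 v : form (fun _ _ => 0) v = 0.
Proof.
apply: sumI_0 => i; rewrite /matvec sumI_0; first ring.
move=> k; ring.
Qed.

Lemma form_le_sd f H x v m : C2_hess f H ->
  (exists d, 0 < d /\ forall r, 0 < r < d -> sd f x (vscale r v) <= m * (r * r)) ->
  form (H x) v <= m.
Proof.
move=> C [d [Hd K]].
have := @form_cmp_sd f H _ _ x v m C (C2_hess_const 0).
rewrite form0 Rplus_0_l; apply; exists d; split => // r Hr.
by have := K r Hr; rewrite /(sd (fun=> 0)); lra.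
Qed.

Lemma form_ge_sd f H x v m : C2_hess f H ->
  (exists d, 0 < d /\ forall r, 0 < r < d -> m * (r * r) <= sd f x (vscale r v)) ->
  m <= form (H x) v.
Proof.
move=> C [d [Hd K]].
have := @form_cmp_sd _ _ f H x v (- m) (C2_hess_const 0) C.
rewrite form0 => K2; suff: 0 <= form (H x) v + - m by lra.
apply: K2; exists d; split => // r Hr.
by have := K r Hr; rewrite /(sd (fun=> 0)); lra.
Qed.

Lemma dot_scale2 r v : dot (vscale r v) (vscale r v) = r * r * dot v v.
Proof. by rewrite dot_scall dot_scalr; ring. Qed.

Lemma sdle_test j Lam f H x m : elliptic j Lam -> C2_hess f H -> sdle j f x m -> Lam (H x) <= m.
Proof.
move=> HL C [V [[u [Hu HV]] [d [Hd K]]]].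
apply: (ell_up HL (v := u)) => // c.
apply: form_le_sd C _; have [d' [Hd' Hsm]] := small_multiple (lincomb u c) Hd.
exists d'; split => // r Hr.
have -> : m * dot (lincomb u c) (lincomb u c) * (r * r) =
   m * dot (vscale r (lincomb u c)) (vscale r (lincomb u c)) by rewrite dot_scale2; ring.
by apply: K; [rewrite -lincomb_scale; exact: HV|exact: Hsm].
Qed.

Lemma sdge_test j Lam f H x m : (j <= N.+1)%nat -> elliptic j Lam -> C2_hess f H ->
  sdge (N.+1 - j) f x m -> m <= Lam (H x).
Proof.
move=> Hj HL C [V [[u [Hu HV]] [d [Hd K]]]].
apply: (ell_lo HL (v := u)) => //; first by rewrite subnK.
move=> c; apply: form_ge_sd C _; have [d' [Hd' Hsm]] := small_multiple (lincomb u c) Hd.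
exists d'; split => // r Hr.
have -> : m * dot (lincomb u c) (lincomb u c) * (r * r) =
   m * dot (vscale r (lincomb u c)) (vscale r (lincomb u c)) by rewrite dot_scale2; ring.
by apply: K; [rewrite -lincomb_scale; exact: HV|exact: Hsm].
Qed.

Lemma op_cmp_sd j Lam f1 H1 f2 H2 x m : elliptic j Lam -> C2_hess f1 H1 -> C2_hess f2 H2 ->
  (exists d, 0 < d /\ forall v, vnorm v < d -> sd f1 x v <= sd f2 x v + m * dot v v) ->
  Lam (H1 x) <= Lam (H2 x) + m.
Proof.
move=> HL C1 C2 [d [Hd K]]; apply: (ell_cont HL) => v.
apply: form_cmp_sd C1 C2 _; have [d' [Hd' Hsm]] := small_multiple v Hd.
exists d'; split => // r Hr.
have -> : m * dot v v * (r * r) = m * dot (vscale r v) (vscale r v) by rewrite dot_scale2; ring.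
by apply: K; exact: Hsm.
Qed.

Lemma op_cmp_touch j Lam f1 H1 f2 H2 x : elliptic j Lam -> C2_hess f1 H1 -> C2_hess f2 H2 ->
  (exists d, 0 < d /\ forall y, vdist y x < d -> f1 y - f1 x <= f2 y - f2 x) ->
  Lam (H1 x) <= Lam (H2 x).
Proof.
move=> HL C1 C2 [d [Hd K]]; rewrite -[Lam (H2 x)]Rplus_0_r; apply: op_cmp_sd HL C1 C2 _.
exists d; split => // v Hv.
have L1 := K (vadd x v); have L2 := K (vsub x v).
rewrite vdist_addr in L1; rewrite vdist_subr in L2; rewrite /sd.
have := L1 ltac:(lra); have := L2 ltac:(lra); lra.
Qed.
End SecondDifferences.

(** The linear bound holds on both sides of t, so right difference quotients are at most c and left
    ones at least c. It identifies the time derivative of a test function touching a barrier that is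
    affine in time. *)
Lemma derivable_touch f t l c : derivable_pt_lim f t l ->
  (exists d, 0 < d /\ forall s, Rabs (s - t) < d -> f s - f t <= c * (s - t)) -> l = c.
Proof.
move=> Hf [d [Hd H]].
have key (e : R) : 0 < e -> Rabs (l - c) <= e.
  move=> He; have [[d' Hd'] /= K] := Hf e He.
  pose h := Rmin d d' / 2.
  have := Rmin_l d d'; have := Rmin_r d d'; have : 0 < Rmin d d' by exact: Rmin_pos.
  move=> ? ? ?; have Hh : 0 < h by rewrite /h; lra.
  have := K h ltac:(lra) ltac:(rewrite Rabs_pos_eq /h; lra).
  have := K (- h) ltac:(lra) ltac:(rewrite Rabs_Ropp Rabs_pos_eq /h; lra).
  have := H (t + h) ltac:(rewrite Rplus_minus_l Rabs_pos_eq /h; lra).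
  have := H (t + - h) ltac:(rewrite Rplus_minus_l Rabs_Ropp Rabs_pos_eq /h; lra).
  move=> L1 L2 /Rabs_def2 [L3 L4] /Rabs_def2 [L5 L6].
  have E1 : (f (t + h) - f t) / h <= c.
    apply: (Rmult_le_reg_r h) => //; rewrite /Rdiv Rmult_assoc Rinv_l; lra.
  have E2 : c <= (f (t + - h) - f t) / - h.
    have -> : (f (t + - h) - f t) / - h = (f t - f (t + - h)) / h by field; lra.
    apply: (Rmult_le_reg_r h) => //; rewrite /Rdiv Rmult_assoc Rinv_l; lra.
  by apply: Rabs_le; lra.
case: (Req_dec l c) => // Hne.
have := key (Rabs (l - c) / 2); have : 0 < Rabs (l - c) by apply: Rabs_pos_lt; lra.
lra.
Qed.

(** * Parabolic test functions *)

Section Parabolic.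
Context (N : nat).
Implicit Types (phi psi : vec N -> R -> R).

Lemma C21_slice phi H T t : C21 phi H T -> C2_hess (fun x => phi x t) (fun x => H x t).
Proof.
move=> [G [HG [HH [_ [cH _]]]]]; exists (fun i x => G i x t); split; first by move=> *; exact: HG.
split; first by move=> *; exact: HH.
by move=> i k; exact: (@cont_on_slice _ _ (fun _ _ => True) (fun x t => H x t i k)).
Qed.

Lemma C21_time phi H T x t : C21 phi H T -> derivable_pt_lim (fun s => phi x s) t (T x t).
Proof. by move=> [G [_ [_ [H1 _]]]]. Qed.

Lemma C21_plus phi H T psi H' T' : C21 phi H T -> C21 psi H' T' ->
  C21 (fun x t => phi x t + psi x t) (fun x t i k => H x t i k + H' x t i k)
    (fun x t => T x t + T' x t).
Proof.
move=> [G [A1 [A2 [A3 [A4 A5]]]]] [G' [B1 [B2 [B3 [B4 B5]]]]].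
exists (fun i x t => G i x t + G' i x t); split.
  by move=> i x t; apply: derivable_pt_lim_plus; [exact: A1|exact: B1].
split; first by move=> i k x t; apply: derivable_pt_lim_plus; [exact: A2|exact: B2].
split; first by move=> x t; apply: derivable_pt_lim_plus.
by split; [move=> i k|]; apply: cont_on2_plus.
Qed.

Lemma C21_static f H : C2_hess f H ->
  C21 (fun (x : vec N) _ => f x) (fun x _ => H x) (fun _ _ => 0).
Proof.
move=> [G [HG [HH cH]]]; exists (fun i x _ => G i x); split => //; split => //.
split; first by move=> x t; exact: derivable_pt_lim_const.
split; last exact: cont_on2_const.
by move=> i k; apply: (@cont_on_static N (fun _ => True)).
Qed.

(** Joint continuity of [phi] is not a clause of [C21]. At fixed time it follows from
    [partial_continuous] applied twice; in time, from the mean value theorem and the local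
    boundedness of [T], uniform in x. *)
Lemma C21_cont phi H T : C21 phi H T -> cont_on2 (fun _ _ => True) phi.
Proof.
move=> C x t _ e He; have [G [HG [HH [HT [cH cT]]]]] := C.
have [d1 [Hd1 K1]] := cT x t I 1 Rlt_0_1.
have cphi : cont_on (fun _ => True) (fun y => phi y t).
  apply: (@partial_continuous N _ (fun i y => G i y t)) => [i y|i]; first exact: HG.
  apply: (@partial_continuous N _ (fun k y => H y t i k)) => [k y|k]; first exact: HH.
  exact: (@cont_on_slice _ _ (fun _ _ => True) (fun x t => H x t i k)).
have [d2 [Hd2 K2]] := cphi x I (e / 2) ltac:(lra).
pose K := Rabs (T x t) + 1.
have HK : 0 < K by have := Rabs_pos (T x t); rewrite /K; lra.
have HeK : 0 < e / (2 * K) by apply: Rdiv_lt_0_compat; lra.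
exists (Rmin (e / (2 * K)) (Rmin d1 d2)); split; first by do !apply: Rmin_pos.
have := Rmin_l (e / (2 * K)) (Rmin d1 d2); have := Rmin_r (e / (2 * K)) (Rmin d1 d2).
have := Rmin_l d1 d2; have := Rmin_r d1 d2 => ? ? ? ? y s _ Hy Hs.
have [c [Hc1 Hc2]] := mvt t s (fun c => HT y c).
have -> : phi y s - phi x t = (phi y s - phi y t) + (phi y t - phi x t) by ring.
apply: Rle_lt_trans (Rabs_triang _ _) _.
have : Rabs (phi y t - phi x t) < e / 2 by apply: K2 => //; lra.
suff: Rabs (phi y s - phi y t) <= e / 2 by lra.
rewrite /= in Hc1; rewrite Hc1 Rabs_mult.
have HTc : Rabs (T y c) <= K.
  have := K1 y c I ltac:(lra) ltac:(lra) => L.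
  have := Rabs_triang (T y c - T x t) (T x t).
  have -> : T y c - T x t + T x t = T y c by ring.
  rewrite /K; lra.

have -> : e / 2 = K * (e / (2 * K)) by field; lra.
by apply: Rmult_le_compat => //; try exact: Rabs_pos; lra.
Qed.

(** Entrywise closeness of the Hessians makes the quadratic forms close, and [ell_cont] turns this
    into closeness of the operator. It lets a strict inequality at one point persist nearby. *)
Lemma C21_op_cont j Lam phi H T : elliptic j Lam -> C21 phi H T ->
  cont_on2 (fun _ _ => True) (fun x t => T x t - Lam (H x t)).
Proof.
move=> HL [G [_ [_ [_ [cH cT]]]]]; apply: cont_on2_minus => // x t _ e He.
have HN := pos_INR N.
pose e' := e / (2 * (INR N * INR N + 1)).
have He' : 0 < e' by apply: Rdiv_lt_0_compat => //; nra.
have [d [Hd K]] : exists d, 0 < d /\ forall i k y s, vdist y x < d -> Rabs (s - t) < d ->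
    Rabs (H y s i k - H x t i k) < e'.
  have [d [Hd K]] : exists d, 0 < d /\ forall p, p \in enum {: prod 'I_N 'I_N} -> forall y s, vdist y x < d -> Rabs (s - t) < d ->
    Rabs (H y s p.1 p.2 - H x t p.1 p.2) < e'.
    elim: (enum _) => [|a l [d [Hd IH]]]; first by exists 1; split; [lra|].
    have [d' [Hd' K]] := cH a.1 a.2 x t I e' He'.
    exists (Rmin d d'); split; first exact: Rmin_pos.
    have := Rmin_l d d'; have := Rmin_r d d' => ? ? p; rewrite in_cons => /orP[/eqP -> |Hi] y s Hy Hs.
      by apply: K => //; lra.
    by apply: IH => //; lra.
  by exists d; split => // i k; apply: (K (i, k)); rewrite mem_enum.
exists d; split => // y s _ Hy Hs.
have Hform A B : (forall i k : 'I_N, Rabs (A i k - B i k) <= e') -> Lam A <= Lam B + e / 2.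
  move=> HAB; apply: (ell_cont HL) => v.
  have -> : form A v = form B v + form (fun i k => A i k - B i k) v.
    rewrite /form -dot_addl; apply: sumI_ext => i; congr Rmult; rewrite /vadd /matvec -sumI_add.
    by apply: sumI_ext => k; ring.
  apply: Rplus_le_compat_l; apply: Rle_trans (Rle_abs _) _.
  apply: Rle_trans (form_bound v (Rlt_le _ _ He') HAB) _.
  apply: Rmult_le_compat_r; first exact: dot_ge0.
  have E : e / 2 = (INR N * INR N + 1) * e' by rewrite /e'; field; nra.
  nra.
have := Hform (H y s) (H x t) (fun i k => Rlt_le _ _ (K i k y s Hy Hs)).
have := Hform (H x t) (H y s) (fun i k => ltac:(rewrite Rabs_minus_sym; exact (Rlt_le _ _ (K i k y s Hy Hs)))).
by move=> ? ?; apply: Rabs_def1; lra.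
Qed.

(** Stronger than [C21]: joint continuity of the function and its gradient is included, because the
    Hessian of a product contains products of gradients. The class is thus closed under sums and
    products. *)
Definition smooth phi : Prop :=
  exists (G : 'I_N -> vec N -> R -> R) (H : vec N -> R -> mat N) (T : vec N -> R -> R),
    (forall i x t, has_partial (fun y => phi y t) i x (G i x t)) /\
    (forall i k x t, has_partial (fun y => G i y t) k x (H x t i k)) /\
    (forall x t, derivable_pt_lim (fun s => phi x s) t (T x t)) /\
    cont_on2 (fun _ _ => True) phi /\
    (forall i, cont_on2 (fun _ _ => True) (G i)) /\
    (forall i k, cont_on2 (fun _ _ => True) (fun x t => H x t i k)) /\
    cont_on2 (fun _ _ => True) T.

Lemma smooth_C21 phi : smooth phi -> exists H T, C21 phi H T.
Proof.
move=> [G [H [T [A1 [A2 [A3 [_ [_ [A4 A5]]]]]]]]]; exists H, T, G.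
by repeat split.
Qed.

Lemma smooth_cont S phi : smooth phi -> cont_on2 S phi.
Proof. by move=> [? [? [? [_ [_ [_ [C _]]]]]]]; apply: cont_on2_sub C. Qed.

Lemma smooth_coord i : smooth (fun x _ => x i).
Proof.
exists (fun k _ _ => if k == i then 1 else 0), (fun _ _ _ _ => 0), (fun _ _ => 0).
split; [move=> k x t|split; [|split; [|split; [|split; [|split]]]]].
- rewrite /has_partial /vadd /vscale /ebasis eq_sym; case: eqP => _.
    rewrite (_ : (fun s => x i + s * 1) = (fun s => x i + s)); last by apply: functional_extensionality => s; ring.
    rewrite -[X in derivable_pt_lim _ _ X]Rplus_0_l.
    by apply: derivable_pt_lim_plus; [exact: derivable_pt_lim_const|exact: derivable_pt_lim_id].
  rewrite (_ : (fun s => x i + s * 0) = (fun s => x i)); last by apply: functional_extensionality => s; ring.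
  exact: derivable_pt_lim_const.
- by move=> *; exact: derivable_pt_lim_const.
- by move=> *; exact: derivable_pt_lim_const.
- exact: cont_on2_coord.
- by move=> k; exact: cont_on2_const.
- by move=> *; exact: cont_on2_const.
exact: cont_on2_const.
Qed.

Lemma smooth_time f f' : (forall t, derivable_pt_lim f t (f' t)) -> continuity f' ->
  smooth (fun _ t => f t).
Proof.
move=> Hf Hf'; exists (fun _ _ _ => 0), (fun _ _ _ _ => 0), (fun _ => f').
split; [|split; [|split; [|split; [|split; [|split]]]]];
 try (by move=> *; exact: derivable_pt_lim_const); try (by move=> *; exact: cont_on2_const).
- by move=> *; exact: Hf.
- by apply: cont_on2_time => t; apply: derivable_continuous_pt; exists (f' t); exact: Hf.
exact: cont_on2_time.
Qed.

Lemma smooth_const c : smooth (fun _ _ => c).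
Proof.
apply: (@smooth_time (fun=> c) (fun=> 0)); first by move=> t; exact: derivable_pt_lim_const.
exact: continuity_const.
Qed.

Lemma smooth_plus phi psi : smooth phi -> smooth psi -> smooth (fun x t => phi x t + psi x t).
Proof.
move=> [G [H [T [A1 [A2 [A3 [A4 [A5 [A6 A7]]]]]]]]] [G' [H' [T' [B1 [B2 [B3 [B4 [B5 [B6 B7]]]]]]]]].
exists (fun i x t => G i x t + G' i x t), (fun x t i k => H x t i k + H' x t i k), (fun x t => T x t + T' x t).
split; [|split; [|split; [|split; [|split; [|split]]]]];
 try (by move=> *; apply: derivable_pt_lim_plus; [exact: A1|exact: B1]);
 try (by move=> *; apply: derivable_pt_lim_plus; [exact: A2|exact: B2]);
 try (by move=> *; apply: derivable_pt_lim_plus; [exact: A3|exact: B3]);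
 by move=> *; apply: cont_on2_plus.
Qed.

Lemma smooth_mult phi psi : smooth phi -> smooth psi -> smooth (fun x t => phi x t * psi x t).
Proof.
move=> [G [H [T [A1 [A2 [A3 [A4 [A5 [A6 A7]]]]]]]]] [G' [H' [T' [B1 [B2 [B3 [B4 [B5 [B6 B7]]]]]]]]].
exists (fun i x t => G i x t * psi x t + phi x t * G' i x t),
  (fun x t i k => H x t i k * psi x t + G i x t * G' k x t + (G k x t * G' i x t + phi x t * H' x t i k)),
  (fun x t => T x t * psi x t + phi x t * T' x t).
split; [move=> i x t|split; [move=> i k x t|split; [move=> x t|]]].
- have := derivable_pt_lim_mult _ _ _ _ _ (A1 i x t) (B1 i x t).
  by rewrite /= vadd0.
- apply: derivable_pt_lim_plus.
    by have := derivable_pt_lim_mult _ _ _ _ _ (A2 i k x t) (B1 k x t); rewrite /= vadd0.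
  by have := derivable_pt_lim_mult _ _ _ _ _ (A1 k x t) (B2 i k x t); rewrite /= vadd0.
- by have := derivable_pt_lim_mult _ _ _ _ _ (A3 x t) (B3 x t).
by repeat split => *; repeat (apply: cont_on2_plus || apply: cont_on2_mult).
Qed.

Lemma smooth_minus phi psi : smooth phi -> smooth psi -> smooth (fun x t => phi x t - psi x t).
Proof.
move=> H1 H2; have := smooth_plus H1 (smooth_mult (smooth_const (-1)) H2).
congr smooth; apply: functional_extensionality => x; apply: functional_extensionality => t; ring.
Qed.

Lemma smooth_sum n (phi : 'I_n -> vec N -> R -> R) : (forall i, smooth (phi i)) ->
  smooth (fun x t => sumI (fun i => phi i x t)).
Proof.
move=> H; rewrite /sumI; elim: (enum _) => [|a l IH] /=; first exact: smooth_const.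
exact: smooth_plus.
Qed.
End Parabolic.

(** * Perron's method *)

Section Viscosity.
Context (N : nat).
Implicit Types (u w L U phi : vec N -> R -> R) (G : vec N -> R -> Prop) (Lam : mat N -> R).

Definition near2 (x : vec N) (t : R) (P : vec N -> R -> Prop) : Prop :=
  exists r, 0 < r /\ forall y s, vdist y x < r -> Rabs (s - t) < r -> P y s.

Definition open2 G : Prop := forall x t, G x t -> near2 x t G.

(** All functions live on the whole space-time and touching is tested in full neighbourhoods; since
    [G] will be open, this agrees with testing inside [G] and lets functions be translated
    freely. *)
Definition subsol Lam G u : Prop := forall x t phi H T, G x t -> C21 phi H T ->
  near2 x t (fun y s => u y s - phi y s <= u x t - phi x t) -> T x t <= Lam (H x t).

Definition supersol Lam G u : Prop := forall x t phi H T, G x t -> C21 phi H T ->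
  near2 x t (fun y s => u x t - phi x t <= u y s - phi y s) -> Lam (H x t) <= T x t.

Definition lipschitz K Kt u : Prop := forall x y t s,
  u x t - u y s <= K * vdist x y + Kt * Rabs (t - s).

Lemma near2_and x t (P Q : vec N -> R -> Prop) :
  near2 x t P -> near2 x t Q -> near2 x t (fun y s => P y s /\ Q y s).
Proof.
move=> [r [Hr H]] [r' [Hr' H']]; exists (Rmin r r'); split; first exact: Rmin_pos.
have := Rmin_l r r'; have := Rmin_r r r' => ? ? y s ? ?.
by split; [apply: H|apply: H']; lra.
Qed.

Lemma near2_mono x t (P Q : vec N -> R -> Prop) :
  (forall y s, P y s -> Q y s) -> near2 x t P -> near2 x t Q.
Proof. by move=> H [r [Hr K]]; exists r; split => // y s ? ?; apply: H; apply: K. Qed.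

Lemma near2_lt u w x t : cont_on2 (fun _ _ => True) u -> cont_on2 (fun _ _ => True) w ->
  u x t < w x t -> near2 x t (fun y s => u y s < w y s).
Proof.
move=> cu cw Hlt; have [r [Hr H]] := cont_on2_minus cw cu (x := x) (t := t) I (eps := w x t - u x t) ltac:(lra).
exists r; split => // y s Hy Hs; have := H y s I Hy Hs => /Rabs_def2 [? ?]; lra.
Qed.

Lemma lipschitz_cont S K Kt u : lipschitz K Kt u -> cont_on2 S u.
Proof.
move=> H x t _ e He; pose C := Rabs K + Rabs Kt + 1.
have HK := Rabs_pos K; have HKt := Rabs_pos Kt.
have HC : 0 < C by rewrite /C; lra.
exists (e / C); split; first exact: Rdiv_lt_0_compat.
move=> y s _ Hy Hs.
have Hv := vdist_ge0 y x; have Ha := Rabs_pos (s - t).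
have E : C * (e / C) = e by field; lra.
have B : K * vdist y x + Kt * Rabs (s - t) < e.
  have : K * vdist y x <= Rabs K * (e / C).
    by apply: Rle_trans (Rmult_le_compat_r _ _ _ Hv (Rle_abs K)) _; apply: Rmult_le_compat_l; lra.
  have : Kt * Rabs (s - t) <= Rabs Kt * (e / C).
    by apply: Rle_trans (Rmult_le_compat_r _ _ _ Ha (Rle_abs Kt)) _; apply: Rmult_le_compat_l; lra.
  have : 0 < e / C by apply: Rdiv_lt_0_compat.
  by move: (e / C) E => q; rewrite /C => <-; lra.
have := H x y t s; have := H y x s t; rewrite (vdist_sym x y) (Rabs_minus_sym t s) => L1 L2.
by apply: Rabs_def1; lra.
Qed.

(** Squared Euclidean distance in space-time. Being smooth, it serves both to make extrema strict
    and to describe the neighbourhoods on which functions are modified. *)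
Definition dsq (x : vec N) (t : R) (y : vec N) (s : R) : R :=
  dot (vsub y x) (vsub y x) + (s - t) * (s - t).

Lemma dsq_smooth x t k : smooth (fun y s => k * dsq x t y s).
Proof.
apply: smooth_mult; first exact: smooth_const.
have Ht : smooth (fun (_ : vec N) s => s - t).
  apply: (@smooth_time _ (fun s => s - t) (fun=> 1)); last exact: continuity_const.
  move=> s; rewrite -[X in derivable_pt_lim _ _ X]Rminus_0_r.
  by apply: derivable_pt_lim_minus; [exact: derivable_pt_lim_id|exact: derivable_pt_lim_const].
apply: smooth_plus; last exact: smooth_mult.
apply: smooth_sum => i; apply: smooth_mult; apply: smooth_minus;
 by [exact: smooth_coord|exact: smooth_const].
Qed.

Lemma dsq_self x t : dsq x t x t = 0.
Proof. by rewrite /dsq -vnorm_sq -/(vdist x x) vdist_self; ring. Qed.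

Lemma dsq_lt x t y s r : 0 < r -> dsq x t y s < r * r -> vdist y x < r /\ Rabs (s - t) < r.
Proof.
move=> Hr; rewrite /dsq -vnorm_sq -/(vdist y x) => H; have Hv := vdist_ge0 y x.
by split; [rewrite -(Rabs_pos_eq (vdist y x)) //|]; apply: Rabs_lt_sq => //;
 have := Rle_0_sqr (s - t); have := Rle_0_sqr (vdist y x); rewrite /Rsqr; lra.
Qed.

Lemma near2_dsq x t P : near2 x t P ->
  exists r, 0 < r /\ forall y s, dsq x t y s < r * r -> P y s.
Proof.
move=> [r [Hr H]]; exists r; split => // y s /(dsq_lt Hr) [? ?]; exact: H.
Qed.

Lemma dsq_cont x t : cont_on2 (fun _ _ => True) (dsq x t).
Proof.
have := smooth_cont (S := fun _ _ => True) (dsq_smooth x t 1); congr cont_on2.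
by apply: functional_extensionality => y; apply: functional_extensionality => s; ring.
Qed.

Lemma dsq_near x t y0 s0 r : dsq x t y0 s0 < r -> near2 y0 s0 (fun y s => dsq x t y s < r).
Proof.
move=> H; by apply: (@near2_lt (dsq x t) (fun _ _ => r)) => //; [exact: dsq_cont|exact: cont_on2_const].
Qed.

Lemma dsq_sd x t k v : sd (fun y => k * dsq x t y t) x v = 2 * k * dot v v.
Proof.
rewrite /sd /dsq.
have -> : vsub (vadd x v) x = v by vec_ring.
have -> : vsub (vsub x v) x = vscale (-1) v by vec_ring.
rewrite dot_scale2 -(vnorm_sq (vsub x x)) -/(vdist x x) vdist_self; ring.
Qed.

(** The second difference of [k * dsq] is exactly 2 k |v|^2, so the operator moves by exactly 2 k:
    [op_cmp_sd] is applied in both directions. *)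
Lemma C21_perturb j Lam phi H T x t k : elliptic j Lam -> C21 phi H T ->
  exists H1 T1, C21 (fun y s => phi y s + k * dsq x t y s) H1 T1 /\
    T1 x t = T x t /\ Lam (H1 x t) = Lam (H x t) + 2 * k.
Proof.
move=> HL C; have [H' [T' C']] := smooth_C21 (dsq_smooth x t k).
have C1 := C21_plus C C'.
exists (fun x t i k => H x t i k + H' x t i k), (fun x t => T x t + T' x t); split => //; split.
  have -> : T' x t = 0; last by rewrite Rplus_0_r.
  apply: (uniqueness_limite _ _ _ _ (C21_time x t C')).
  have D1 : derivable_pt_lim (fun s => s - t) t (1 - 0).
    by apply: derivable_pt_lim_minus; [exact: derivable_pt_lim_id|exact: derivable_pt_lim_const].
  have := derivable_pt_lim_scal _ k _ _ (derivable_pt_lim_plus _ _ _ _ _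
    (derivable_pt_lim_const (dot (vsub x x) (vsub x x)) t) (derivable_pt_lim_mult _ _ _ _ _ D1 D1)).
  by rewrite /= Rminus_diag (_ : k * (0 + ((1 - 0) * 0 + 0 * (1 - 0))) = 0); last ring.
have S0 := C21_slice t C; have S1 := C21_slice t C1.
have E v : sd (fun y => phi y t + k * dsq x t y t) x v = sd (fun y => phi y t) x v + 2 * k * dot v v.
  by rewrite -(dsq_sd x t); rewrite /sd; ring.
apply: Rle_antisym.
  apply: (op_cmp_sd HL S1 S0); exists 1; split; first lra.
  by move=> v _; rewrite E; lra.
suff: Lam (H x t) <= Lam (fun i k => H x t i k + H' x t i k) + (- (2 * k)) by lra.
apply: (op_cmp_sd HL S0 S1); exists 1; split; first lra.
by move=> v _; rewrite E; lra.
Qed.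

Lemma C21_shift phi H T h tau : C21 phi H T ->
  C21 (fun y s => phi (vadd y h) (s + tau)) (fun y s => H (vadd y h) (s + tau))
      (fun y s => T (vadd y h) (s + tau)).
Proof.
have SP (f : vec N -> R) i x l : has_partial f i (vadd x h) l -> has_partial (fun y => f (vadd y h)) i x l.
  move=> Hp; have E : (fun s => f (vadd (vadd x (vscale s (ebasis i))) h)) =
    (fun s => f (vadd (vadd x h) (vscale s (ebasis i)))).
    apply: functional_extensionality => s; congr f; apply: functional_extensionality => k.
    by rewrite /vadd; ring.
  by rewrite /has_partial E.
have SC f : cont_on2 (fun _ _ => True) f -> cont_on2 (fun _ _ => True) (fun y s => f (vadd y h) (s + tau)).
  move=> Hf x t _ e He; have [d [Hd K]] := Hf (vadd x h) (t + tau) I e He; exists d; split => // y s _ Hy Hs.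
  by apply: K => //; rewrite ?vdist_transl // (_ : s + tau - (t + tau) = s - t) //; ring.
move=> [G [A1 [A2 [A3 [A4 A5]]]]]; exists (fun i y s => G i (vadd y h) (s + tau)).
split; first by move=> i x t; apply: (SP (fun y => phi y (t + tau))); exact: A1.
split; first by move=> i k x t; apply: (SP (fun y => G i y (t + tau))); exact: A2.
split; last by split; [move=> i k; apply: (SC (fun x t => H x t i k)); exact: A4|exact: SC].
move=> x t e He; have [d K] := A3 (vadd x h) (t + tau) e He; exists d => k Hk Hkd.
by have := K k Hk Hkd; rewrite (_ : t + tau + k = t + k + tau) //; ring.
Qed.

Lemma subsol_shift Lam G u h tau c : subsol Lam G u ->
  subsol Lam (fun x t => G (vadd x h) (t + tau)) (fun x t => u (vadd x h) (t + tau) + c).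
Proof.
move=> Hu x t phi H T Gxt C [r [Hr K]].
have E y : vadd (vadd y h) (vscale (-1) h) = y by vec_ring.
have E' y : vadd (vadd y (vscale (-1) h)) h = y by vec_ring.
have C' := C21_shift (vscale (-1) h) (- tau) C.
have := Hu _ _ _ _ _ Gxt C'; rewrite /= E (_ : t + tau + - tau = t); last ring.
apply; exists r; split => // y s Hy Hs.
have := K (vadd y (vscale (-1) h)) (s + - tau).
rewrite E' (_ : s + - tau + tau = s); last ring.
have -> : vdist (vadd y (vscale (-1) h)) x = vdist y (vadd x h).
  by rewrite -(vdist_transl _ x h) E'.
have -> : s + - tau - t = s - (t + tau) by ring.
by move=> /(_ Hy Hs); lra.
Qed.

(** A test function touching the maximum touches whichever function is active, so [w] has to be a
    subsolution only where it exceeds [u]. This is what admits translates whose own domain is a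
    translate of [G]. *)
Lemma subsol_max Lam G u w : subsol Lam G u ->
  (forall x t, u x t < w x t -> G x t -> exists G', G' x t /\ subsol Lam G' w) ->
  subsol Lam G (fun x t => Rmax (u x t) (w x t)).
Proof.
move=> Hu Hw x t phi H T Gxt C [r [Hr K]].
case: (Rlt_dec (u x t) (w x t)) => Hlt.
  have [G' [HG' HwG]] := Hw x t Hlt Gxt; apply: (HwG x t phi H T) => //.
  exists r; split => // y s Hy Hs; have := K y s Hy Hs; rewrite (Rmax_right (u x t)); last lra.
  by have := Rmax_r (u y s) (w y s); lra.
apply: (Hu x t phi H T) => //; exists r; split => // y s Hy Hs.
have := K y s Hy Hs; rewrite (Rmax_left (u x t)); last lra.
by have := Rmax_l (u y s) (w y s); lra.
Qed.

Lemma dsq_closed x t r : forall y s, (forall e, 0 < e -> exists y' s', dsq x t y' s' <= r /\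
   vdist y' y < e /\ Rabs (s' - s) < e) -> dsq x t y s <= r.
Proof.
move=> y s H; apply: Rnot_lt_le => Hlt.
have [] := near2_lt (@cont_on2_const _ _ r) (@dsq_cont x t) Hlt.
move=> e [He K]; have [y' [s' [H1 [H2 H3]]]] := H e He.
by have := K y' s' H2 H3; lra.
Qed.

Lemma dsq_bounded x t r : 0 < r -> exists M, forall y s, dsq x t y s <= r * r -> vnorm y <= M /\ Rabs s <= M.
Proof.
move=> Hr; exists (vnorm x + Rabs t + 2 * r) => y s H.
have [|H1 H2] := @dsq_lt x t y s (2 * r) ltac:(lra); first nra.
have Hx := vnorm_ge0 x; have Ht := Rabs_pos t; split.
  have : vnorm y <= vnorm x + vdist y x.
    have -> : y = vadd x (vsub y x) by vec_ring.
    by rewrite vdist_addr; apply: vnorm_triang.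
  lra.
have := Rabs_triang (s - t) t; rewrite (_ : s - t + t = s); last ring.
lra.
Qed.

Section Perron.
Context (j : nat) (Lam : mat N -> R) (HL : elliptic j Lam) (G : vec N -> R -> Prop) (L U : vec N -> R -> R)
  (K Kt : R) (HG : open2 G) (LL : lipschitz K Kt L) (LU : lipschitz K Kt U)
  (LleU : forall x t, L x t <= U x t) (LeqU : forall x t, ~ G x t -> L x t = U x t)
  (subL : subsol Lam G L) (superU : supersol Lam G U).

Definition perron_family w : Prop := cont_on2 (fun _ _ => True) w /\
  (forall x t, L x t <= w x t <= U x t) /\ subsol Lam G w.

Definition perron_sup x t : R := Sup (fun r => exists w, perron_family w /\ r = w x t).
Let u := perron_sup.

Lemma L_in_family : perron_family L.
Proof.
split; first exact: lipschitz_cont LL.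
by split => // x t; split; [lra|].
Qed.

Lemma perron_sup_lub x t : is_lub (fun r => exists w, perron_family w /\ r = w x t) (u x t).
Proof.
apply: Sup_lub; first by exists (L x t), L; split => //; exact: L_in_family.
by exists (U x t) => r [w [[_ [H _]] ->]]; have := H x t; lra.
Qed.

Lemma family_le_perron w x t : perron_family w -> w x t <= u x t.
Proof. by move=> Hw; apply: (perron_sup_lub x t).1; exists w. Qed.

Lemma perron_le x t M : (forall w, perron_family w -> w x t <= M) -> u x t <= M.
Proof. by move=> H; apply: (perron_sup_lub x t).2 => r [w [Hw ->]]; exact: H. Qed.

Lemma perron_between x t : L x t <= u x t <= U x t.
Proof.
split; first by apply: family_le_perron L_in_family.
by apply: perron_le => w [_ [H _]]; have := H x t; lra.
Qed.

(** Translate a member of the family, lower it by the Lipschitz modulus of the barriers, and take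
    the maximum with the original. The result is again in the family, so the supremum inherits the
    modulus of the barriers. *)
Lemma perron_lipschitz : lipschitz K Kt u.
Proof.
move=> x y t s.
suff: u x t <= u y s + (K * vdist x y + Kt * Rabs (t - s)) by lra.
apply: perron_le => w [cw [Bw Sw]].
pose h := vsub x y; pose tau := t - s; pose c := - (K * vnorm h + Kt * Rabs tau).
pose W z r := Rmax (w z r) (w (vadd z h) (r + tau) + c).
have shL f z r : lipschitz K Kt f -> f (vadd z h) (r + tau) + c <= f z r.
  move=> Hf; have := Hf (vadd z h) z (r + tau) r; rewrite vdist_addr.
  by rewrite (_ : r + tau - r = tau) /c; [lra|ring].
have FW : perron_family W.
  split; last split.
  - apply: cont_on2_max => // z r _ e He.
    have [d [Hd Kd]] := cw (vadd z h) (r + tau) I e He; exists d; split => // z' r' _ Hz Hr.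
    have := Kd (vadd z' h) (r' + tau) I; rewrite vdist_transl (_ : r' + tau - (r + tau) = r' - r); last ring.
    by rewrite (_ : forall a b, a + c - (b + c) = a - b) => [|a b]; [apply|ring].
  - move=> z r; have := Bw z r; have := Bw (vadd z h) (r + tau); have := shL U z r LU => *.
    split; first by apply: Rle_trans (Rmax_l _ _); lra.
    by apply: Rmax_lub; lra.
  apply: subsol_max => // z r Hlt Gz; exists (fun x t => G (vadd x h) (t + tau)); split.
    (* Where the translated point leaves [G] the barriers agree, so [w] equals [L] there; lowered,
       it is at most [L], hence at most [w], at the untranslated point. *)
    apply: NNPP => NG; have := LeqU NG; have := Bw (vadd z h) (r + tau); have := shL L z r LL.
    by have := Bw z r; lra.
  exact: subsol_shift.
have : w x t + c <= W y s.
  rewrite /W (_ : vadd y h = x); last by apply: functional_extensionality => i; rewrite /h /vadd /vsub; ring.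
  by rewrite (_ : s + tau = t); [exact: Rmax_r|rewrite /tau; ring].
by have := family_le_perron y s FW; rewrite /c /tau /h -/(vdist x y); lra.
Qed.

Let cu : cont_on2 (fun _ _ => True) u := lipschitz_cont perron_lipschitz.

(** A member of the family that is almost optimal at the centre has an interior maximum against the
    perturbed test function, near enough for the strict reverse inequality still to hold. *)
Lemma perron_subsol : subsol Lam G u.
Proof.
move=> x t phi H T Gxt C Hmax; apply: Rnot_lt_le => Hlt.
(* The perturbation uses 2 k, which leaves half of the gap. *)
pose k := (T x t - Lam (H x t)) / 4.
have Hk : 0 < k by rewrite /k; lra.
have [H1 [T1 [C1 [ET EL]]]] := C21_perturb x t k HL C.
have Hpos : near2 x t (fun y s => 0 < T1 y s - Lam (H1 y s)).
  apply: (@near2_lt (fun _ _ => 0)); [exact: cont_on2_const|exact: C21_op_cont HL C1|].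
  by rewrite ET EL /k; lra.
have [r [Hr Kr]] := near2_dsq (near2_and (near2_and Hmax Hpos) (HG Gxt)).
pose rho := r / 2; have Hrho : 0 < rho by rewrite /rho; lra.
have Hrr : rho * rho < r * r by rewrite /rho; nra.
(* The tolerance k rho^2 is what the perturbation gains on the sphere of radius rho, so the maximum
   cannot sit there. *)
have [w [Fw Hw]] : exists w, perron_family w /\ u x t - k * (rho * rho) < w x t.
  apply: NNPP => Hn; have : u x t <= u x t - k * (rho * rho).
    by apply: perron_le => w Fw; apply: Rnot_lt_le => Hl; apply: Hn; exists w.
  by have : 0 < k * (rho * rho); [apply: Rmult_lt_0_compat; nra|lra].
have [cw [_ Sw]] := Fw.
have [M HM] := dsq_bounded x t Hrho.
have [||y [s [Hys Hmx]]] := @EVT_max N (fun y s => dsq x t y s <= rho * rho)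
   (fun y s => w y s - (phi y s + k * dsq x t y s)) M _ HM (@dsq_closed x t (rho * rho)).
- by exists x, t; rewrite dsq_self; nra.
- apply: cont_on2_sub (cont_on2_minus cw (C21_cont C1)) => //.
have [[Hm Hp] Gy] := Kr y s ltac:(lra).
have Hx := Hmx x t ltac:(rewrite dsq_self; nra).
rewrite dsq_self in Hx.
have Hin : dsq x t y s < rho * rho.
  apply: Rnot_le_lt => Hge; have := family_le_perron y s Fw.
  have : k * (rho * rho) <= k * dsq x t y s by apply: Rmult_le_compat_l; lra.
  rewrite Rmult_0_r in Hx; lra.
have := Sw y s _ _ _ Gy C1; move=> /(_ _)/(fun f => f)Sw1.
suff: T1 y s <= Lam (H1 y s) by lra.
apply: Sw1; apply: near2_mono (dsq_near Hin) => z q Hz; apply: Hmx; lra.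
Qed.

(** Where [u] meets [U], the test function touches [U]. Elsewhere a failing supersolution inequality
    gives a strict subsolution [f] that can be raised slightly above [u] and glued to it,
    contradicting maximality. *)
Lemma perron_supersol : supersol Lam G u.
Proof.
move=> x t phi H T Gxt C Hmin; apply: Rnot_lt_le => Hlt.
have [Lu uU] := perron_between x t.
case: (Rle_lt_or_eq_dec _ _ uU) => HuU; last first.
  have := superU Gxt C; rewrite -HuU => K1.
  suff: Lam (H x t) <= T x t by lra.
  apply: K1; apply: near2_mono Hmin => y s; have := (perron_between y s).2; lra.
pose k := (Lam (H x t) - T x t) / 4.
have Hk : 0 < k by rewrite /k; lra.
have [H1 [T1 [C1 [ET EL]]]] := C21_perturb x t (- k) HL C.
pose c := u x t - phi x t.
have Hneg : near2 x t (fun y s => T1 y s - Lam (H1 y s) < 0).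
  apply: (@near2_lt _ (fun _ _ => 0)); [exact: C21_op_cont HL C1|exact: cont_on2_const|].
  by rewrite ET EL /k; lra.
pose e := (U x t - u x t) / 2.
have cphi1 := C21_cont C1.
have Hbelow : near2 x t (fun y s => phi y s + - k * dsq x t y s + (c + e) < U y s).
  apply: (@near2_lt (fun y s => phi y s + - k * dsq x t y s + (c + e))).
  - by apply: cont_on2_plus => //; exact: cont_on2_const.
  - exact: lipschitz_cont LU.
  by rewrite dsq_self /c /e; lra.
have [r [Hr Kr]] := near2_dsq (near2_and (near2_and Hmin Hneg) Hbelow).
(* The bound [e] keeps [f] below [U]; the bound k r^2 / 2 puts [f] below [u] on the shell dsq >= r^2
   / 2, so the gluing is continuous. *)
pose del := Rmin e (k * (r * r) / 2).
have Hdel : 0 < del by apply: Rmin_pos; [rewrite /e; lra|have : 0 < k * (r * r); [apply: Rmult_lt_0_compat; nra|lra]].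
have De := Rmin_l e (k * (r * r) / 2); have Dk := Rmin_r e (k * (r * r) / 2).
rewrite -/del in De Dk.
pose f y s := phi y s + - k * dsq x t y s + (c + del).
pose w y s := if excluded_middle_informative (dsq x t y s < r * r) then Rmax (u y s) (f y s) else u y s.
have w_in y s : dsq x t y s < r * r -> w y s = Rmax (u y s) (f y s).
  by rewrite /w; case: excluded_middle_informative.
have w_out y s : r * r / 2 <= dsq x t y s -> w y s = u y s.
  rewrite /w; case: excluded_middle_informative => // Hin Hout; apply: Rmax_left.
  have [[Hm _] _] := Kr y s Hin.
  have : k * (r * r / 2) <= k * dsq x t y s by apply: Rmult_le_compat_l; lra.
  rewrite /f /c; lra.
have uw y s : u y s <= w y s.
  by rewrite /w; case: excluded_middle_informative => Hin; [exact: Rmax_l|exact: Rle_refl].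
have cf : cont_on2 (fun _ _ => True) f by apply: cont_on2_plus => //; exact: cont_on2_const.
have Fw : perron_family w.
  split; last split.
  - move=> y s _ eps Heps.
    case: (Rlt_dec (dsq x t y s) (r * r)) => Hin.
      have [d [Hd Kd]] := dsq_near Hin.
      have [d' [Hd' Kd']] := cont_on2_max cu cf (x := y) (t := s) I Heps.
      exists (Rmin d d'); split; first exact: Rmin_pos.
      have := Rmin_l d d'; have := Rmin_r d d' => ? ? z q _ Hz Hq.
      by rewrite !w_in //; [apply: Kd'|apply: Kd] => //; lra.
    have [] := @near2_lt (fun _ _ => r * r / 2) (dsq x t) y s; [exact: cont_on2_const|exact: dsq_cont|nra|].
    move=> d [Hd Kd].
    have [d' [Hd' Kd']] := cu (x := y) (t := s) I Heps.
    exists (Rmin d d'); split; first exact: Rmin_pos.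
    have := Rmin_l d d'; have := Rmin_r d d' => ? ? z q _ Hz Hq.
    rewrite !w_out; [apply: Kd'| |left; apply: Kd] => //; try lra.
    by have := Rmult_lt_0_compat r r Hr Hr; lra.
  - move=> y s; have [B1 B2] := perron_between y s; split; first by have := uw y s; lra.
    rewrite /w; case: excluded_middle_informative => // Hin; apply: Rmax_lub => //.
    have [_ Hb] := Kr y s Hin; rewrite /f; lra.
  move=> y s psi H2 T2 Gy C2 Hmax2.
  (* Where [w] equals [u], the test function touches [u]. Otherwise it touches [f]: time derivatives
     agree, the operators are ordered, and [f] is a strict subsolution. *)
  case: (Rle_lt_dec (w y s) (u y s)) => Hw.
    apply: (perron_subsol Gy C2); apply: near2_mono Hmax2 => z q.
    by have := uw z q; have := uw y s; lra.
  have Hin : dsq x t y s < r * r / 2.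
    by apply: Rnot_le_lt => Hge; rewrite w_out // in Hw; lra.
  have Hin' : dsq x t y s < r * r by nra.
  have Ewf : w y s = f y s.
    rewrite w_in // Rmax_right //; rewrite w_in // in Hw.
    by move: Hw; rewrite /Rmax; case: Rle_dec; lra.
  have Htouch : near2 y s (fun z q => f z q - psi z q <= f y s - psi y s).
    apply: near2_mono (near2_and Hmax2 (dsq_near Hin')) => z q [Hm Hd].
    by rewrite Ewf w_in // in Hm; have := Rmax_r (u z q) (f z q); lra.
  have [r2 [Hr2 K2]] := Htouch.
  have [[_ Hn] _] := Kr y s Hin'.
  have ET2 : T1 y s - T2 y s = 0.
    apply: (@derivable_touch (fun q => phi y q + - k * dsq x t y q - psi y q) s).
      by apply: derivable_pt_lim_minus; [exact: (C21_time y s C1)|exact: C21_time C2].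
    exists r2; split => // q Hq; have := K2 y q ltac:(rewrite vdist_self; lra) Hq.
    by rewrite /f; lra.
  have : Lam (H1 y s) <= Lam (H2 y s).
    apply: (op_cmp_touch HL (C21_slice s C1) (C21_slice s C2)); exists r2; split => // z Hz.
    by have := K2 z s Hz ltac:(rewrite Rminus_diag Rabs_R0; lra); rewrite /f; lra.
  lra.
have := family_le_perron x t Fw; rewrite w_in; last by rewrite dsq_self; nra.
by have := Rmax_r (u x t) (f x t); rewrite /f dsq_self /c; lra.
Qed.
End Perron.
End Viscosity.

(** * Existence and comparison with smooth functions *)

Section Solutions.
Context (N : nat).
Implicit Types (O : vec N -> Prop) (Lam : mat N -> R).

(** [visc_sol_ell] with an arbitrary operator in place of [lambda j], so that [dual_op] is covered;
    likewise [sol_par] below. With [lambda j] they are convertible to the original definitions. *)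
Definition sol_ell Lam O (g z : vec N -> R) : Prop :=
  cont_on (clos O) z /\
  (forall x, bdry O x -> z x = g x) /\
  (forall x phi H, O x -> C2_hess phi H ->
     (exists r, 0 < r /\ forall y, O y -> vdist y x < r -> z y - phi y <= z x - phi x) ->
     0 <= Lam (H x)) /\
  (forall x phi H, O x -> C2_hess phi H ->
     (exists r, 0 < r /\ forall y, O y -> vdist y x < r -> z y - phi y >= z x - phi x) ->
     Lam (H x) <= 0).

Definition sol_par Lam O (g u0 : vec N -> R) (u : vec N -> R -> R) : Prop :=
  cont_on2 (fun x t => clos O x /\ 0 <= t) u /\
  (forall x t, bdry O x -> 0 < t -> u x t = g x) /\
  (forall x, O x -> u x 0 = u0 x) /\
  (forall x t phi H T, O x -> 0 < t -> C21 phi H T ->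
     (exists r, 0 < r /\ forall y s, O y -> 0 < s -> vdist y x < r -> Rabs (s - t) < r ->
        u y s - phi y s <= u x t - phi x t) ->
     T x t - Lam (H x t) <= 0) /\
  (forall x t phi H T, O x -> 0 < t -> C21 phi H T ->
     (exists r, 0 < r /\ forall y s, O y -> 0 < s -> vdist y x < r -> Rabs (s - t) < r ->
        u y s - phi y s >= u x t - phi x t) ->
     T x t - Lam (H x t) >= 0).

Definition lip K (f : vec N -> R) : Prop := forall x y, f x - f y <= K * vdist x y.

Lemma lip_cont K S f : lip K f -> cont_on S f.
Proof.
move=> H; apply: (@cont_on_slice N S (fun _ _ => True) (fun x _ => f x) 0) => //.
apply: (@lipschitz_cont N _ K 0) => x y t s; have := H x y; lra.
Qed.

Lemma Rmax_lip a b a' b' c : a - a' <= c -> b - b' <= c -> Rmax a b - Rmax a' b' <= c.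
Proof.
move=> H1 H2; suff: Rmax a b <= Rmax a' b' + c by lra.
by apply: Rmax_lub; have := Rmax_l a' b'; have := Rmax_r a' b'; lra.
Qed.

Lemma Rmin_lip a b a' b' c : a - a' <= c -> b - b' <= c -> Rmin a b - Rmin a' b' <= c.
Proof.
move=> H1 H2; suff: Rmin a b - c <= Rmin a' b' by lra.
by apply: Rmin_glb; have := Rmin_l a b; have := Rmin_r a b; lra.
Qed.

Lemma tplus_lip t s : Rmax 0 t - Rmax 0 s <= Rabs (t - s).
Proof. by apply: Rmax_lip; [have := Rabs_pos (t - s); lra|exact: Rle_abs]. Qed.

Section Existence.
Context (j : nat) (Lam : mat N -> R) (HL : elliptic j Lam) (Hj : (j <= N.+1)%nat)
  (O : vec N -> Prop) (HO : is_open O) (K : R) (Lb Ub : vec N -> R)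
  (LL : lip K Lb) (LU : lip K Ub) (LleU : forall x, Lb x <= Ub x)
  (LeqU : forall x, ~ O x -> Lb x = Ub x)
  (subL : forall x, O x -> sdge (N.+1 - j) Lb x 0) (superU : forall x, O x -> sdle j Ub x 0).

(** The stationary problem is treated as a parabolic one on O times the whole time line: with time
    Lipschitz constant 0, Perron's function is independent of time. *)
Lemma sol_ell_exists g : (forall x, ~ O x -> g x = Ub x) -> exists z, sol_ell Lam O g z.
Proof.
move=> Hg.
have [u [Lu [Bu [Su1 Su2]]]] : exists u, lipschitz K 0 u /\ (forall x t, Lb x <= u x t <= Ub x) /\
    subsol Lam (fun x (_ : R) => O x) u /\ supersol Lam (fun x (_ : R) => O x) u.
  exists (perron_sup Lam (fun x _ => O x) (fun x _ => Lb x) (fun x _ => Ub x)).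
  have A1 : open2 (fun x (_ : R) => O x).
    by move=> x t /HO [r [Hr H]]; exists r; split => // y s Hy Hs; exact: H.
  have A2 : lipschitz K 0 (fun x _ => Lb x) by move=> x y t s; have := LL x y; lra.
  have A3 : lipschitz K 0 (fun x _ => Ub x) by move=> x y t s; have := LU x y; lra.
  have A4 : subsol Lam (fun x (_ : R) => O x) (fun x _ => Lb x).
    move=> x t phi H T Ox C [r [Hr K1]].
    have ET : T x t = 0.
      suff: - T x t = 0 by lra.
      apply: (derivable_touch (derivable_pt_lim_opp _ _ _ (C21_time x t C))).
      exists r; split => // s Hs; have := K1 x s ltac:(rewrite vdist_self; lra) Hs.
      by rewrite /opp_fct /=; lra.
    rewrite ET; apply: (sdge_test Hj HL (C21_slice t C)); apply: sdge_touch (subL Ox) _.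
    exists r; split => // y Hy; have := K1 y t Hy ltac:(rewrite Rminus_diag Rabs_R0; lra); lra.
  have A5 : supersol Lam (fun x (_ : R) => O x) (fun x _ => Ub x).
    move=> x t phi H T Ox C [r [Hr K1]].
    have ET : T x t = 0.
      apply: (derivable_touch (C21_time x t C)).
      by exists r; split => // s Hs; have := K1 x s ltac:(rewrite vdist_self; lra) Hs; lra.
    rewrite ET; apply: (sdle_test HL (C21_slice t C)); apply: sdle_touch (superU Ox) _.
    exists r; split => // y Hy; have := K1 y t Hy ltac:(rewrite Rminus_diag Rabs_R0; lra); lra.
  have A6 (x : vec N) (t : R) : ~ O x -> Lb x = Ub x by exact: LeqU.
  have A7 (x : vec N) (t : R) : Lb x <= Ub x by [].
  split; first exact: (perron_lipschitz A2 A3 A7 A6 A4).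
  split; first by move=> x t; exact: (perron_between A2 A7 A4 x t).
  split; first exact: (perron_subsol HL A1 A2 A7 A4).
  exact: (perron_supersol HL A1 A2 A3 A7 A6 A4 A5).
have Est x t : u x t = u x 0.
  have := Lu x x t 0; have := Lu x x 0 t; rewrite vdist_self; lra.
exists (fun x => u x 0); split; last split; last split.
- by apply: (@lip_cont K) => x y; have := Lu x y 0 0; lra.
- move=> x [_ Hx]; rewrite Hg //; have := Bu x 0; have := LeqU Hx; lra.
- move=> x phi H Ox C [r [Hr K1]].
  apply: (Su1 x 0 _ _ _ Ox (C21_static C)); have [r' [Hr' HB]] := HO Ox.
  exists (Rmin r r'); split; first exact: Rmin_pos.
  have := Rmin_l r r'; have := Rmin_r r r' => ? ? y s Hy _; rewrite (Est y s).
  by apply: K1; [apply: HB|]; lra.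
move=> x phi H Ox C [r [Hr K1]].
apply: (Su2 x 0 _ _ _ Ox (C21_static C)); have [r' [Hr' HB]] := HO Ox.
exists (Rmin r r'); split; first exact: Rmin_pos.
have := Rmin_l r r'; have := Rmin_r r r' => ? ? y s Hy _; rewrite (Est y s).
by apply: Rge_le; apply: K1; [apply: HB|]; lra.
Qed.

(** Using the positive part of t makes both barriers equal to [u0] for t <= 0 and outside [O], which
    encodes initial and boundary data at once. One-sided curvature bounds on [u0] are asked only
    where it leaves the corresponding stationary barrier. *)
Lemma sol_par_exists u0 C : lip K u0 -> 0 <= C -> (forall x, Lb x <= u0 x <= Ub x) ->
  (forall x, O x -> Lb x < u0 x -> sdge (N.+1 - j) u0 x (- C)) ->
  (forall x, O x -> u0 x < Ub x -> sdle j u0 x C) ->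
  exists u, sol_par Lam O u0 u0 u.
Proof.
move=> L0 HC B0 S0 S1.
pose L x t := Rmax (Lb x) (u0 x - C * Rmax 0 t).
pose U x t := Rmin (Ub x) (u0 x + C * Rmax 0 t).
pose G x t := O x /\ 0 < t.
have tp t : 0 <= Rmax 0 t by exact: Rmax_l.
have A1 : open2 G.
  move=> x t [/HO [r [Hr H]] Ht]; exists (Rmin r t); split; first exact: Rmin_pos.
  have := Rmin_l r t; have := Rmin_r r t => ? ? y s Hy /Rabs_def2 [? ?].
  by split; [apply: H|]; lra.
have LK x y t s f : lip K f -> f x - f y <= K * vdist x y + C * Rabs (t - s).
  by move=> Hf; have := Hf x y; have := Rmult_le_pos _ _ HC (Rabs_pos (t - s)); lra.
have Lt t s : C * Rmax 0 t - C * Rmax 0 s <= C * Rabs (t - s).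
  by have := Rmult_le_compat_l _ _ _ HC (tplus_lip t s); lra.
have A2 : lipschitz K C L.
  move=> x y t s; apply: Rmax_lip; first exact: LK.
  by have := Lt s t; have := L0 x y; rewrite (Rabs_minus_sym s t); lra.
have A3 : lipschitz K C U.
  move=> x y t s; apply: Rmin_lip; first exact: LK.
  by have := Lt t s; have := L0 x y; lra.
have CT t := Rmult_le_pos _ _ HC (tp t).
have A7 x t : L x t <= U x t.
  by have := B0 x; have := CT t => ? ?; apply: Rmax_lub; apply: Rmin_glb; lra.
have E0 x : L x 0 = u0 x /\ U x 0 = u0 x.
  rewrite /L /U (Rmax_left 0 0); last lra.
  by have := B0 x => ?; rewrite Rmax_right ?Rmin_right; lra.
have tp0 t : t <= 0 -> Rmax 0 t = Rmax 0 0 by move=> Ht; rewrite !Rmax_left; lra.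
have EO x t : ~ O x -> L x t = u0 x /\ U x t = u0 x.
  move=> /LeqU E; have := B0 x; have := CT t => ? ?.
  by rewrite /L /U Rmax_left ?Rmin_left; lra.
have A6 x t : ~ G x t -> L x t = U x t.
  move=> HG; case: (classic (O x)) => Ox; last by have [-> ->] := EO x t Ox.
  have Ht : t <= 0 by apply: Rnot_lt_le => Ht; apply: HG.
  by rewrite /L /U (tp0 t Ht); have [H1 H2] := E0 x; rewrite /L /U in H1 H2; lra.
have A4 : subsol Lam G L.
  move=> x t phi H T [Ox Ht] Cp [r [Hr K1]].
  (* Either the stationary branch is active and the test function has time derivative 0, or the
     moving branch is active, with time derivative - C and [Lb] strictly below [u0]. *)
  case: (Rle_lt_dec (u0 x - C * Rmax 0 t) (Lb x)) => Hc.
    have EL : L x t = Lb x by exact: Rmax_left.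
    have K2 y s : vdist y x < r -> Rabs (s - t) < r -> Lb y - Lb x <= phi y s - phi x t.
      move=> Hy Hs; have := K1 y s Hy Hs; rewrite EL.
      by have := Rmax_l (Lb y) (u0 y - C * Rmax 0 s); rewrite -/(L y s); lra.
    have ET : T x t = 0.
      suff: - T x t = 0 by lra.
      apply: (derivable_touch (derivable_pt_lim_opp _ _ _ (C21_time x t Cp))).
      exists r; split => // s Hs; have := K2 x s ltac:(rewrite vdist_self; lra) Hs.
      by rewrite /opp_fct /=; lra.
    rewrite ET; apply: (sdge_test Hj HL (C21_slice t Cp)); apply: sdge_touch (subL Ox) _.
    exists r; split => // y Hy; have := K2 y t Hy ltac:(rewrite Rminus_diag Rabs_R0; lra); lra.
  have EL : L x t = u0 x - C * Rmax 0 t by apply: Rmax_right; lra.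
  have K2 y s : vdist y x < r -> Rabs (s - t) < r ->
      (u0 y - C * Rmax 0 s) - (u0 x - C * Rmax 0 t) <= phi y s - phi x t.
    move=> Hy Hs; have := K1 y s Hy Hs; rewrite EL.
    by have := Rmax_r (Lb y) (u0 y - C * Rmax 0 s); rewrite -/(L y s); lra.
  have ET : T x t = - C.
    suff: - T x t = C by lra.
    apply: (derivable_touch (derivable_pt_lim_opp _ _ _ (C21_time x t Cp))).
    exists (Rmin r t); split; first exact: Rmin_pos.
    have := Rmin_l r t; have := Rmin_r r t => ? ? s Hs.
    have := K2 x s ltac:(rewrite vdist_self; lra) ltac:(lra).
    have [? ?] := Rabs_def2 _ _ Hs.
    by rewrite /opp_fct /= !Rmax_right; lra.
  rewrite ET; apply: (sdge_test Hj HL (C21_slice t Cp)); apply: sdge_touch.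
    by apply: (S0 x Ox); have := CT t; lra.
  exists r; split => // y Hy; have := K2 y t Hy ltac:(rewrite Rminus_diag Rabs_R0; lra); lra.
have A5 : supersol Lam G U.
  move=> x t phi H T [Ox Ht] Cp [r [Hr K1]].
  case: (Rle_lt_dec (Ub x) (u0 x + C * Rmax 0 t)) => Hc.
    have EL : U x t = Ub x by exact: Rmin_left.
    have K2 y s : vdist y x < r -> Rabs (s - t) < r -> phi y s - phi x t <= Ub y - Ub x.
      move=> Hy Hs; have := K1 y s Hy Hs; rewrite EL.
      by have := Rmin_l (Ub y) (u0 y + C * Rmax 0 s); rewrite -/(U y s); lra.
    have ET : T x t = 0.
      apply: (derivable_touch (C21_time x t Cp)).
      by exists r; split => // s Hs; have := K2 x s ltac:(rewrite vdist_self; lra) Hs; lra.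
    rewrite ET; apply: (sdle_test HL (C21_slice t Cp)); apply: sdle_touch (superU Ox) _.
    exists r; split => // y Hy; have := K2 y t Hy ltac:(rewrite Rminus_diag Rabs_R0; lra); lra.
  have EL : U x t = u0 x + C * Rmax 0 t by apply: Rmin_right; lra.
  have K2 y s : vdist y x < r -> Rabs (s - t) < r ->
      phi y s - phi x t <= (u0 y + C * Rmax 0 s) - (u0 x + C * Rmax 0 t).
    move=> Hy Hs; have := K1 y s Hy Hs; rewrite EL.
    by have := Rmin_r (Ub y) (u0 y + C * Rmax 0 s); rewrite -/(U y s); lra.
  have ET : T x t = C.
    apply: (derivable_touch (C21_time x t Cp)).
    exists (Rmin r t); split; first exact: Rmin_pos.
    have := Rmin_l r t; have := Rmin_r r t => ? ? s Hs.
    have := K2 x s ltac:(rewrite vdist_self; lra) ltac:(lra).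
    have [? ?] := Rabs_def2 _ _ Hs.
    by rewrite !Rmax_right; lra.
  rewrite ET; apply: (sdle_test HL (C21_slice t Cp)); apply: sdle_touch.
    by apply: (S1 x Ox); have := CT t; lra.
  exists r; split => // y Hy; have := K2 y t Hy ltac:(rewrite Rminus_diag Rabs_R0; lra); lra.
pose u := perron_sup Lam G L U.
have Lu : lipschitz K C u by exact: (perron_lipschitz A2 A3 A7 A6 A4).
have Bu x t : L x t <= u x t <= U x t by exact: (perron_between A2 A7 A4 x t).
have Su1 : subsol Lam G u by exact: (perron_subsol HL A1 A2 A7 A4).
have Su2 : supersol Lam G u by exact: (perron_supersol HL A1 A2 A3 A7 A6 A4 A5).
exists u; split; last split; last split; last split.
- exact: lipschitz_cont Lu.
- by move=> x t [_ Hx] _; have := Bu x t; have [-> ->] := EO x t Hx; lra.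
- by move=> x _; have := Bu x 0; have [-> ->] := E0 x; lra.
- move=> x t phi H T Ox Ht Cp [r [Hr K1]].
  suff: T x t <= Lam (H x t) by lra.
  apply: (Su1 _ _ _ _ _ (conj Ox Ht) Cp).
  apply: near2_mono (near2_and (A1 x t (conj Ox Ht)) (ex_intro _ r (conj Hr (fun y s H1 H2 => conj H1 H2)))).
  by move=> y s [[Oy Hs] [Hy Hst]]; exact: K1.
move=> x t phi H T Ox Ht Cp [r [Hr K1]].
suff: Lam (H x t) <= T x t by lra.
apply: (Su2 _ _ _ _ _ (conj Ox Ht) Cp).
apply: near2_mono (near2_and (A1 x t (conj Ox Ht)) (ex_intro _ r (conj Hr (fun y s H1 H2 => conj H1 H2)))).
by move=> y s [[Oy Hs] [Hy Hst]]; apply: Rge_le; exact: K1.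
Qed.
End Existence.

Definition interior_pt (S : vec N -> Prop) x : Prop :=
  exists r, 0 < r /\ forall y, vdist y x < r -> S y.

Definition closed_set_v (S : vec N -> Prop) : Prop :=
  forall x, (forall e, 0 < e -> exists y, S y /\ vdist y x < e) -> S x.

Lemma clos_closed O : closed_set_v (clos O).
Proof.
move=> x H r Hr; have [y [Hy Hyx]] := H (r / 2) ltac:(lra).
have [w [Ow Hw]] := Hy (r / 2) ltac:(lra); exists w; split => //.
by have := vdist_triang w y x; lra.
Qed.

Lemma clos_bounded O : bounded_set O -> bounded_set (clos O).
Proof.
move=> [M HM]; exists (M + 1) => x H; have [y [Oy Hy]] := H 1 Rlt_0_1.
have -> : x = vadd y (vsub x y) by vec_ring.
apply: Rle_trans (vnorm_triang _ _) _; have := HM y Oy.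
by move: Hy; rewrite vdist_sym /vdist; lra.
Qed.

Lemma clos_sub O x : O x -> clos O x.
Proof. by move=> Ox r Hr; exists x; rewrite vdist_self. Qed.

Lemma clos_cases O x : clos O x -> O x \/ bdry O x.
Proof. by move=> H; case: (classic (O x)) => Ox; [left|right; split]. Qed.

(** Minimise u - (phi - E) up to time [t2], where E grows exponentially. At the assumed violation E
    is only half of it, so the minimum is negative; the derivative of E makes phi - E a strict
    subsolution; and E is so large at [t2] that the minimum is not at the final time, where no
    two-sided neighbourhood is available. *)
Lemma compare_lower_horizon j Lam O g u0 u (S : vec N -> Prop) (phi : vec N -> R -> R) T0 :
  (j <= N.+1)%nat -> elliptic j Lam -> sol_par Lam O g u0 u ->
  closed_set_v S -> bounded_set S -> (forall x, S x -> clos O x) -> smooth phi ->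
  (forall x t, S x -> 0 < t < T0 -> phi x t <= u x t \/
     (O x /\ interior_pt S x /\ exists tau m, derivable_pt_lim (phi x) t tau /\
        sdge (N.+1 - j) (fun y => phi y t) x m /\ tau <= m)) ->
  (forall x, S x -> phi x 0 <= u x 0) ->
  forall x t, S x -> 0 <= t < T0 -> phi x t <= u x t.
Proof.
move=> Hj HL [cu [_ [_ [_ Hsup]]]] clS [M HM] SO sphi Hint H0 x1 t1 Sx1 [Ht1 Ht1'].
pose t2 := (t1 + T0) / 2; have Ht2 : t1 < t2 < T0 by rewrite /t2; lra.
apply: Rnot_lt_le => Hlt; pose a := phi x1 t1 - u x1 t1; pose eta := a / 2.
have Ha : 0 < a by rewrite /a; lra.
have Heta : 0 < eta by rewrite /eta; lra.
pose K x t := S x /\ 0 <= t <= t2.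
have KM x t : K x t -> vnorm x <= Rabs M + t2 /\ Rabs t <= Rabs M + t2.
  by move=> [/HM Hx Ht]; have := Rle_abs M; have := Rabs_pos M; rewrite (Rabs_pos_eq t); [split; lra|lra].
have Kcl x t : (forall e, 0 < e -> exists y s, K y s /\ vdist y x < e /\ Rabs (s - t) < e) -> K x t.
  move=> H; split.
    by apply: clS => e He; have [y [s [[Sy _] [Hy _]]]] := H e He; exists y.
  split; apply: Rnot_lt_le => Hlt'.
    by have [y [s [[_ Hs] [_ /Rabs_def2 ?]]]] := H (- t) ltac:(lra); lra.
  by have [y [s [[_ Hs] [_ /Rabs_def2 ?]]]] := H (t - (t2)) ltac:(lra); lra.
have Kne : exists x t, K x t by exists x1, t1; split => //; lra.
have cuphi : cont_on2 K (fun x t => u x t - phi x t).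
  apply: cont_on2_minus; last exact: smooth_cont sphi.
  by apply: cont_on2_sub cu => x t [Sx Ht]; split; [exact: SO|lra].
have [xm [tm [_ Hm]]] := EVT_min Kne KM Kcl cuphi.
pose B := Rabs (u xm tm - phi xm tm).
have HB y s : K y s -> - B <= u y s - phi y s.
  by move=> /Hm; have := Rle_abs (- (u xm tm - phi xm tm)); rewrite Rabs_Ropp -/B; lra.
have HB0 : 0 <= B by exact: Rabs_pos.
(* Then E(t2) = eta exp(B / eta + 1) > B, while - B bounds u - phi from below. *)
pose l := (B / eta + 1) / (t2 - t1).
have HB1 : 0 <= B / eta by apply: Rle_mult_inv_pos.
have Hl : 0 < l by apply: Rdiv_lt_0_compat; lra.
have El : l * (t2 - t1) = B / eta + 1 by rewrite /l; field; lra.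
pose E s := eta * exp (l * (s - t1)).
have Epos s : 0 < E s by apply: Rmult_lt_0_compat => //; exact: exp_pos.
have DE s : derivable_pt_lim E s (l * E s).
  have -> : l * E s = eta * (exp (l * (s - t1)) * (l * (1 - 0))) by rewrite /E; ring.
  apply: derivable_pt_lim_scal; apply: (derivable_pt_lim_comp (fun s => l * (s - t1)) exp).
    apply: derivable_pt_lim_scal; apply: derivable_pt_lim_minus.
      exact: derivable_pt_lim_id.
    exact: derivable_pt_lim_const.
  exact: derivable_pt_lim_exp.
have cE : continuity E by move=> s; apply: derivable_continuous_pt; exists (l * E s); exact: DE.
have sE : smooth (fun (_ : vec N) s => E s).
  apply: (@smooth_time N E (fun s => l * E s)) => //.
  by apply: continuity_scal.
have s1 := smooth_minus sphi sE.
have [|y [s [Kys Hmin]]] := @EVT_min N K (fun x t => u x t - (phi x t - E t)) _ Kne KM Kcl.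
  apply: cont_on2_minus; last exact: smooth_cont s1.
  by apply: cont_on2_sub cu => x t [Sx Ht]; split; [exact: SO|lra].
have [Sy Hs] := Kys.
have Hneg : u y s - (phi y s - E s) < 0.
  apply: Rle_lt_trans (Hmin x1 t1 _) _; first by split => //; lra.
  by rewrite /E Rminus_diag Rmult_0_r exp_0 /eta /a; rewrite /eta /a; lra.
have Hgt : u y s < phi y s by have := Epos s; lra.
have Hs0 : 0 < s.
  case: (proj1 Hs) => // Es; rewrite -Es in Hgt; have := H0 y Sy; lra.
have Hs1 : s < t2.
  case: (proj2 Hs) => // Es; exfalso.
  have := HB y s Kys; suff: B < E s by lra.
  rewrite /E Es El.
  have := exp_ineq1 (B / eta + 1) ltac:(lra) => He.
  have EB : B = eta * (B / eta) by field; lra.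
  by apply: Rle_lt_trans (Req_le _ _ EB) _; apply: Rmult_lt_compat_l => //; lra.
case: (Hint y s Sy); [lra|lra|].
move=> [Oy [[r [Hr SB]] [tau [m [Dt [Hsd Htm]]]]]].
have [H [T C]] := smooth_C21 s1.
have ET : T y s = tau - l * E s.
  apply: (uniqueness_limite _ _ _ _ (C21_time y s C)); exact: derivable_pt_lim_minus.
have EL : m <= Lam (H y s).
  apply: (sdge_test Hj HL (C21_slice s C)); apply: sdge_touch Hsd _.
  by exists 1; split; [lra|move=> w _; lra].
have : T y s - Lam (H y s) >= 0.
  apply: (Hsup _ _ _ _ _ Oy Hs0 C).
  exists (Rmin r (t2 - s)); split; first by apply: Rmin_pos => //; lra.
  have := Rmin_l r (t2 - s); have := Rmin_r r (t2 - s) => ? ? w q Ow Hq Hw Hqs.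
  apply: Rle_ge; apply: Hmin; split; first by apply: SB; lra.
  by have [? ?] := Rabs_def2 _ _ Hqs; lra.
have := Rmult_lt_0_compat _ _ Hl (Epos s); lra.
Qed.

Lemma compare_lower j Lam O g u0 u (S : vec N -> Prop) (phi : vec N -> R -> R) :
  (j <= N.+1)%nat -> elliptic j Lam -> sol_par Lam O g u0 u ->
  closed_set_v S -> bounded_set S -> (forall x, S x -> clos O x) -> smooth phi ->
  (forall x t, S x -> 0 < t -> phi x t <= u x t \/
     (O x /\ interior_pt S x /\ exists tau m, derivable_pt_lim (phi x) t tau /\
        sdge (N.+1 - j) (fun y => phi y t) x m /\ tau <= m)) ->
  (forall x, S x -> phi x 0 <= u x 0) ->
  forall x t, S x -> 0 <= t -> phi x t <= u x t.
Proof.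
move=> Hj HL Su clS bS SO sphi Hint H0 x t Sx Ht.
apply: (compare_lower_horizon (T0 := t + 1) Hj HL Su clS bS SO sphi) => //; last lra.
by move=> y s Sy Hs; apply: Hint => //; lra.
Qed.

(** At an interior maximum of z - f the function [f] is itself a test function, and its strict sign
    contradicts the subsolution inequality. The extreme value theorem is used on the time slice
    0. *)
Lemma compare_upper j Lam O g z (f : vec N -> R) :
  elliptic j Lam -> bounded_set O -> sol_ell Lam O g z -> smooth (fun x _ => f x) ->
  (forall x, O x -> exists m, m < 0 /\ sdle j f x m) ->
  (forall x, bdry O x -> g x <= f x) ->
  forall x, clos O x -> z x <= f x.
Proof.
move=> HL bO [cz [Hg [Hsub _]]] sf Hsd Hb x1 Ox1.
have [M HM] := clos_bounded bO.
pose K x (t : R) := clos O x /\ t = 0.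
have [||||x [t [[Ox _] Hmax]]] := @EVT_max N K (fun x _ => z x - f x) (Rabs M).
- by exists x1, 0.
- by move=> x t [/HM Hx ->]; rewrite Rabs_R0; have := Rle_abs M; have := Rabs_pos M; split; lra.
- move=> x t H; split.
    by apply: clos_closed => e He; have [y [s [[Sy _] [Hy _]]]] := H e He; exists y.
  apply: NNPP => Ht; have [y [s [[_ ->] [_]]]] := H (Rabs t) (Rabs_pos_lt _ Ht).
  by rewrite Rminus_0_l Rabs_Ropp; lra.
- apply: cont_on2_minus; last exact: smooth_cont sf.
  by apply: (@cont_on_static N (clos O)) => // x t [].
have Hx1 : z x1 - f x1 <= z x - f x by apply: (Hmax x1 0).
suff: z x <= f x by lra.
case: (clos_cases Ox) => [Ox'|Bx]; last by rewrite Hg //; apply: Hb.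
have [H [T C]] := smooth_C21 sf.
have [m [Hm Hsdx]] := Hsd x Ox'.
have := sdle_test HL (C21_slice 0 C) Hsdx.
suff: 0 <= Lam (H x 0) by lra.
apply: (Hsub _ _ _ Ox' (C21_slice 0 C)); exists 1; split; first lra.
by move=> y Oy _; apply: (Hmax y 0); split => //; apply: clos_sub.
Qed.
End Solutions.

(** * The exponential lower bound on a box *)

Section StaticComparison.
Context (N j : nat) (Lam : mat N -> R) (HL : elliptic j Lam) (Hj : (j <= N.+1)%nat).
Context (O : vec N -> Prop) (HO : is_open O) (bO : bounded_set O) (g u0 : vec N -> R).

(** The definition prescribes [u] on the boundary for t > 0 and at t = 0 inside [O]; the corner is
    reached by continuity from positive times. *)
Lemma sol_par_init u x : sol_par Lam O g u0 u -> bdry O x -> u x 0 = g x.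
Proof.
move=> [cu [Hb _]] Bx; apply: NNPP => Hne.
have [d [Hd H]] := cu x 0 (conj (proj1 Bx) (Rle_refl 0)) (Rabs (u x 0 - g x)) ltac:(apply: Rabs_pos_lt; lra).
have := H x (d / 2) ltac:(split; [exact: (proj1 Bx)|lra]) ltac:(rewrite vdist_self; lra)
  ltac:(rewrite Rminus_0_r Rabs_pos_eq; lra).
rewrite Hb //; last lra.
by rewrite Rabs_minus_sym; lra.
Qed.

Lemma compare_static u (f : vec N -> R) : sol_par Lam O g u0 u -> smooth (fun x _ => f x) ->
  (forall x, O x -> sdge (N.+1 - j) f x 0) ->
  (forall x, bdry O x -> f x <= g x) -> (forall x, O x -> f x <= u0 x) ->
  forall x t, clos O x -> 0 <= t -> f x <= u x t.
Proof.
move=> Su sf Hsd Hb H0 x t Hx Ht.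
apply: (compare_lower Hj HL Su (@clos_closed N O) (clos_bounded bO) _ sf) => //.
  move=> y s Cy Hs; case: (clos_cases Cy) => [Oy|By]; last first.
    by left; rewrite (proj1 (proj2 Su) y s By Hs); exact: Hb.
  right; split => //; split.
    have [r [Hr Kr]] := HO Oy; exists r; split => // w Hw; apply: clos_sub; exact: Kr.
  exists 0, 0; split; first exact: derivable_pt_lim_const.
  by split; [exact: Hsd|lra].
move=> y Cy; case: (clos_cases Cy) => [Oy|By].
  by have [_ [_ [-> // _]]] := Su; exact: H0.
by rewrite (sol_par_init Su By); exact: Hb.
Qed.
End StaticComparison.

Section Splitting.
Context (N j : nat) (Hj : (1 <= j)%nat) (HjN : (j <= N)%nat) (x0 : vec N).
Implicit Types (x v : vec N) (f g : 'I_N -> R) (i k : 'I_N).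

Let HjS : (j <= N.+1)%nat := leqW HjN.
Definition sumP (f : 'I_N -> R) : R := sumI (fun i => if (i < j)%nat then f i else 0).
Definition sumW (f : 'I_N -> R) : R := sumI (fun i => if (i < j)%nat then 0 else f i).

Lemma sumP_ext f g : (forall i, (i < j)%nat -> f i = g i) -> sumP f = sumP g.
Proof. by move=> H; apply: sumI_ext => i; case: (boolP (i < j)%nat) => // /H. Qed.
Lemma sumW_ext f g : (forall i, ~~ (i < j)%nat -> f i = g i) -> sumW f = sumW g.
Proof. by move=> H; apply: sumI_ext => i; case: (boolP (i < j)%nat) => // /H. Qed.
Lemma sumW_le f g : (forall i, ~~ (i < j)%nat -> f i <= g i) -> sumW f <= sumW g.
Proof. by move=> H; apply: sumI_le => i; case: (boolP (i < j)%nat) => [_|/H //]; lra. Qed.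
Lemma sumP_add f g : sumP (fun i => f i + g i) = sumP f + sumP g.
Proof. by rewrite -sumI_add; apply: sumI_ext => i; case: ifP => _; ring. Qed.
Lemma sumP_scal c f : sumP (fun i => c * f i) = c * sumP f.
Proof. by rewrite -sumI_scal; apply: sumI_ext => i; case: ifP => _; ring. Qed.
Lemma sumW_add f g : sumW (fun i => f i + g i) = sumW f + sumW g.
Proof. by rewrite -sumI_add; apply: sumI_ext => i; case: ifP => _; ring. Qed.
Lemma sumW_scal c f : sumW (fun i => c * f i) = c * sumW f.
Proof. by rewrite -sumI_scal; apply: sumI_ext => i; case: ifP => _; ring. Qed.
Lemma sumP_ge0 f : (forall i, (i < j)%nat -> 0 <= f i) -> 0 <= sumP f.
Proof. by move=> H; apply: sumI_ge0 => i; case: (boolP (i < j)%nat) => [/H //|_]; lra. Qed.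
Lemma sumW_ge0 f : (forall i, ~~ (i < j)%nat -> 0 <= f i) -> 0 <= sumW f.
Proof. by move=> H; apply: sumI_ge0 => i; case: (boolP (i < j)%nat) => [_|/H //]; lra. Qed.
Lemma sumP_term f k : (forall i, (i < j)%nat -> 0 <= f i) -> (k < j)%nat -> f k <= sumP f.
Proof.
move=> H Hk; have := @sumI_term N (fun i => if (i < j)%nat then f i else 0) k; rewrite Hk; apply.
by move=> i; case: (boolP (i < j)%nat) => [/H //|_]; lra.
Qed.
Lemma sumW_term f k : (forall i, ~~ (i < j)%nat -> 0 <= f i) -> ~~ (k < j)%nat -> f k <= sumW f.
Proof.
move=> H Hk; have := @sumI_term N (fun i => if (i < j)%nat then 0 else f i) k; rewrite (negbTE Hk); apply.
by move=> i; case: (boolP (i < j)%nat) => [_|/H //]; lra.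
Qed.

Lemma i0_subproof : (0 < N)%nat. Proof. exact: leq_trans Hj HjN. Qed.
Definition i0 : 'I_N := Ordinal i0_subproof.

Lemma card_W : (N - j <= #|[pred i : 'I_N | ~~ (i < j)%nat]|)%nat.
Proof.
have H (m : 'I_(N - j)) : (j + m < N)%nat by have := ltn_ord m; rewrite ltn_subRL.
apply: (@card_ge_inj _ _ _ (fun m => Ordinal (H m))).
  by move=> m m' [] /eqP; rewrite eqn_add2l => /eqP E; apply: val_inj.
by move=> m /=; rewrite -leqNgt leq_addr.
Qed.

Lemma card_W1 (i1 : 'I_N) : (i1 < j)%nat ->
  (N.+1 - j <= #|[pred i : 'I_N | ~~ (i < j)%nat || (i == i1)]|)%nat.
Proof.
move=> Hi; rewrite subSn //.
rewrite (eq_card (B := [predU1 i1 & [pred i : 'I_N | ~~ (i < j)%nat]])); last first.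
  by move=> i; rewrite !inE orbC.
by rewrite cardU1 inE Hi /= add1n ltnS card_W.
Qed.

Lemma card_P : (j <= #|[pred i : 'I_N | (i < j)%nat]|)%nat.
Proof.
apply: (@card_ge_inj _ _ _ (widen_ord HjN)).
  by move=> m m' [] E; apply: val_inj.
by move=> m /=; exact: ltn_ord.
Qed.

Lemma dim_P : dim_ge j (fun v => forall i, ~~ (i < j)%nat -> v i = 0).
Proof.
apply: dim_ge_weaken (dim_ge_graph (fun _ _ => 0) card_P) _ => v H i Hi.
by rewrite (H i Hi) sumI_0 // => k; case: ifP => _; ring.
Qed.

(* If the first [j] coordinates of [p] vanish, the implication is void: any
   direction among them completes the last [N - j] ones. *)
Lemma dim_radial (p : vec N) : dim_ge (N.+1 - j)
  (fun v => (exists i, (i < j)%nat /\ p i <> 0) -> exists c, forall i, (i < j)%nat -> v i = c * p i).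
Proof.
case: (classic (exists i : 'I_N, (i < j)%nat /\ p i <> 0)) => [[i1 [Hi1 Hp]]|Hn]; last first.
  by apply: dim_ge_weaken (dim_ge_graph (fun _ _ => 0) (@card_W1 i0 Hj)) _ => v _ /Hn.
apply: dim_ge_weaken (dim_ge_graph (fun i k => if i == i1 then p k / p i1 else 0) (card_W1 Hi1)) _.
move=> v H _; exists (v i1 / p i1) => i Hi.
case: (boolP (i == i1)) => [/eqP ->|Hne]; first by field.
rewrite H; last by rewrite /= negb_or negbK Hi.
rewrite (sumI_ext (g := fun k => if k == i1 then v k * (p i / p i1) else 0)).
  by rewrite sumI_delta; field.
move=> k /=; case: eqP => [->|_]; rewrite ?orbT //=.
by rewrite orbF; case: ifP => _ //; ring.
Qed.

Definition relc x (i : 'I_N) : R := x i - x0 i.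
Definition Qh x : R := sumW (fun i => Rabs (relc x i)).
Definition AP x : R := sumP (fun i => relc x i * relc x i).

Lemma Qh_ge0 x : 0 <= Qh x.
Proof. by apply: sumW_ge0 => i _; exact: Rabs_pos. Qed.

Lemma relc_smooth i : smooth (fun x _ => relc x i).
Proof. apply: smooth_minus; [exact: smooth_coord|exact: smooth_const]. Qed.

Lemma sumW_smooth (f : 'I_N -> vec N -> R -> R) : (forall i, smooth (f i)) ->
  smooth (fun x t => sumW (fun i => f i x t)).
Proof. by move=> H; apply: smooth_sum => i; case: (i < j)%nat => //; exact: smooth_const. Qed.
Lemma sumP_smooth (f : 'I_N -> vec N -> R -> R) : (forall i, smooth (f i)) ->
  smooth (fun x t => sumP (fun i => f i x t)).
Proof. by move=> H; apply: smooth_sum => i; case: (i < j)%nat => //; exact: smooth_const. Qed.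

Lemma AP_smooth : smooth (fun x _ => AP x).
Proof. by apply: sumP_smooth => i; apply: smooth_mult; exact: relc_smooth. Qed.

Lemma AP_add x v : AP (vadd x v) = AP x + 2 * sumP (fun i => relc x i * v i) + sumP (fun i => v i * v i).
Proof.
rewrite /AP -sumP_scal -!sumP_add; apply: sumP_ext => i _; rewrite /relc /vadd; ring.
Qed.
Lemma AP_sub x v : AP (vsub x v) = AP x - 2 * sumP (fun i => relc x i * v i) + sumP (fun i => v i * v i).
Proof.
rewrite vsubE AP_add.
have -> : sumP (fun i => relc x i * vscale (-1) v i) = - sumP (fun i => relc x i * v i).
  rewrite -[X in _ = - X]Rmult_1_l Ropp_mult_distr_l -sumP_scal; apply: sumP_ext => i _; rewrite /vscale; ring.
rewrite (sumP_ext (f := fun i => vscale (-1) v i * _) (g := fun i => v i * v i)); first ring.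
by move=> i _; rewrite /vscale; ring.
Qed.

Lemma AP_ge0 x : 0 <= AP x.
Proof. by apply: sumP_ge0 => i _; exact: Rle_0_sqr. Qed.

Lemma AP_le_dist x : AP x <= vdist x x0 * vdist x x0.
Proof.
rewrite vnorm_sq; apply: sumI_le => i; case: ifP => _; rewrite /relc /vsub; first lra.
exact: Rle_0_sqr.
Qed.

Lemma sumPsq_le v : sumP (fun i => v i * v i) <= dot v v.
Proof. by apply: sumI_le => i; case: ifP => _; [lra|exact: Rle_0_sqr]. Qed.

Section Tail.
Context (Lam : mat N -> R) (HL : elliptic j Lam) (O : vec N -> Prop) (bO : bounded_set O) (Ox0 : O x0).
Context (HO : is_open O).

(** The majorant regularises each |a| by (a^2 / del + del) / 2 >= |a|, constant along x_P, and adds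
    a small paraboloid in x_P that makes it strictly concave in j directions. *)
Lemma static_le0 (g z : vec N -> R) : sol_ell Lam O g z -> (forall x, bdry O x -> g x <= Qh x) -> z x0 <= 0.
Proof.
move=> Sz Hg; apply: Rnot_lt_le => Hz.
have [M HM] := clos_bounded bO.
pose D := 2 * Rabs M + 1.
have HD0 := Rabs_pos M.
have HD x : clos O x -> AP x <= D * D.
  move=> Cx; apply: Rle_trans (AP_le_dist x) _.
  have Hd : vdist x x0 <= D.
    have := HM x Cx; have := HM x0 (clos_sub Ox0); have := Rle_abs M.
    rewrite /vdist vsubE; have := vnorm_triang x (vscale (-1) x0).
    by rewrite vnorm_scale Rabs_Ropp Rabs_R1 /D; lra.
  by have := vdist_ge0 x x0; nra.
pose eta := z x0 / (4 * (D * D)).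
have HD1 : 1 <= D by rewrite /D; lra.
have HDD : 1 <= D * D by nra.
have Heta : 0 < eta by apply: Rdiv_lt_0_compat; lra.
pose del := z x0 / (2 * (INR N + 1)).
have HN := pos_INR N.
have Hdel : 0 < del by apply: Rdiv_lt_0_compat; lra.
(* The constants give eta D^2 = z(x0) / 4 and at most z(x0) / 4 for the regularisation at [x0], so
   f(x0) <= z(x0) / 2. *)
pose f x := sumW (fun i => (relc x i * relc x i * / del + del) * / 2) + eta * (D * D - AP x).
have sf : smooth (fun x _ => f x).
  apply: smooth_plus.
    apply: sumW_smooth => i; apply: smooth_mult; last exact: smooth_const.
    apply: smooth_plus; last exact: smooth_const.
    by apply: smooth_mult; [apply: smooth_mult; exact: relc_smooth|exact: smooth_const].
  apply: smooth_mult; first exact: smooth_const.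
  by apply: smooth_minus; [exact: smooth_const|exact: AP_smooth].
have : z x0 <= f x0.
  apply: (compare_upper HL bO Sz sf); last exact: clos_sub.
    move=> x _; exists (- (2 * eta)); split; first lra.
    exists (fun v => forall i, ~~ (i < j)%nat -> v i = 0); split; first exact: dim_P.
    exists 1; split; first lra.
    move=> v Hv _; rewrite /sd /f AP_add AP_sub.
    have EW c : sumW (fun i => (relc (vadd x (vscale c v)) i * relc (vadd x (vscale c v)) i * / del + del) * / 2) =
       sumW (fun i => (relc x i * relc x i * / del + del) * / 2).
      by apply: sumW_ext => i Hi; rewrite /relc /vadd /vscale (Hv i Hi) Rmult_0_r Rplus_0_r.
    have E1 := EW 1; have E2 := EW (-1); rewrite -vsubE in E2.
    have Ev : vadd x (vscale 1 v) = vadd x v by vec_ring.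
    rewrite Ev in E1; rewrite E1 E2.
    have -> : dot v v = sumP (fun i => v i * v i).
      by apply: sumI_ext => i; case: (boolP (i < j)%nat) => // /Hv ->; ring.
    lra.
  move=> x Bx; apply: Rle_trans (Hg x Bx) _; rewrite /f.
  have : 0 <= eta * (D * D - AP x).
    by apply: Rmult_le_pos; [lra|have := HD x (proj1 Bx); lra].
  suff: Qh x <= sumW (fun i => (relc x i * relc x i * / del + del) * / 2) by lra.
  apply: sumW_le => i _; set a := relc x i.
  have -> : (a * a * / del + del) * / 2 = Rabs a + (Rabs a - del) * (Rabs a - del) * / (2 * del).
    have -> : a * a = Rabs a * Rabs a by rewrite Rabs_sq.
    by field; lra.
  have : 0 <= (Rabs a - del) * (Rabs a - del) * / (2 * del).
    apply: Rmult_le_pos; first exact: Rle_0_sqr.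
    by left; apply: Rinv_0_lt_compat; lra.
  lra.
have -> : f x0 = sumW (fun=> del * / 2) + eta * (D * D).
  rewrite /f; have -> : AP x0 = 0.
    by apply: sumI_0 => i; case: ifP => // _; rewrite /relc; ring.
  rewrite Rminus_0_r; congr Rplus; apply: sumW_ext => i _; rewrite /relc; field; lra.
have : sumW (fun=> del * / 2) <= INR N * (del * / 2).
  by apply: sumI_const_le => i; case: ifP => _; lra.
have -> : eta * (D * D) = z x0 / 4 by rewrite /eta; field; lra.
have : INR N * (del * / 2) <= z x0 / 4.
  have -> : z x0 / 4 = (INR N + 1) * (del * / 2) by rewrite /del; field; lra.
  by apply: Rmult_le_compat_r; lra.
lra.
Qed.

(** The second difference of q^2 when the values of q at x + v and x - v are q - 2 s - p and q + 2 s
    - p. *)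
Lemma sd_quartic q s p : (q - p - 2 * s) * (q - p - 2 * s) + (q - p + 2 * s) * (q - p + 2 * s) - 2 * (q * q)
  = 8 * (s * s) - 4 * q * p + 2 * (p * p).
Proof. ring. Qed.

Context (rho e0 : R) (Hrho : 0 < rho) (He0 : 0 < e0).
Context (cube : forall x, (forall i, Rabs (relc x i) <= rho) -> O x).

(** At most [e0], to start below [u0]; at most [rho], to stay below [Qh] on the faces where a
    coordinate of x_W has modulus rho. *)
Definition kdecay : R := Rmin rho e0.
(** The subsolution property reduces to 8 rho^2 - 12 q + mu q^2 >= 0 for all q, which holds as soon
    as mu rho^2 >= 9 / 2. *)
Definition mudecay : R := 5 / (rho * rho).

(** Comparison on the product of a ball in x_P and a cube in x_W. On the faces in x_W the barrier
    [Qh] is at least rho; on the sphere in x_P the subsolution vanishes; inside, it is tested with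
    the directions of [dim_radial]. *)
Lemma dynamic_lower (g u0 : vec N -> R) u : sol_par Lam O g u0 u ->
  (forall x t, clos O x -> 0 <= t -> (forall i, (i < j)%nat -> Rabs (relc x i) <= rho) -> Qh x <= u x t) ->
  (forall x, (forall i, Rabs (relc x i) <= rho) -> e0 <= u0 x) ->
  forall t, 0 <= t -> kdecay * exp (- mudecay * t) <= u x0 t.
Proof.
move=> Su HQ H0.
have Hk : 0 < kdecay by exact: Rmin_pos.
have Hkr : kdecay <= rho by exact: Rmin_l.
have Hke : kdecay <= e0 by exact: Rmin_r.
have Hrr : 0 < rho * rho by apply: Rmult_lt_0_compat.
have Hmu : 0 < mudecay by apply: Rdiv_lt_0_compat; lra.
have Emu : mudecay * (rho * rho) = 5 by rewrite /mudecay; field; lra.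
pose q x := rho * rho - AP x.
(* Normalised so that phi(x0, t) is kdecay times the exponential, since q(x0) = rho^2. *)
pose c := kdecay / (rho * rho * (rho * rho)).
have Hc : 0 < c by apply: Rdiv_lt_0_compat => //; nra.
pose E t := exp (- mudecay * t).
have DE s : derivable_pt_lim E s (- mudecay * E s).
  rewrite /E Rmult_comm; apply: (derivable_pt_lim_comp (fun s => - mudecay * s) exp).
    rewrite -{2}(Rmult_1_r (- mudecay)); apply: derivable_pt_lim_scal; exact: derivable_pt_lim_id.
  exact: derivable_pt_lim_exp.
have cE : continuity E by move=> s; apply: derivable_continuous_pt; exists (- mudecay * E s); exact: DE.
have Epos s : 0 < E s by exact: exp_pos.
have E1 s : 0 <= s -> E s <= 1.
  move=> Hs; rewrite /E -exp_0; case: (Req_dec s 0) => [->|Hne]; first by rewrite Rmult_0_r; lra.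
  by left; apply: exp_increasing; nra.
pose phi x t := c * E t * (q x * q x).
have sphi : smooth phi.
  have sq : smooth (fun x (_ : R) => q x).
    by apply: smooth_minus; [exact: smooth_const|exact: AP_smooth].
  apply: smooth_mult; last exact: smooth_mult.
  apply: smooth_mult; first exact: smooth_const.
  apply: (@smooth_time N E (fun s => - mudecay * E s)) => //.
  exact: continuity_scal.
pose S x := 0 <= q x /\ forall i, ~~ (i < j)%nat -> Rabs (relc x i) <= rho.
have SP x i : S x -> (i < j)%nat -> Rabs (relc x i) <= rho.
  move=> [Hq _] Hi; apply: Rnot_lt_le => Hlt.
  have := @sumP_term (fun i => relc x i * relc x i) i (fun k _ => Rle_0_sqr _) Hi.
  rewrite -/(AP x); rewrite /q in Hq.
  have -> : relc x i * relc x i = Rabs (relc x i) * Rabs (relc x i) by rewrite Rabs_sq.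
  nra.
have SO x : S x -> O x.
  by move=> Sx; apply: cube => i; case: (boolP (i < j)%nat) => Hi; [exact: SP|exact: (proj2 Sx)].
have phik x t : S x -> 0 <= t -> phi x t <= kdecay.
  move=> [Hq _] Ht; have := AP_ge0 x; have := E1 t Ht; have := Epos t => HE HE1 HA.
  have Hqr : q x <= rho * rho by rewrite /q; lra.
  have Hqq : q x * q x <= rho * rho * (rho * rho) by apply: Rmult_le_compat.
  have -> : kdecay = c * 1 * (rho * rho * (rho * rho)) by rewrite /c; field; lra.
  apply: Rmult_le_compat => //; [by nra|exact: Rle_0_sqr|].
  by apply: Rmult_le_compat_l; lra.
have cAP : cont_on (fun _ => True) AP.
  by apply: (@cont_on_slice N _ (fun _ _ => True) (fun x _ => AP x) 0) => //; exact: smooth_cont AP_smooth.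
have lrel x y i : Rabs (relc x i) - Rabs (relc y i) <= vdist x y.
  have := vdist_coord x y i; have := Rabs_triang (x i - y i) (relc y i).
  by rewrite (_ : x i - y i + relc y i = relc x i); [lra|rewrite /relc; ring].
have clS : closed_set_v S.
  move=> x Hx; split.
    apply: Rnot_lt_le => Hq.
    have [d [Hd Kd]] := cAP x I (- q x) ltac:(lra).
    have [y [[Hy _] Hyx]] := Hx d Hd.
    by have /Rabs_def2 := Kd y I Hyx; rewrite /q in Hy Hq *; lra.
  move=> i Hi; apply: Rnot_lt_le => Hlt.
  have [y [[_ Hy] Hyx]] := Hx (Rabs (relc x i) - rho) ltac:(lra).
  by have := lrel x y i; rewrite vdist_sym; have := Hy i Hi; lra.
have bS : bounded_set S by have [M HM] := bO; exists M => x /SO; exact: HM.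
have main : forall x t, S x -> 0 <= t -> phi x t <= u x t.
  apply: (compare_lower HjS HL Su clS bS (fun x Sx => clos_sub (SO x Sx)) sphi).
    move=> x t Sx Ht.
    have HQx : Qh x <= u x t by apply: HQ => [||i]; [apply: clos_sub; exact: SO|lra|exact: SP].
    case: (classic (exists i : 'I_N, ~~ (i < j)%nat /\ rho <= Rabs (relc x i))) => [[i [Hi Hr]]|Hn].
      left; apply: Rle_trans HQx; apply: Rle_trans (phik x t Sx _) _; first lra.
      apply: Rle_trans Hkr _; apply: Rle_trans Hr _.
      by apply: (@sumW_term (fun i => Rabs (relc x i))) => // k _; exact: Rabs_pos.
    case: (Rle_lt_or_eq_dec _ _ (proj1 Sx)) => Hq; last first.
      by left; rewrite /phi -Hq !Rmult_0_r; have := Qh_ge0 x; lra.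
    right; split; first exact: SO.
    split.
      have [d [Hd Kd]] := cAP x I (q x) Hq.
      have [d' [Hd' Kd']] : exists d', 0 < d' /\ forall i, ~~ (i < j)%nat -> d' <= rho - Rabs (relc x i).
        have [d' [Hd' Kd']] : exists d', 0 < d' /\ forall i, i \in enum 'I_N -> ~~ (i < j)%nat -> d' <= rho - Rabs (relc x i).
          elim: (enum _) => [|a l [d' [Hd' IH]]]; first by exists 1; split; [lra|].
          case: (boolP (a < j)%nat) => Ha.
            by exists d'; split => // i; rewrite in_cons => /orP [/eqP ->|/IH //]; rewrite Ha.
          have Hra : 0 < rho - Rabs (relc x a).
            by have := proj2 Sx a Ha; case=> [?|E']; [lra|exfalso; apply: Hn; exists a; split; [|lra]].
          exists (Rmin d' (rho - Rabs (relc x a))); split; first exact: Rmin_pos.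
          move=> i; rewrite in_cons => /orP [/eqP -> _|/IH H1 /H1]; first exact: Rmin_r.
          by apply: Rle_trans; exact: Rmin_l.
        by exists d'; split => // i; apply: Kd'; rewrite mem_enum.
      exists (Rmin d d'); split; first exact: Rmin_pos.
      have := Rmin_l d d'; have := Rmin_r d d' => ? ? y Hy; split.
        by have /Rabs_def2 := Kd y I ltac:(lra); rewrite /q; lra.
      by move=> i Hi; have := lrel y x i; have := Kd' i Hi; lra.
    exists (- mudecay * phi x t), (- mudecay * phi x t); split; last split; last lra.
      have := derivable_pt_lim_scal E (c * (q x * q x)) t _ (DE t).
      have -> : c * (q x * q x) * (- mudecay * E t) = - mudecay * phi x t by rewrite /phi; ring.
      congr derivable_pt_lim; apply: functional_extensionality => s.
      by rewrite /phi /mult_real_fct; ring.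
    exists (fun v => (exists i, (i < j)%nat /\ relc x i <> 0) -> exists c, forall i, (i < j)%nat -> v i = c * relc x i).
    split; first exact: dim_radial.
    exists 1; split; first lra.
    move=> v Hv _; pose s := sumP (fun i => relc x i * v i); pose p := sumP (fun i => v i * v i).
    (* Equality in Cauchy-Schwarz: the x_P part of v is parallel to that of x, or the latter is
       zero. *)
    have Hsp : s * s = AP x * p.
      case: (classic (exists i : 'I_N, (i < j)%nat /\ relc x i <> 0)) => [/Hv [b Hb]|Hz].
        have -> : s = b * AP x by rewrite -sumP_scal; apply: sumP_ext => i Hi; rewrite (Hb i Hi); ring.
        have -> : p = b * b * AP x by rewrite -sumP_scal; apply: sumP_ext => i Hi; rewrite (Hb i Hi); ring.
        ring.
      have Hr i : (i < j)%nat -> relc x i = 0 by move=> Hi; apply: NNPP => Hne; apply: Hz; exists i.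
      have -> : s = 0 by apply: sumI_0 => i; case: ifP => // Hi; rewrite Hr //; ring.
      have -> : AP x = 0 by apply: sumI_0 => i; case: ifP => // Hi; rewrite Hr //; ring.
      ring.
    have Hp : 0 <= p by apply: sumP_ge0 => i _; exact: Rle_0_sqr.
    have -> : sd (fun y => phi y t) x v = c * E t * (8 * (s * s) - 4 * q x * p + 2 * (p * p)).
      rewrite -sd_quartic /sd /phi /q AP_add AP_sub -/s -/p; ring.
    rewrite /phi Hsp.
    have -> : - mudecay * (c * E t * (q x * q x)) * dot v v = c * E t * (- mudecay * (q x * q x) * dot v v) by ring.
    have HcE : 0 <= c * E t by have := Epos t; nra.
    apply: Rmult_le_compat_l => //.
    have EA : AP x = rho * rho - q x by rewrite /q; ring.
    have Hdv : p <= dot v v by exact: sumPsq_le.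
    have Hq2 : 0 <= mudecay * (q x * q x) by have := Rle_0_sqr (q x); rewrite /Rsqr; nra.
    have H1 : - mudecay * (q x * q x) * dot v v <= - mudecay * (q x * q x) * p by nra.
    (* After multiplication by rho^2 this is ((6 rho^2 - 5 q)^2 + 4 rho^4) / 5. *)
    have H2 : 0 <= 8 * (rho * rho) - 12 * q x + mudecay * (q x * q x).
      have E2 : rho * rho * (8 * (rho * rho) - 12 * q x + mudecay * (q x * q x)) =
         8 * (rho * rho) * (rho * rho) - 12 * (rho * rho) * q x + 5 * (q x * q x).
        by rewrite -Emu; ring.
      have : 0 <= rho * rho * (8 * (rho * rho) - 12 * q x + mudecay * (q x * q x)).
        rewrite E2; have := Rle_0_sqr (6 * (rho * rho) - 5 * q x); rewrite /Rsqr; nra.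
      by move=> H3; apply: (Rmult_le_reg_l (rho * rho)) => //; rewrite Rmult_0_r.
    have H3 : 0 <= (8 * (rho * rho) - 12 * q x + mudecay * (q x * q x)) * p by exact: Rmult_le_pos.
    have := Rle_0_sqr p; rewrite /Rsqr EA; lra.
  move=> x Sx; rewrite (proj1 (proj2 (proj2 Su)) x (SO x Sx)).
  apply: Rle_trans (phik x 0 Sx (Rle_refl 0)) _; apply: Rle_trans Hke _.
  by apply: H0 => i; case: (boolP (i < j)%nat) => Hi; [exact: SP|exact: (proj2 Sx)].
move=> t Ht.
have Ax0 : AP x0 = 0 by apply: sumI_0 => i; case: ifP => // _; rewrite /relc; ring.
have Sx0 : S x0.
  by split; [rewrite /q Ax0; lra|move=> i _; rewrite /relc Rminus_diag Rabs_R0; lra].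
have := main x0 t Sx0 Ht; rewrite /phi /q Ax0 Rminus_0_r /c.
have -> : kdecay / (rho * rho * (rho * rho)) * E t * (rho * rho * (rho * rho)) = kdecay * E t by field; lra.
by [].
Qed.
End Tail.
End Splitting.

(** * Cone barriers and the first eigenvalue *)

Section Gap.
Context (N : nat).
Implicit Types (O : vec N -> Prop) (Lam : mat N -> R) (x v : vec N) (f : vec N -> R).

(** The first half of the theorem for a general operator; the second half will be this property for
    the dual operator. *)
Definition exponential_gap Lam O x0 : Prop :=
  exists (g u0 : vec N -> R) (mu1 k : R),
     cont_on (bdry O) g /\ cont_on (clos O) u0 /\
     (forall x, bdry O x -> u0 x = g x) /\ 0 < mu1 /\ 0 < k /\
     (exists u, sol_par Lam O g u0 u) /\ (exists z, sol_ell Lam O g z) /\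
     (forall u z, sol_par Lam O g u0 u -> sol_ell Lam O g z ->
        forall t, 0 < t -> u x0 t >= z x0 + k * exp (- mu1 * t)).

(** What each range of j must supply. The data are normalised so that z(x0) <= 0, which turns the
    gap into a lower bound on [u] alone; [u0] also serves as boundary datum. *)
Lemma exponential_gap_intro j Lam O x0 K (Lb Ub u0 : vec N -> R) C mu1 k :
  elliptic j Lam -> (j <= N.+1)%nat -> is_open O ->
  lip K Lb -> lip K Ub -> lip K u0 -> (forall x, Lb x <= u0 x <= Ub x) ->
  (forall x, ~ O x -> Lb x = Ub x) ->
  (forall x, O x -> sdge (N.+1 - j) Lb x 0) -> (forall x, O x -> sdle j Ub x 0) -> 0 <= C ->
  (forall x, O x -> Lb x < u0 x -> sdge (N.+1 - j) u0 x (- C)) ->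
  (forall x, O x -> u0 x < Ub x -> sdle j u0 x C) -> 0 < mu1 -> 0 < k ->
  (forall z, sol_ell Lam O u0 z -> z x0 <= 0) ->
  (forall u, sol_par Lam O u0 u0 u -> forall t, 0 <= t -> k * exp (- mu1 * t) <= u x0 t) ->
  exponential_gap Lam O x0.
Proof.
move=> HL Hj HO L1 L2 L3 B E S1 S2 HC S3 S4 Hmu Hk Hz Hu.
have B' x : Lb x <= Ub x by have := B x; lra.
have E' x : ~ O x -> u0 x = Ub x by move=> Ox; have := B x; have := E x Ox; lra.
exists u0, u0, mu1, k; do !split => //; try exact: lip_cont L3.
- exact: (sol_par_exists HL Hj HO L1 L2 E S1 S2 L3 HC B S3 S4).
- exact: (sol_ell_exists HL Hj HO L1 L2 B' E S1 S2 E').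
move=> u z Su Sz t Ht; have := Hz z Sz; have := Hu u Su t ltac:(lra); lra.
Qed.

Lemma lip_vdist p : lip 1 (fun x => vdist x p).
Proof. by move=> x y; have := vdist_triang x y p; lra. Qed.

Lemma lip_plus K K' f f' : lip K f -> lip K' f' -> lip (K + K') (fun x => f x + f' x).
Proof. by move=> H H' x y; have := H x y; have := H' x y; lra. Qed.

Lemma lip_weaken K K' f : K <= K' -> lip K f -> lip K' f.
Proof.
move=> HK H x y; apply: Rle_trans (H x y) _.
by apply: Rmult_le_compat_r => //; exact: vdist_ge0.
Qed.

Lemma lip_abs K f x y : lip K f -> Rabs (f x - f y) <= K * vdist x y.
Proof.
by move=> H; apply: Rabs_le; have := H x y; have := H y x; rewrite (vdist_sym y x); lra.
Qed.

Lemma lip_scal K f c : lip K f -> lip (Rabs c * K) (fun x => c * f x).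
Proof.
move=> H x y; rewrite -Rmult_minus_distr_l Rmult_assoc; apply: Rle_trans (Rle_abs _) _.
by rewrite Rabs_mult; apply: Rmult_le_compat_l; [exact: Rabs_pos|exact: lip_abs].
Qed.

Lemma lip_sq K f M : (forall x, 0 <= f x <= M) -> 0 <= K -> lip K f -> lip (2 * M * K) (fun x => f x * f x).
Proof.
move=> B HK H x y.
have -> : f x * f x - f y * f y = (f x + f y) * (f x - f y) by ring.
have := B x; have := B y; have := H x y; have := vdist_ge0 x y => Hd H1 By Bx.
have H2 := Rmult_le_pos _ _ HK Hd.
apply: Rle_trans (Rmult_le_compat_l (f x + f y) _ _ _ H1) _; first lra.
rewrite Rmult_assoc; apply: Rmult_le_compat_r => //; lra.
Qed.

(** For f >= 0, the positive part of h^2 - f^2. Truncating f before squaring makes it globally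
    Lipschitz. *)
Definition cap h f x : R := h * h - Rmin (f x) h * Rmin (f x) h.

Lemma cap_bounds h f x : 0 < h -> 0 <= f x -> 0 <= cap h f x <= h * h.
Proof.
move=> Hh Hf; have H1 : 0 <= Rmin (f x) h by apply: Rmin_glb; lra.
have H2 := Rmin_r (f x) h; rewrite /cap; nra.
Qed.

Lemma cap_lip h f K : 0 < h -> 0 <= K -> (forall x, 0 <= f x) -> lip K f -> lip (2 * h * K) (cap h f).
Proof.
move=> Hh HK Hf H.
have Hm : lip K (fun x => Rmin (f x) h).
  move=> x y; apply: Rmin_lip; first exact: H.
  by have := Rmult_le_pos _ _ HK (vdist_ge0 x y); lra.
have := @lip_sq K (fun x => Rmin (f x) h) h (fun x => conj (Rmin_glb _ _ _ (Hf x) (Rlt_le _ _ Hh)) (Rmin_r _ _)) HK Hm.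
by move=> K1 x y; have := K1 y x; rewrite /cap (vdist_sym y x); lra.
Qed.

Lemma cap_cases h f x : 0 < h -> 0 <= f x ->
  (f x <= h /\ cap h f x = h * h - f x * f x) \/ (h < f x /\ cap h f x = 0).
Proof.
move=> Hh Hf; rewrite /cap; case: (Rle_lt_dec (f x) h) => H; [left|right]; split => //.
  by rewrite Rmin_left.
by rewrite Rmin_right; [ring|lra].
Qed.

Lemma sd_plus f f' x v : sd (fun y => f y + f' y) x v = sd f x v + sd f' x v.
Proof. rewrite /sd; ring. Qed.

Lemma dim_all n : (n <= N)%nat -> dim_ge n (fun _ : vec N => True).
Proof.
move=> Hn; apply: dim_ge_weaken (@dim_ge_graph N predT (fun _ _ => 0) n _) _ => //.
by rewrite card_ord.
Qed.

Lemma dim_line (d : vec N) i : d i <> 0 -> dim_ge 1 (fun v => exists c, v = vscale c d).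
Proof.
move=> Hd; have E (c : 'I_1 -> R) : lincomb (fun _ : 'I_1 => d) c = vscale (c ord0) d.
  apply: functional_extensionality => k; rewrite /lincomb /vscale -(sumI_delta ord0 (fun l => c l * d k)).
  by apply: sumI_ext => l; rewrite (ord1 l) eqxx.
exists (fun _ => d); split; last by move=> c; exists (c ord0).
move=> c /(_ i); rewrite E /vscale => H k; rewrite (ord1 k).
by case: (Rmult_integral _ _ H).
Qed.

(** McShane's extension of [f] from the complement of [O], an infimum of cones. The slope K + 1,
    strictly above the Lipschitz constant, makes the infimum attained, so at each point some cone
    touches [m] from above. *)
Lemma mcshane O f K : (forall x, O x -> exists r, 0 < r /\ forall y, vdist y x < r -> O y) ->
  (exists p, ~ O p) -> lip K f -> 0 <= K ->
  exists m, lip (K + 1) m /\ (forall x, ~ O x -> m x = f x) /\ (forall x, f x <= m x) /\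
    forall x, exists p, ~ O p /\ m x = f p + (K + 1) * vdist x p /\
      forall y, m y <= f p + (K + 1) * vdist y p.
Proof.
move=> HO [p0 Hp0] Hf HK.
have Hlow x p : f x + vdist x p <= f p + (K + 1) * vdist x p by have := Hf x p; lra.
have ex x : exists p, ~ O p /\ forall p', ~ O p' -> f p + (K + 1) * vdist x p <= f p' + (K + 1) * vdist x p'.
  (* A vertex at distance more than B from x does worse than [p0], because the surplus slope 1 adds
     the distance itself. *)
  pose B := f p0 + (K + 1) * vdist x p0 - f x.
  have HB0 : vdist x p0 <= B by have := Hlow x p0; rewrite /B; lra.
  have [||||p [t [[Op [HpB _]] Hmin]]] := @EVT_min N (fun p t => ~ O p /\ vdist x p <= B /\ t = 0)
     (fun p _ => f p + (K + 1) * vdist x p) (vnorm x + B).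
  - by exists p0, 0.
  - move=> p t [_ [Hp ->]]; rewrite Rabs_R0.
    have Hv := vnorm_ge0 x; have Hd := vdist_ge0 x p; split; last lra.
    have -> : p = vadd x (vsub p x) by vec_ring.
    by apply: Rle_trans (vnorm_triang _ _) _; rewrite -/(vdist p x) vdist_sym; lra.
  - move=> p t H; split; last split.
    + move=> Op; have [r [Hr Kr]] := HO p Op.
      by have [y [s [[Oy _] [Hy _]]]] := H r Hr; apply: Oy; exact: Kr.
    + apply: Rnot_lt_le => Hlt; have [y [s [[_ [Hy _]] [Hyp _]]]] := H (vdist x p - B) ltac:(lra).
      by have := vdist_triang x y p; lra.
    apply: NNPP => Ht; have [y [s [[_ [_ ->]] [_]]]] := H (Rabs t) (Rabs_pos_lt _ Ht).
    by rewrite Rminus_0_l Rabs_Ropp; lra.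
  - apply: (@lipschitz_cont N _ (K + (K + 1)) 0) => y q t s.
    by have := Hf y q; have := vdist_triang x q y; rewrite (vdist_sym q y); nra.
  exists p; split => // p' Op'.
  case: (Rle_lt_dec (vdist x p') B) => Hd; first exact: (Hmin p' 0).
  apply: Rle_trans (Hmin p0 0 _) _; first by split.
  by have := Hlow x p'; rewrite /B in Hd; lra.
pose P x p := ~ O p /\ forall p', ~ O p' -> f p + (K + 1) * vdist x p <= f p' + (K + 1) * vdist x p'.
pose s x := epsilon (inhabits p0) (P x).
have Hs x : P x (s x) by exact: (epsilon_spec (inhabits p0) (P x) (ex x)).
pose m x := f (s x) + (K + 1) * vdist x (s x).
have Hm y x : m y <= f (s x) + (K + 1) * vdist y (s x) by have [_] := Hs y; apply; have [] := Hs x.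
exists m; split; last split; last split.
- move=> x y; have := Hm x y; rewrite /m; have := vdist_triang x y (s y); nra.
- move=> x Ox; apply: Rle_antisym.
    by have [_ /(_ x Ox)] := Hs x; rewrite vdist_self Rmult_0_r Rplus_0_r.
  by have := Hlow x (s x); rewrite /m; have := vdist_ge0 x (s x); lra.
- by move=> x; have := Hlow x (s x); rewrite /m; have := vdist_ge0 x (s x); lra.
by move=> x; exists (s x); split; [have [] := Hs x|split].
Qed.

(** The touching cone is affine along the line through x and its vertex, and the vertex differs from
    x because it lies outside [O]. *)
Lemma cone_sdle O (m : vec N -> R) K : 0 <= K ->
  (forall x, exists p, ~ O p /\ (exists c, m x = c + K * vdist x p /\ forall y, m y <= c + K * vdist y p)) ->
  forall x, O x -> sdle 1 m x 0.
Proof.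
move=> HK H x Ox; have [p [Op [c [Ex Hy]]]] := H x.
have [i Hi] : exists i, vsub x p i <> 0.
  apply: NNPP => Hn; apply: Op; suff -> : p = x by [].
  apply: functional_extensionality => i; apply: NNPP => Hne; apply: Hn; exists i.
  by rewrite /vsub; lra.
exists (fun v => exists c, v = vscale c (vsub x p)); split; first exact: dim_line Hi.
have Hd : 0 < vdist x p by apply: vnorm_pos Hi.
exists (vdist x p); split => // v [b ->]; rewrite vnorm_scale -/(vdist x p) => Hb.
have Hb1 : Rabs b < 1.
  by apply: (Rmult_lt_reg_r (vdist x p)) => //; lra.
have [? ?] := Rabs_def2 _ _ Hb1.
have E1 : vdist (vadd x (vscale b (vsub x p))) p = (1 + b) * vdist x p.
  rewrite -(Rabs_pos_eq (1 + b)) -?vnorm_scale; last lra.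
  by rewrite /vdist; congr vnorm; vec_ring.
have E2 : vdist (vsub x (vscale b (vsub x p))) p = (1 - b) * vdist x p.
  rewrite -(Rabs_pos_eq (1 - b)) -?vnorm_scale; last lra.
  by rewrite /vdist; congr vnorm; vec_ring.
have := Hy (vadd x (vscale b (vsub x p))); have := Hy (vsub x (vscale b (vsub x p))).
by rewrite /sd E1 E2 Ex; lra.
Qed.

Lemma bounded_complement O : (1 <= N)%nat -> bounded_set O -> exists p, ~ O p.
Proof.
move=> HN [M HM]; pose i : 'I_N := Ordinal HN.
exists (vscale (Rabs M + 1) (ebasis i)) => /HM H.
have := coord_le (vscale (Rabs M + 1) (ebasis i)) i.
have -> : vscale (Rabs M + 1) (ebasis i) i = Rabs M + 1 by rewrite /vscale /ebasis eqxx Rmult_1_r.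
by have := Rle_abs (Rabs M + 1); have := Rle_abs M; lra.
Qed.

Lemma bounded_dist O x0 : bounded_set O -> exists D, 0 < D /\ forall x, O x -> vdist x x0 <= D.
Proof.
move=> [M HM]; exists (Rabs M + vnorm x0 + 1).
have := Rabs_pos M; have := vnorm_ge0 x0 => ? ?; split; first lra.
move=> x /HM H; have := Rle_abs M; rewrite /vdist vsubE; have := vnorm_triang x (vscale (-1) x0).
by rewrite vnorm_scale Rabs_Ropp Rabs_R1; lra.
Qed.

Lemma small_cube O x0 : is_open O -> O x0 ->
  exists h, 0 < h /\ forall x, (forall i, Rabs (x i - x0 i) <= h) -> O x.
Proof.
move=> HO Ox0; have [r [Hr K]] := HO x0 Ox0; have HN := pos_INR N.
exists (r / (2 * (INR N + 1))); split; first by apply: Rdiv_lt_0_compat; lra.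
move=> x Hx; apply: K; apply: (Rle_lt_trans _ ((INR N + 1) * (r / (2 * (INR N + 1))))).
  by apply: vnorm_le_coord => //; left; apply: Rdiv_lt_0_compat; lra.
have -> : (INR N + 1) * (r / (2 * (INR N + 1))) = r / 2 by field; lra.
lra.
Qed.
End Gap.

Section FirstEigenvalue.
Context (N : nat) (HN : (1 <= N)%nat) (x0 : vec N) (Lam : mat N -> R) (HL : elliptic 1 Lam).
Context (O : vec N -> Prop) (HO : is_open O) (bO : bounded_set O) (Ox0 : O x0).
Let Q := Qh 1 x0.

Lemma Qh_lip j : lip (INR N) (@Qh N j x0).
Proof.
move=> x y; rewrite /Qh; set A := sumW _ _; set B := sumW _ _.
have -> : A - B = sumW j (fun i => Rabs (relc x0 x i) + -1 * Rabs (relc x0 y i)).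
  by rewrite sumW_add sumW_scal -/A -/B; ring.
apply: sumI_const_le => i; case: ifP => _; first exact: vdist_ge0.
have := vdist_coord x y i; have := Rabs_triang (x i - y i) (relc x0 y i).
by rewrite (_ : x i - y i + relc x0 y i = relc x0 x i); [lra|rewrite /relc; ring].
Qed.

Lemma sdge_Qh j x v : 0 <= sd (@Qh N j x0) x v.
Proof.
rewrite /sd /Qh.
have -> : 2 * sumW j (fun i => Rabs (relc x0 x i)) = sumW j (fun i => 2 * Rabs (relc x0 x i)) by rewrite sumW_scal.
rewrite -sumW_add; suff: sumW j (fun i => 2 * Rabs (relc x0 x i)) <=
  sumW j (fun i => Rabs (relc x0 (vadd x v) i) + Rabs (relc x0 (vsub x v) i)) by lra.
apply: sumW_le => i _.
have := Rabs_triang (relc x0 (vadd x v) i) (relc x0 (vsub x v) i).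
have -> : relc x0 (vadd x v) i + relc x0 (vsub x v) i = 2 * relc x0 x i by rewrite /relc /vadd /vsub; ring.
by rewrite Rabs_mult (Rabs_pos_eq 2); lra.
Qed.

(** The lower barrier is [Q], the upper one the McShane extension of u0 = Q + c^2. The truncated
    paraboloid is squared so that its second differences are bounded on both sides across the edge
    of its support. *)
Lemma first_eigenvalue_gap : exponential_gap Lam O x0.
Proof.
have [h [Hh cube]] := small_cube HO Ox0.
have [D [HD HDx]] := bounded_dist x0 bO.
pose c := cap h (fun x => vdist x x0).
have Hd x : 0 <= vdist x x0 by exact: vdist_ge0.
have cB x : 0 <= c x <= h * h by apply: cap_bounds.
have clip := cap_lip Hh Rle_0_1 Hd (lip_vdist x0).
have H2h : 0 <= 2 * h * 1 by lra.
have csq := lip_sq cB H2h clip.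
have cc x := @cap_cases N h (fun y => vdist y x0) x Hh (Hd x).
pose K := INR N + 2 * (h * h) * (2 * h * 1).
have HNp := pos_INR N.
have HK : INR N <= K by have : 0 < h * h * h; [do !apply: Rmult_lt_0_compat|rewrite /K; nra].
pose u0 x := Q x + c x * c x.
have L0 : lip K u0 by apply: lip_plus; [exact: Qh_lip|exact: csq].
have LQ : lip K Q by apply: lip_weaken HK _; exact: Qh_lip.
have HK0 : 0 <= K by lra.
have [m [Lm [Em [Um Hm]]]] := mcshane HO (bounded_complement HN bO) L0 HK0.
have EQ x : ~ O x -> u0 x = Q x.
  move=> Ox; rewrite /u0; suff -> : c x = 0 by ring.
  case: (cc x) => [[H _]|[_ //]].
  by case: Ox; apply: cube => i; apply: Rle_trans (vdist_coord _ _ _) _.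
pose q x := h * h - vdist x x0 * vdist x x0.
have cq x : q x <= c x /\ (c x = 0 \/ c x = q x).
  have := cc x; have := cB x; rewrite -/c -/(q x) => Bx.
  by case=> [[H1 ->]|[H1 E]]; [split; [lra|right]|split; [rewrite E /q; nra|left]].
have qE x v : q (vadd x v) = q x - 2 * dot (vsub x x0) v - dot v v /\
              q (vsub x v) = q x + 2 * dot (vsub x x0) v - dot v v.
  rewrite /q !vnorm_sq.
  have -> : vsub (vadd x v) x0 = vadd (vsub x x0) v.
    by vec_ring.
  have -> : vsub (vsub x v) x0 = vsub (vsub x x0) v.
    by vec_ring.
  by move: (vsub x x0) => d; rewrite !(dot_addl, dot_addr, dot_subl, dot_subr) (dotC v d); split; ring.
(* [cup] and [clow] enclose c^2 between its linearisation and the square of the smooth profile based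
   at x; they hold across the edge of the support. *)
have cup x y : c y * c y <= (c x + (q y - q x)) * (c x + (q y - q x)).
  have [H1 H2] := cq x; have [H3 [->|E]] := cq y; first by have := Rle_0_sqr (c x + (q y - q x)); rewrite /Rsqr; lra.
  by have := cB y; rewrite E => By; nra.
have clow x y : c x * c x + 2 * c x * (q y - q x) <= c y * c y.
  have [H1 [->|E]] := cq x; first by have := Rle_0_sqr (c y); rewrite /Rsqr; lra.
  have [H3 _] := cq y; have := cB x; have := Rle_0_sqr (c x - c y); rewrite /Rsqr -E; nra.
(* From above the second difference is at most 8 s^2 + 2 p^2 with s^2 <= D^2 p and p <= 1; from
   below it is at least - 4 c p with c <= h^2. *)
pose C := 2 + 8 * (D * D) + 4 * (h * h).
have HC : 0 <= C by rewrite /C; nra.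
have sdc x v : O x -> vnorm v < 1 -> - C * dot v v <= sd (fun y => c y * c y) x v <= C * dot v v.
  move=> Ox Hv; have [E1 E2] := qE x v; set s := dot (vsub x x0) v in E1 E2; set p := dot v v in E1 E2 *.
  have Hp : 0 <= p <= 1.
    by rewrite /p -vnorm_sq; have := vnorm_ge0 v; nra.
  have Hs : s * s <= D * D * p.
    have Hcs : Rabs s <= vdist x x0 * vnorm v.
      apply: Rabs_le; split; last exact: cauchy_schwarz.
      have := cauchy_schwarz (vscale (-1) (vsub x x0)) v; rewrite dot_scall vnorm_scale Rabs_Ropp Rabs_R1.
      by rewrite -/(vdist x x0) -/s; lra.
    have -> : s * s = Rabs s * Rabs s by rewrite Rabs_sq.
    have -> : D * D * p = (D * vnorm v) * (D * vnorm v) by rewrite /p -vnorm_sq; ring.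
    have := HDx x Ox; have := vnorm_ge0 v; have := Rabs_pos s => ? ? ?.
    by apply: Rmult_le_compat => //; apply: Rle_trans Hcs _; apply: Rmult_le_compat_r.
  have U1 := cup x (vadd x v); have U2 := cup x (vsub x v).
  have V1 := clow x (vadd x v); have V2 := clow x (vsub x v).
  rewrite E1 in U1 V1; rewrite E2 in U2 V2; have Bx := cB x; rewrite /sd; split.
    have : c x * p <= h * h * p by apply: Rmult_le_compat_r; lra.
    have : 0 <= (2 + 8 * (D * D)) * p by apply: Rmult_le_pos; nra.
    rewrite /C; lra.
  have Hcp : 0 <= c x * p by apply: Rmult_le_pos; lra.
  have : p * p <= p by nra.
  have : 0 <= 4 * (h * h) * p by apply: Rmult_le_pos; nra.
  rewrite /C; lra.
have Hcsq x : 0 <= c x * c x by exact: Rle_0_sqr.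
have rh : 0 < h / 2 by lra.
(* On the ball of radius h / 2 one has c >= 3 h^2 / 4, and this is the square; [rho] below puts the
   cube inside that ball. *)
have re : 0 < 9 / 16 * (h * h) * (h * h) by do !apply: Rmult_lt_0_compat; lra.
have HNh : 0 < INR N + 1 by lra.
pose rho := h / (2 * (INR N + 1)).
have Hrho : 0 < rho by apply: Rdiv_lt_0_compat; lra.
have Erho : (INR N + 1) * rho = h / 2 by rewrite /rho; field; lra.
have HrhoN : rho <= h by nra.
apply: (@exponential_gap_intro N 1 Lam O x0 (K + 1) Q m u0 C (mudecay rho) (kdecay rho (9 / 16 * (h * h) * (h * h)))) => //.
- by apply: lip_weaken LQ; lra.
- by apply: lip_weaken L0; lra.
- by move=> x; have := Um x; rewrite /u0 in Um *; have := Hcsq x; lra.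
- by move=> x Ox; rewrite Em // EQ.
- move=> x Ox; exists (fun=> True); split; first by apply: dim_all; rewrite subSS subn0.
  by exists 1; split; [lra|move=> v _ _; rewrite Rmult_0_l; exact: sdge_Qh].
- apply: (@cone_sdle N O m (K + 1)); first lra.
  by move=> x; have [p [Op [E Hy]]] := Hm x; exists p; split => //; exists (u0 p).
- move=> x Ox _; exists (fun=> True); split; first by apply: dim_all; rewrite subSS subn0.
  exists 1; split; first lra.
  move=> v _ Hv; have [H1 _] := sdc x v Ox Hv; have := sdge_Qh 1 x v.
  by rewrite /u0 sd_plus -/Q; lra.
- move=> x Ox _; exists (fun v : vec N => forall i : 'I_N, ~~ (i < 1)%nat -> v i = 0); split; first exact: dim_P.
  exists 1; split; first lra.
  move=> v Vv Hv; have [_ H1] := sdc x v Ox Hv; rewrite /u0 sd_plus.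
  have -> : sd Q x v = 0.
    rewrite /sd /Q /Qh (sumW_ext (f := fun i => Rabs (relc x0 (vadd x v) i)) (g := fun i => Rabs (relc x0 x i))).
      rewrite (sumW_ext (f := fun i => Rabs (relc x0 (vsub x v) i)) (g := fun i => Rabs (relc x0 x i))); first ring.
      by move=> i Hi; rewrite /relc /vsub (Vv i Hi) Rminus_0_r.
    by move=> i Hi; rewrite /relc /vadd (Vv i Hi) Rplus_0_r.
  by rewrite Rplus_0_l.
- by apply: Rdiv_lt_0_compat; [lra|nra].
- exact: Rmin_pos.
- move=> z Sz; apply: (static_le0 HN HL bO Ox0 Sz).
  by move=> x [_ Ox]; rewrite EQ //; exact: Rle_refl.
have cube' x : (forall i, Rabs (relc x0 x i) <= rho) -> O x.
  by move=> Hx; apply: cube => i; apply: Rle_trans (Hx i) _.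
move=> u Su; apply: (dynamic_lower (j := 1) isT HN HL bO Hrho re cube' Su).
- move=> x t Cx Ht _.
  (* Freezing the signs at x gives an affine minorant of [Q] that touches it at x; affine functions
     are stationary subsolutions. *)
  pose sg i := if Rle_dec 0 (relc x0 x i) then 1 else -1.
  pose th y := sumW 1 (fun i => sg i * relc x0 y i).
  have thQ y : th y <= Q y.
    apply: sumW_le => i _; rewrite /sg /=; case: (Rle_dec 0 (relc x0 x i)) => ? /=; have := Rle_abs (relc x0 y i).
      lra.
    by have := Rle_abs (- relc x0 y i); rewrite Rabs_Ropp; lra.
  have -> : Qh 1 x0 x = th x.
    apply: sumW_ext => i _; rewrite /sg /Rabs; case: (Rle_dec 0 (relc x0 x i)) => ? /=; case: Rcase_abs => ?; lra.
  apply: (compare_static HL _ HO bO Su) => //.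
  + by apply: sumW_smooth => i; apply: smooth_mult; [exact: smooth_const|exact: relc_smooth].
  + move=> y _; exists (fun=> True); split; first by apply: dim_all; rewrite subSS subn0.
    exists 1; split; first lra.
    move=> v _ _; rewrite Rmult_0_l /sd /th -sumW_add -sumW_scal.
    by right; apply: esym; apply: Rminus_diag_eq; apply: sumW_ext => i _; rewrite /relc /vadd /vsub; ring.
  + by move=> y _; have := thQ y; have := Hcsq y; rewrite /u0; lra.
  by move=> y _; have := thQ y; have := Hcsq y; rewrite /u0; lra.
move=> x Hx; have Hdx : vdist x x0 <= h / 2.
  by rewrite -Erho; apply: vnorm_le_coord => //; lra.
case: (cc x) => [[_ E]|[H _]]; last lra.
have HQ := Qh_ge0 1 x0 x; rewrite /u0 /c E -/Q in HQ *.
have := Hd x => Hd0.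
have : 3 / 4 * (h * h) <= h * h - vdist x x0 * vdist x x0 by nra.
have : 0 <= 3 / 4 * (h * h) by nra.
rewrite -/Q in HQ; nra.
Qed.
End FirstEigenvalue.

(** * Intermediate eigenvalues *)

(** Both sides clamp [a] (for w >= 0) or [b] (for w <= 0) to the interval [- |w|, |w|]; the other
    parameter is inactive. *)
Lemma breather_identity w a b :
  Rmax (- Rabs w) (Rmax (Rmin w a) (Rmin (- w) b)) = Rmin (Rabs w) (Rmin (Rmax w b) (Rmax a (- w))).
Proof.
have Mx p q : (p <= q /\ Rmax p q = q) \/ (q <= p /\ Rmax p q = p).
  by case: (Rle_lt_dec p q) => H; [left; rewrite Rmax_right|right; rewrite Rmax_left]; lra.
have Mn p q : (p <= q /\ Rmin p q = p) \/ (q <= p /\ Rmin p q = q).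
  by case: (Rle_lt_dec p q) => H; [left; rewrite Rmin_left|right; rewrite Rmin_right]; lra.
rewrite /Rabs; case: Rcase_abs => Hw;
 case: (Mn w a) => -[? ->]; case: (Mn (- w) b) => -[? ->];
 case: (Mx w b) => -[? ->]; case: (Mx a (- w)) => -[? ->];
 rewrite /Rmin /Rmax; repeat match goal with |- context [Rle_dec ?p ?q] =>
   lazymatch p with context [Rle_dec] => fail | _ =>
   lazymatch q with context [Rle_dec] => fail | _ => case: (Rle_dec p q) => ? end end end; lra.
Qed.

Lemma Rmax_either a b : Rmax a b = a \/ Rmax a b = b.
Proof. by rewrite /Rmax; case: Rle_dec; [right|left]. Qed.

Section Intermediate.
Context (N j : nat) (Hj : (1 < j)%nat) (HjN : (j < N)%nat) (x0 : vec N).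
Implicit Types (x y v : vec N) (i l : 'I_N) (I : pred 'I_N).

Let Hj1 : (1 <= j)%nat := ltnW Hj.
Let HjN1 : (j <= N)%nat := ltnW HjN.
(** Coordinates are numbered from 0, so index j is the first one of x_W. It is the coordinate along
    which the datum is folded; those beyond it stay in [Qt]. *)
Let iw : 'I_N := Ordinal HjN.

Definition supI I x : R :=
  List.fold_right (fun i r => if I i then Rmax (Rabs (relc x0 x i)) r else r) 0 (enum 'I_N).

Lemma supI_ge I x i : I i -> Rabs (relc x0 x i) <= supI I x.
Proof.
move=> Hi; have : i \in enum 'I_N by rewrite mem_enum.
rewrite /supI; elim: (enum _) => [|a s IH] //=; rewrite in_cons => /orP [/eqP <-|/IH H].
  by rewrite Hi; exact: Rmax_l.
by case: (I a) => //; apply: Rle_trans H _; exact: Rmax_r.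
Qed.

Lemma supI_ge0 I x : 0 <= supI I x.
Proof.
rewrite /supI; elim: (enum _) => [|a s IH] /=; first lra.
by case: (I a) => //; apply: Rle_trans IH _; exact: Rmax_r.
Qed.

Lemma supI_le I x c : 0 <= c -> (forall i, I i -> Rabs (relc x0 x i) <= c) -> supI I x <= c.
Proof.
move=> Hc H; rewrite /supI; elim: (enum _) => [|a s IH] //=.
by case: (boolP (I a)) => // /H Ha; apply: Rmax_lub.
Qed.

Lemma supI_attained I x : (exists i, I i) -> exists i, I i /\ supI I x = Rabs (relc x0 x i).
Proof.
move=> [i1 Hi1].
have [H|[i [Hi H]]] : supI I x = 0 \/ exists i, I i /\ supI I x = Rabs (relc x0 x i).
  rewrite /supI; elim: (enum _) => [|a s IH] /=; first by left.
  case: (boolP (I a)) => // Ha; rewrite /Rmax; case: Rle_dec => _ //.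
  by right; exists a.
  exists i1; split => //; rewrite H; have := supI_ge x Hi1; have := Rabs_pos (relc x0 x i1); lra.
by exists i.
Qed.

Lemma supI_lip I : lip 1 (supI I).
Proof.
move=> x y; suff: supI I x <= supI I y + 1 * vdist x y by lra.
apply: supI_le; first by have := supI_ge0 I y; have := vdist_ge0 x y; lra.
move=> i Hi; have := supI_ge y Hi; have := vdist_coord x y i; have := Rabs_triang (x i - y i) (relc x0 y i).
by rewrite (_ : x i - y i + relc x0 y i = relc x0 x i); [lra|rewrite /relc; ring].
Qed.

Lemma supI_homogeneous I x y c : 0 <= c -> (forall i, I i -> relc x0 y i = c * relc x0 x i) ->
  supI I y = c * supI I x.
Proof.
move=> Hc H; rewrite /supI; elim: (enum _) => [|a s IH] /=; first ring.
case: (boolP (I a)) => // Ha.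
by rewrite IH H // Rabs_mult (Rabs_pos_eq c) // RmaxRmult.
Qed.

Definition ww x : R := relc x0 x iw.
Definition Qt x : R := sumI (fun i => if (j < i)%nat then Rabs (relc x0 x i) else 0).

Lemma Qh_split x : Qh j x0 x = Rabs (ww x) + Qt x.
Proof.
rewrite /Qh /sumW -(sumI_delta iw (fun i => Rabs (relc x0 x i))) -sumI_add.
apply: sumI_ext => i; rewrite ltnNge leq_eqVlt -(inj_eq val_inj) /= eq_sym.
by case: eqP => [E|_] /=; [rewrite E ltnn; lra|case: (j < i)%nat => /=; lra].
Qed.

Lemma Qt_ge0 x : 0 <= Qt x.
Proof. by apply: sumI_ge0 => i; case: ifP => _; [exact: Rabs_pos|lra]. Qed.

Lemma Qt_lip : lip (INR N) Qt.
Proof.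
move=> x y; rewrite /Qt; set A := sumI _; set B := sumI _.
have -> : A - B = sumI (fun i => (if (j < i)%nat then Rabs (relc x0 x i) else 0) + -1 * (if (j < i)%nat then Rabs (relc x0 y i) else 0)).
  by rewrite sumI_add sumI_scal -/A -/B; ring.
apply: sumI_const_le => i; case: ifP => _; last by have := vdist_ge0 x y; lra.
have := vdist_coord x y i; have := Rabs_triang (x i - y i) (relc x0 y i).
by rewrite (_ : x i - y i + relc x0 y i = relc x0 x i); [lra|rewrite /relc; ring].
Qed.

Lemma Qt_sd x v : 0 <= sd Qt x v.
Proof.
have -> : sd Qt x v = sumI (fun i => (if (j < i)%nat then Rabs (relc x0 (vadd x v) i) else 0) +
   (if (j < i)%nat then Rabs (relc x0 (vsub x v) i) else 0) + -2 * (if (j < i)%nat then Rabs (relc x0 x i) else 0)).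
  by rewrite !sumI_add sumI_scal /sd /Qt; ring.
apply: sumI_ge0 => i; case: ifP => _; last lra.
have := Rabs_triang (relc x0 (vadd x v) i) (relc x0 (vsub x v) i).
have -> : relc x0 (vadd x v) i + relc x0 (vsub x v) i = 2 * relc x0 x i by rewrite /relc /vadd /vsub; ring.
by rewrite Rabs_mult (Rabs_pos_eq 2); lra.
Qed.

Lemma Qt_const x y : (forall i, (j < i)%nat -> y i = x i) -> Qt y = Qt x.
Proof. by move=> H; apply: sumI_ext => i; case: (boolP (j < i)%nat) => // /H; rewrite /relc => ->. Qed.

Lemma iw_notP : (iw < j)%nat = false. Proof. exact: ltnn. Qed.

(** A tilted copy of the x_P space. It is needed where two branches of a maximum meet: the tilt
    makes both vary by the same linear amount. *)
Lemma dim_P_tilt l i1 tau : ~~ (l < j)%nat -> (i1 < j)%nat ->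
  dim_ge j (fun v => forall k : 'I_N, ~~ (k < j)%nat -> v k = if k == l then tau * v i1 else 0).
Proof.
move=> Hl Hi1.
apply: dim_ge_weaken (dim_ge_graph (fun i k => if (i == i1) && (k == l) then tau else 0) (card_P HjN1)) _.
move=> v H k Hk; rewrite H // -(sumI_delta i1 (fun i => if k == l then tau * v i else 0)).
apply: sumI_ext => i /=; case: (boolP (i == i1)) => [/eqP ->|_] /=.
  by rewrite Hi1; case: eqP => _; ring.
by case: ifP => _; ring.
Qed.

(** The free coordinates are i1, i2 and the N - j - 1 ones beyond [iw], in total N + 1 - j. The
    spare index i2 in x_P compensates for [iw], which is tied to i1; this is where j > 1 enters. *)
Lemma dim_sub (i1 i2 : 'I_N) (p : vec N) tau I : (i1 < j)%nat -> (i2 < j)%nat -> i1 != i2 ->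
  ~~ I i2 -> (forall i, I i -> (i < j)%nat) -> p i1 <> 0 ->
  dim_ge (N.+1 - j) (fun v => exists c, v i1 = c * p i1 /\ v iw = tau * c /\ forall i, I i -> v i = c * p i).
Proof.
move=> Hi1 Hi2 Hne I2 IP Hp.
pose S := [pred i : 'I_N | [|| i == i1, i == i2 | ~~ (i < j.+1)%nat]].
have HS : (N.+1 - j <= #|S|)%nat.
  rewrite (eq_card (B := [predU1 i1 & [predU1 i2 & [pred i : 'I_N | ~~ (i < j.+1)%nat]]])); last first.
    by move=> i; rewrite !inE.
  rewrite !cardU1 !inE (negbTE Hne) /= !negbK (leqW Hi1 : (i1 < j.+1)%nat) (leqW Hi2 : (i2 < j.+1)%nat) !add1n.
  have := @card_W N j.+1; have -> : (N.+1 - j = (N - j.+1).+2)%nat by rewrite subSn // -subnSK.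
  by rewrite !ltnS.
apply: dim_ge_weaken (dim_ge_graph (fun i k => if i == i1 then (if k == iw then tau / p i1 else p k / p i1) else 0) HS) _.
move=> v H; exists (v i1 / p i1); split; first by field.
have key k : ~~ S k -> v k = v i1 * (if k == iw then tau / p i1 else p k / p i1).
  move=> Hk; rewrite H // -(sumI_delta i1 (fun i => v i * (if k == iw then tau / p i1 else p k / p i1))).
  apply: sumI_ext => i /=; case: (boolP (i == i1)) => [_|_] //=.
  by case: ifP => _; ring.
split.
  rewrite key ?eqxx; first by field.
  rewrite /= !negb_or negbK ltnS leqnn andbT -!(inj_eq val_inj) /=.
  by rewrite !neq_ltn Hi1 Hi2 !orbT.
move=> i Ii; case: (boolP (i == i1)) => [/eqP ->|Hi]; first by field.
rewrite key; last first.
  rewrite /= (negbTE Hi) /= negb_or negbK ltnS (ltnW (IP i Ii)) andbT.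
  by apply: contra I2 => /eqP <-.
case: eqP => [E|_]; last by field.
by have := IP i Ii; rewrite E iw_notP.
Qed.

Context (h k eps : R) (Hh : 0 < h) (Hk : 0 < k) (Heps : 0 < eps) (Hke : 2 * eps * h <= k).

Definition slope I x : R := k * (h - supI I x).

Lemma slope_lip I : lip k (slope I).
Proof.
move=> x y; have := supI_lip I y x; rewrite vdist_sym /slope => H.
have := Rmult_le_compat_l k _ _ (Rlt_le _ _ Hk) H; lra.
Qed.

Lemma ww_sd sg x v : sg * ww (vadd x v) = sg * ww x + sg * v iw /\ sg * ww (vsub x v) = sg * ww x - sg * v iw.
Proof. by rewrite /ww /relc /vadd /vsub; split; ring. Qed.

(** Where the first branch is strictly larger, the function is constant along x_P. Otherwise [slope]
    lies below an affine function of the coordinate realising the supremum, and a tilted x_P space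
    makes the first branch follow it. *)
Lemma slope_super sg I x : (sg = 1 \/ sg = -1) -> (exists i, I i) -> (forall i, I i -> (i < j)%nat) ->
  sdle j (fun y => Rmax (sg * ww y) (slope I y) + Qt y) x 0.
Proof.
move=> Hsg [i Ii] IP; have [i1 [Ii1 E1]] := supI_attained x (ex_intro _ i Ii).
case: (Rlt_le_dec (slope I x) (sg * ww x)) => Hlt.
  exists (fun v => forall l, ~~ (l < j)%nat -> v l = 0); split; first exact: dim_P.
  exists ((sg * ww x - slope I x) / k); split; first by apply: Rdiv_lt_0_compat; lra.
  move=> v Hv Hvn; rewrite Rmult_0_l /sd.
  have Hkv : k * vnorm v < sg * ww x - slope I x.
    have -> : sg * ww x - slope I x = k * ((sg * ww x - slope I x) / k) by field; lra.
    exact: Rmult_lt_compat_l.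
  have W0 : v iw = 0 by apply: Hv; rewrite iw_notP.
  have [-> ->] := ww_sd sg x v; rewrite W0.
  have S1 := slope_lip I (vadd x v) x; have S2 := slope_lip I (vsub x v) x.
  rewrite vdist_addr in S1; rewrite vdist_subr in S2.
  rewrite !(Qt_const (x := x)).
  - by rewrite !Rmax_left; lra.
  - by move=> l Hl; rewrite /vsub Hv; [ring|rewrite -leqNgt ltnW].
  by move=> l Hl; rewrite /vadd Hv; [ring|rewrite -leqNgt ltnW].
pose s := if Rle_dec 0 (relc x0 x i1) then 1 else -1.
have Es : supI I x = s * relc x0 x i1.
  by rewrite E1 /s /Rabs; case: Rle_dec => ? /=; case: Rcase_abs => ?; lra.
have Ms y : s * relc x0 y i1 <= supI I y.
  apply: Rle_trans (supI_ge y Ii1); rewrite /s; case: Rle_dec => ? /=; have := Rle_abs (relc x0 y i1); first lra.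
  by have := Rle_abs (- relc x0 y i1); rewrite Rabs_Ropp; lra.
(* With this tilt sg * v iw equals - k s v i1, the increment of the affine majorant k (h - s x_i1)
   of [slope]. *)
exists (fun v => forall l, ~~ (l < j)%nat -> v l = if l == iw then (- sg * k * s) * v i1 else 0).
split; first by apply: dim_P_tilt; [rewrite iw_notP|exact: IP].
exists 1; split; first lra.
move=> v Hv _; rewrite Rmult_0_l /sd.
have W0 : v iw = - sg * k * s * v i1 by rewrite Hv ?eqxx // iw_notP.
have Hl l : (j < l)%nat -> v l = 0.
  move=> Hl; rewrite Hv; last by rewrite -leqNgt ltnW.
  by case: eqP => // E; rewrite E /= ltnn in Hl.
have W1 : sg * v iw = - (k * s * v i1) by rewrite W0; case: Hsg => ->; ring.
have [-> ->] := ww_sd sg x v; rewrite W1.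
rewrite !(Qt_const (x := x)); last first.
- by move=> l /Hl E; rewrite /vadd E; ring.
- by move=> l /Hl E; rewrite /vsub E; ring.
have M1 := Ms (vadd x v); have M2 := Ms (vsub x v).
have T1 : slope I (vadd x v) <= slope I x - k * s * v i1.
  rewrite /slope Es; have : s * relc x0 (vadd x v) i1 = s * relc x0 x i1 + s * v i1 by rewrite /relc /vadd; ring.
  move=> E; rewrite E in M1; have := Rmult_le_compat_l k _ _ (Rlt_le _ _ Hk) M1; lra.
have T2 : slope I (vsub x v) <= slope I x + k * s * v i1.
  rewrite /slope Es; have : s * relc x0 (vsub x v) i1 = s * relc x0 x i1 - s * v i1 by rewrite /relc /vsub; ring.
  move=> E; rewrite E in M2; have := Rmult_le_compat_l k _ _ (Rlt_le _ _ Hk) M2; lra.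
rewrite (Rmax_right (sg * ww x)) //.
have : Rmax (sg * ww x + - (k * s * v i1)) (slope I (vadd x v)) <= slope I x - k * s * v i1.
  by apply: Rmax_lub; lra.
have : Rmax (sg * ww x - - (k * s * v i1)) (slope I (vsub x v)) <= slope I x + k * s * v i1.
  by apply: Rmax_lub; lra.
lra.
Qed.

(** Along dilations of the coordinates in [I] the supremum norm is linear, and moving [iw] at the
    matching rate keeps the difference of the two branches constant, so the minimum is affine and
    the convex [Qt] only helps. *)
Lemma slope_sub sg I i1 i2 x : (sg = 1 \/ sg = -1) -> I i1 -> (forall i, I i -> (i < j)%nat) ->
  (i2 < j)%nat -> ~~ I i2 -> sg * ww x < k * h ->
  sdge (N.+1 - j) (fun y => Rmin (sg * ww y) (slope I y) + Qt y) x 0.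
Proof.
move=> Hsg Ii1 IP Hi2 I2 Hw.
have IN2 i : I i -> i != i2 by move=> Hi; apply: contra I2 => /eqP <-.
have red v : 0 <= sd (fun y => Rmin (sg * ww y) (slope I y)) x v ->
    0 * dot v v <= sd (fun y => Rmin (sg * ww y) (slope I y) + Qt y) x v.
  by rewrite sd_plus Rmult_0_l; have := Qt_sd x v; lra.
case: (classic (exists i, I i /\ relc x0 x i <> 0)) => [[i [Ii Hi]]|Hz].
  exists (fun v => exists c, v i = c * relc x0 x i /\ v iw = - sg * k * supI I x * c /\ forall l, I l -> v l = c * relc x0 x l).
  split; first by apply: (@dim_sub i i2 (relc x0 x)) => //; [exact: IP|exact: IN2].
  exists (Rabs (relc x0 x i)); split; first exact: Rabs_pos_lt.
  move=> v [c [E1 [E2 E3]]] Hv; apply: red.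
  have Hc : Rabs c < 1.
    apply: (Rmult_lt_reg_r (Rabs (relc x0 x i))); first exact: Rabs_pos_lt.
    by rewrite -Rabs_mult -E1 Rmult_1_l; apply: Rle_lt_trans (coord_le v i) Hv.
  have [? ?] := Rabs_def2 _ _ Hc.
  have M1 : supI I (vadd x v) = (1 + c) * supI I x.
    by apply: supI_homogeneous; [lra|move=> l /E3 E; rewrite /relc /vadd E /relc; ring].
  have M2 : supI I (vsub x v) = (1 - c) * supI I x.
    by apply: supI_homogeneous; [lra|move=> l /E3 E; rewrite /relc /vsub E /relc; ring].
  have W1 : sg * v iw = - (k * c * supI I x) by rewrite E2; case: Hsg => ->; ring.
  rewrite /sd; have [-> ->] := ww_sd sg x v; rewrite W1.
  rewrite /slope M1 M2; set m := supI I x; set w := sg * ww x.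
  have -> : k * (h - (1 + c) * m) = k * (h - m) + - (k * c * m) by ring.
  have -> : k * (h - (1 - c) * m) = k * (h - m) - - (k * c * m) by ring.
  by rewrite /Rmin; do !case: Rle_dec => ?; lra.
have Z i : I i -> relc x0 x i = 0 by move=> Ii; apply: NNPP => Hne; apply: Hz; exists i.
have M0 : supI I x = 0.
  apply: Rle_antisym (supI_ge0 I x); apply: supI_le; first lra.
  by move=> i /Z ->; rewrite Rabs_R0; lra.
(* When all coordinates in [I] vanish, [slope] has its top value k h and the other branch is
   strictly active; it suffices to keep [iw] fixed. *)
exists (fun v => exists c, v i1 = c * 1 /\ v iw = 0 * c /\ forall l, I l -> v l = c * 1).
split; first by apply: (@dim_sub i1 i2 (fun=> 1)) => //; [exact: IP|exact: IN2].
exists ((k * h - sg * ww x) / k); split; first by apply: Rdiv_lt_0_compat; lra.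
move=> v [c [_ [E2 _]]] Hv; apply: red.
have W1 : sg * v iw = 0 by rewrite E2; ring.
have Hkv : k * vnorm v < k * h - sg * ww x.
  have -> : k * h - sg * ww x = k * ((k * h - sg * ww x) / k) by field; lra.
  exact: Rmult_lt_compat_l.
have S1 := slope_lip I x (vadd x v); have S2 := slope_lip I x (vsub x v).
rewrite vdist_sym vdist_addr in S1; rewrite vdist_sym vdist_subr in S2.
have S0 : slope I x = k * h by rewrite /slope M0; ring.
rewrite /sd; have [-> ->] := ww_sd sg x v; rewrite W1.
by rewrite !Rmin_left; lra.
Qed.

(** The indices of x_P are divided into two nonempty sets, [I0] and [I1], so that each has a spare
    index in the other, as [slope_sub] requires. *)
Definition I0 : pred 'I_N := [pred i : 'I_N | (i < 1)%nat].
Definition I1 : pred 'I_N := [pred i : 'I_N | (0 < i < j)%nat].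
Definition IP : pred 'I_N := [pred i : 'I_N | (i < j)%nat].
Let j0 : 'I_N := i0 Hj1 HjN1.
Let j1 : 'I_N := Ordinal (ltn_trans Hj HjN).

(* [zeta], [zbar] is the stationary datum: the max form exhibits it as a
   subsolution, the min form ([zbar_min]) as a supersolution. As [k h] is large
   compared with the domain, [zbar = Qh] where the first [j] coordinates are at
   most [3 h / 4]; [breather] replaces [Qh] by [max (Qh, bump)] in the min form, which
   changes it only where [Qh < bump]. *)
Definition zeta x : R :=
  Rmax (- Rabs (ww x)) (Rmax (Rmin (ww x) (slope I0 x)) (Rmin (- ww x) (slope I1 x))).
Definition zbar x : R := zeta x + Qt x.
Definition bump x : R := eps * cap h (supI IP) x.
Definition breather x : R :=
  Rmin (Rmax (Qh j x0 x) (bump x))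
    (Rmin (Rmax (1 * ww x) (slope I1 x) + Qt x) (Rmax (-1 * ww x) (slope I0 x) + Qt x)).

Lemma bump_ge0 x : 0 <= bump x.
Proof. by apply: Rmult_le_pos; [lra|have := cap_bounds Hh (supI_ge0 IP x); lra]. Qed.

Lemma bump_lip : lip (eps * (2 * h)) bump.
Proof.
have := lip_scal eps (cap_lip Hh Rle_0_1 (supI_ge0 IP) (supI_lip IP)).
by rewrite Rabs_pos_eq ?Rmult_1_r; [|lra].
Qed.

Lemma bump_pos x : 0 < bump x -> supI IP x < h /\ bump x = eps * (h * h - supI IP x * supI IP x).
Proof.
rewrite /bump; case: (cap_cases Hh (supI_ge0 IP x)) => [[H1 ->] H|[_ ->]]; last lra.
split => //; case: H1 => // E; rewrite E Rminus_diag in H; lra.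
Qed.

Lemma bump_below x : supI IP x <= h -> bump x = eps * (h * h - supI IP x * supI IP x).
Proof. by rewrite /bump; case: (cap_cases Hh (supI_ge0 IP x)) => [[_ -> //]|[H _]]; lra. Qed.

Lemma supI_mono I I' x : (forall i, I i -> I' i) -> supI I x <= supI I' x.
Proof. by move=> H; apply: supI_le; [exact: supI_ge0|move=> i /H; exact: supI_ge]. Qed.

(** With m the supremum over x_P, eps (h^2 - m^2) = eps (h + m) (h - m) <= 2 eps h (h - m): this is
    the origin of the condition 2 eps h <= k. *)
Lemma bump_le_slope I x : (forall i, I i -> IP i) -> 0 < bump x -> bump x <= slope I x.
Proof.
move=> HI /bump_pos [H1 ->]; rewrite /slope; have := supI_mono x HI; have := supI_ge0 IP x => H2 H3.
apply: (Rle_trans _ (k * (h - supI IP x))); last by apply: Rmult_le_compat_l; lra.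
have -> : eps * (h * h - supI IP x * supI IP x) = (eps * (h + supI IP x)) * (h - supI IP x) by ring.
apply: Rmult_le_compat_r; first lra.
by apply: Rle_trans Hke; have := Rmult_le_compat_l eps _ _ (Rlt_le _ _ Heps) (Rlt_le _ _ H1); lra.
Qed.

Lemma I0P i : I0 i -> IP i. Proof. by move=> H; exact: leq_trans H Hj1. Qed.
Lemma I1P i : I1 i -> IP i. Proof. by case/andP. Qed.
Lemma I0j0 : I0 j0. Proof. by []. Qed.
Lemma I1j1 : I1 j1. Proof. exact: Hj. Qed.

Lemma zbar_min x : zbar x = Rmin (Qh j x0 x)
    (Rmin (Rmax (1 * ww x) (slope I1 x) + Qt x) (Rmax (-1 * ww x) (slope I0 x) + Qt x)).
Proof.
rewrite /zbar /zeta breather_identity Qh_split Rmult_1_l (Rmax_comm (slope I0 x)).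
have -> : -1 * ww x = - ww x by ring.
have E p q c : Rmin (p + c) (q + c) = Rmin p q + c.
  by rewrite /Rmin; case: (Rle_dec (p + c)); case: (Rle_dec p); lra.
by rewrite !E.
Qed.

Lemma zbar_le_breather x : zbar x <= breather x.
Proof. by rewrite zbar_min; apply: Rle_min_compat_r; exact: Rmax_l. Qed.

Lemma breather_eq x : bump x <= Qh j x0 x -> breather x = zbar x.
Proof. by move=> H; rewrite zbar_min /breather Rmax_left. Qed.

Lemma zbar_le_Qh x : zbar x <= Qh j x0 x.
Proof. by rewrite zbar_min; exact: Rmin_l. Qed.

Lemma bump_le_breather x : 0 < bump x -> bump x <= breather x.
Proof.
move=> H; apply: Rmin_glb; first exact: Rmax_r.
have := bump_le_slope I0P H; have := bump_le_slope I1P H; have := Qt_ge0 x => ? ? ?.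
by apply: Rmin_glb; [have := Rmax_r (1 * ww x) (slope I1 x)|have := Rmax_r (-1 * ww x) (slope I0 x)]; lra.
Qed.

Definition KK : R := INR N + k + 1 + eps * (2 * h).

Lemma lips : lip KK zbar /\ lip KK breather.
Proof.
have HN := pos_INR N; have Heh : 0 < eps * (2 * h) by apply: Rmult_lt_0_compat; lra.
have LW s : Rabs s = 1 -> lip (k + 1) (fun x => s * ww x).
  move=> Hs x y; apply: Rle_trans (Rle_abs _) _; rewrite -Rmult_minus_distr_l Rabs_mult Hs Rmult_1_l.
  rewrite /ww /relc (_ : x iw - x0 iw - (y iw - x0 iw) = x iw - y iw); last ring.
  by have := vdist_coord x y iw; have := vdist_ge0 x y; nra.
have LA : lip (k + 1) (fun x => - Rabs (ww x)).
  move=> x y; have := LW 1 Rabs_R1 y x; have := LW 1 Rabs_R1 x y; rewrite (vdist_sym y x) !Rmult_1_l.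
  by rewrite /Rabs; do !case: Rcase_abs => ?; lra.
have LS I : lip (k + 1) (slope I) by apply: lip_weaken (slope_lip I); lra.
have R1 : Rabs (-1) = 1 by rewrite Rabs_Ropp Rabs_R1.
have Lz : lip (k + 1) zeta.
  move=> x y; do !apply: Rmax_lip; first exact: LA.
    by apply: Rmin_lip; [have := LW 1 Rabs_R1 x y; lra|exact: LS].
  by apply: Rmin_lip; [have := LW (-1) R1 x y; lra|exact: LS].
have LM s I : Rabs s = 1 -> lip (k + 1 + INR N) (fun x => Rmax (s * ww x) (slope I x) + Qt x).
  move=> Hs; apply: (lip_plus (f := fun x => Rmax (s * ww x) (slope I x))); last exact: Qt_lip.
  by move=> x y; apply: Rmax_lip; [exact: (LW s Hs)|exact: LS].
split.
  by apply: lip_weaken (lip_plus Lz Qt_lip); rewrite /KK; lra.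
have W f K' : lip K' f -> K' <= KK -> lip KK f by move=> H1 H2; exact: lip_weaken H1.
have F1 : lip KK (Qh j x0) by apply: W (Qh_lip x0 j) _; rewrite /KK; lra.
have F2 : lip KK bump by apply: W bump_lip _; rewrite /KK; lra.
have F3 : lip KK (fun x => Rmax (1 * ww x) (slope I1 x) + Qt x).
  by apply: W (LM 1 I1 Rabs_R1) _; rewrite /KK; lra.
have F4 : lip KK (fun x => Rmax (-1 * ww x) (slope I0 x) + Qt x).
  by apply: W (LM (-1) I0 R1) _; rewrite /KK; lra.
move=> x y; apply: Rmin_lip; first by apply: Rmax_lip; [exact: F1|exact: F2].
by apply: Rmin_lip; [exact: F3|exact: F4].
Qed.

(** Only the active piece of the maximum is tested. The bound |w| < k h is what [slope_sub] asks at
    the top of the slope. *)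
Lemma zbar_sub x : Rabs (ww x) < k * h -> sdge (N.+1 - j) zbar x 0.
Proof.
move=> Hw; have W1 := Rle_abs (ww x); have W2 := Rle_abs (- ww x); rewrite Rabs_Ropp in W2.
have j01 : ~~ I1 j0 by []. have j10 : ~~ I0 j1 by [].
have touch f : (forall y, f y <= zeta y) -> f x = zeta x ->
    sdge (N.+1 - j) (fun y => f y + Qt y) x 0 -> sdge (N.+1 - j) zbar x 0.
  move=> Hf E H; apply: sdge_touch H _; exists 1; split; first lra.
  by move=> y _; rewrite /zbar; have := Hf y; lra.
have Z1 y : - Rabs (ww y) <= zeta y by exact: Rmax_l.
have Z2 y : Rmin (1 * ww y) (slope I0 y) <= zeta y.
  by rewrite Rmult_1_l; apply: Rle_trans (Rmax_r _ _); exact: Rmax_l.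
have Z3 y : Rmin (-1 * ww y) (slope I1 y) <= zeta y.
  rewrite (_ : -1 * ww y = - ww y); last ring.
  by apply: Rle_trans (Rmax_r _ _); exact: Rmax_r.
have [E|[E|E]] : - Rabs (ww x) = zeta x \/ Rmin (1 * ww x) (slope I0 x) = zeta x \/ Rmin (-1 * ww x) (slope I1 x) = zeta x.
- rewrite Rmult_1_l (_ : -1 * ww x = - ww x); last ring.
  rewrite /zeta; case: (Rmax_either (- Rabs (ww x)) (Rmax (Rmin (ww x) (slope I0 x)) (Rmin (- ww x) (slope I1 x)))) => ->; first by left.
  by right; case: (Rmax_either (Rmin (ww x) (slope I0 x)) (Rmin (- ww x) (slope I1 x))) => ->; [left|right].
- apply: (touch (fun y => - Rabs (ww y))) => //.
  (* For the piece - |w| it is enough that directions keep [iw] fixed; the conditions on j0 only fit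
     the format of [dim_sub]. *)
  exists (fun v => exists c, v j0 = c * 1 /\ v iw = 0 * c /\ forall l, pred0 l -> v l = c * 1).
  split; first by apply: (@dim_sub j0 j1 (fun=> 1)) => //; lra.
  exists 1; split; first lra.
  move=> v [c [_ [E2 _]]] _; rewrite sd_plus Rmult_0_l.
  have -> : sd (fun y => - Rabs (ww y)) x v = 0.
    have [] := ww_sd 1 x v; rewrite E2 !Rmult_1_l => A B; rewrite /sd A B.
    by rewrite Rmult_0_l Rplus_0_r Rminus_0_r; ring.
  by have := Qt_sd x v; lra.
- apply: (touch _ Z2 E); apply: (@slope_sub 1 I0 j0 j1) => //; [by left| |lra].
  by move=> i /I0P.
apply: (touch _ Z3 E); apply: (@slope_sub (-1) I1 j1 j0) => //; [by right| |lra].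
by move=> i /I1P.
Qed.

Lemma Qh_P_const x v : (forall i, ~~ (i < j)%nat -> v i = 0) ->
  Qh j x0 (vadd x v) = Qh j x0 x /\ Qh j x0 (vsub x v) = Qh j x0 x.
Proof.
by move=> H; split; apply: sumW_ext => i /H; rewrite /relc /vadd /vsub => ->; rewrite ?Rplus_0_r ?Rminus_0_r.
Qed.

(** Replacing the supremum by the coordinate that realises it at x gives a concave quadratic
    majorant touching at x, which lies below its tangent. *)
Lemma bump_upper x i1 : 0 < bump x -> IP i1 -> supI IP x = Rabs (relc x0 x i1) ->
  exists d, 0 < d /\ forall v, vnorm v < d ->
    bump (vadd x v) <= bump x - 2 * eps * relc x0 x i1 * v i1 /\
    bump (vsub x v) <= bump x + 2 * eps * relc x0 x i1 * v i1.
Proof.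
move=> Hb Pi E; have [Hm Eb] := bump_pos Hb.
exists (h - supI IP x); split; first lra.
have key y : vdist y x < h - supI IP x -> bump y <= bump x - eps * (relc x0 y i1 * relc x0 y i1 - relc x0 x i1 * relc x0 x i1).
  move=> Hy; have Hmy : supI IP y <= h by have := supI_lip IP y x; lra.
  rewrite Eb (bump_below Hmy) E.
  have S1 : Rabs (relc x0 y i1) <= supI IP y by exact: supI_ge.
  have S2 : relc x0 y i1 * relc x0 y i1 <= supI IP y * supI IP y.
    have -> : relc x0 y i1 * relc x0 y i1 = Rabs (relc x0 y i1) * Rabs (relc x0 y i1).
      by rewrite Rabs_sq.
    by apply: Rmult_le_compat => //; exact: Rabs_pos.
  have -> : Rabs (relc x0 x i1) * Rabs (relc x0 x i1) = relc x0 x i1 * relc x0 x i1.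
    by rewrite Rabs_sq.
  by have := Rmult_le_compat_l eps _ _ (Rlt_le _ _ Heps) S2; lra.
move=> v Hv; have := key (vadd x v); have := key (vsub x v); rewrite vdist_addr vdist_subr.
have Hsq : 0 <= eps * (v i1 * v i1) by apply: Rmult_le_pos; [lra|exact: Rle_0_sqr].
move=> /(_ Hv) K1 /(_ Hv) K2; split; [move: K2|move: K1]; rewrite /relc /vadd /vsub; lra.
Qed.

(** If a slope branch of the minimum is active, [slope_super] applies. Otherwise max(Qh, bump) is
    active, and the cases are Qh > bump, Qh = bump = 0, Qh < bump and the tie Qh = bump > 0. *)
Lemma breather_super x : sdle j breather x 0.
Proof.
have touch f : (forall y, breather y <= f y) -> f x = breather x -> sdle j f x 0 -> sdle j breather x 0.
  move=> Hf E H; apply: sdle_touch H _; exists 1; split; first lra.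
  by move=> y _; have := Hf y; lra.
pose f1 y := Rmax (Qh j x0 y) (bump y).
pose f2 y := Rmax (1 * ww y) (slope I1 y) + Qt y.
pose f3 y := Rmax (-1 * ww y) (slope I0 y) + Qt y.
have B1 y : breather y <= f1 y by exact: Rmin_l.
have B2 y : breather y <= f2 y by apply: Rle_trans (Rmin_r _ _) _; exact: Rmin_l.
have B3 y : breather y <= f3 y by apply: Rle_trans (Rmin_r _ _) _; exact: Rmin_r.
case: (Req_dec (f2 x) (breather x)) => [E|N2].
  by apply: (touch f2 B2 E); apply: slope_super; [left|exists j1; exact: I1j1|exact: I1P].
case: (Req_dec (f3 x) (breather x)) => [E|N3].
  by apply: (touch f3 B3 E); apply: slope_super; [right|exists j0|exact: I0P].
have E1 : f1 x = breather x.
  have := B2 x; have := B3 x; have : breather x = Rmin (f1 x) (Rmin (f2 x) (f3 x)) by [].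
  by rewrite /Rmin; do !case: Rle_dec => ?; lra.
apply: (touch f1 B1 E1).
have L1 y : Rabs (bump y - bump x) <= eps * (2 * h) * vdist y x by exact: lip_abs bump_lip.
have Heh : 0 < eps * (2 * h) by apply: Rmult_lt_0_compat; lra.
case: (Rlt_le_dec (bump x) (Qh j x0 x)) => Hlt.
  exists (fun v => forall i, ~~ (i < j)%nat -> v i = 0); split; first exact: dim_P.
  exists ((Qh j x0 x - bump x) / (eps * (2 * h))); split; first by apply: Rdiv_lt_0_compat; lra.
  move=> v Hv Hvn; have [Q1 Q2] := Qh_P_const x Hv.
  have Hkv : eps * (2 * h) * vnorm v < Qh j x0 x - bump x.
    have -> : Qh j x0 x - bump x = eps * (2 * h) * ((Qh j x0 x - bump x) / (eps * (2 * h))) by field; lra.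
    exact: Rmult_lt_compat_l.
  have := L1 (vadd x v); have := L1 (vsub x v); rewrite vdist_addr vdist_subr => /Rabs_le_both [? ?] /Rabs_le_both [? ?].
  by rewrite Rmult_0_l /sd /f1 Q1 Q2 !Rmax_left; lra.
(* If both vanish, x_W is zero and the supremum over x_P is at least h. It is realised in [I0] or in
   [I1], so one slope branch vanishes too and is active, which was excluded. *)
case: (Rle_lt_or_eq_dec _ _ (bump_ge0 x)) => Hb; last first.
  have Q0 : Qh j x0 x = 0 by have := Qh_ge0 j x0 x; lra.
  have W0 : ww x = 0 /\ Qt x = 0.
    have := Qh_split x; have := Qt_ge0 x; have := Rabs_pos (ww x); rewrite Q0 => ? ? ?.
    by split; [apply: NNPP => /Rabs_pos_lt; lra|lra].
  have F1 : f1 x = 0 by rewrite /f1 Q0 -Hb Rmax_left //; lra.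
  have [i [Pi Ei]] := @supI_attained IP x (ex_intro _ j0 (Hj1 : IP j0)).
  have Hmh : h <= supI IP x.
    apply: Rnot_lt_le => Hm; have := bump_below (Rlt_le _ _ Hm); rewrite -Hb.
    have : 0 < h * h - supI IP x * supI IP x by have := supI_ge0 IP x; nra.
    by move=> H1 H2; have := Rmult_lt_0_compat _ _ Heps H1; lra.
  have sl0 I : h <= supI I x -> slope I x <= 0.
    by move=> H; rewrite /slope; have := Rmult_le_compat_l k _ _ (Rlt_le _ _ Hk) H; lra.
  case: (posnP i) => Hi.
    case: N3; rewrite -E1 F1 /f3 (proj1 W0) (proj2 W0) Rmult_0_r Rmax_left; first ring.
    by apply: sl0; rewrite Ei in Hmh; apply: Rle_trans Hmh _; apply: supI_ge; rewrite /I0 /= Hi.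
  case: N2; rewrite -E1 F1 /f2 (proj1 W0) (proj2 W0) Rmult_0_r Rmax_left; first ring.
  by apply: sl0; rewrite Ei in Hmh; apply: Rle_trans Hmh _; apply: supI_ge; rewrite /I1 /= Hi.
have [i1 [Pi1 Ei1]] := @supI_attained IP x (ex_intro _ j0 (Hj1 : IP j0)).
have [d [Hd Kd]] := bump_upper Hb Pi1 Ei1.
case: Hlt => Hlt.
  exists (fun v => forall i, ~~ (i < j)%nat -> v i = 0); split; first exact: dim_P.
  exists (Rmin d ((bump x - Qh j x0 x) / (eps * (2 * h)))); split.
    by apply: Rmin_pos => //; apply: Rdiv_lt_0_compat; lra.
  have := Rmin_l d ((bump x - Qh j x0 x) / (eps * (2 * h))); have := Rmin_r d ((bump x - Qh j x0 x) / (eps * (2 * h))).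
  move=> ? ? v Hv Hvn; have [Q1 Q2] := Qh_P_const x Hv.
  have Hkv : eps * (2 * h) * vnorm v < bump x - Qh j x0 x.
    have -> : bump x - Qh j x0 x = eps * (2 * h) * ((bump x - Qh j x0 x) / (eps * (2 * h))) by field; lra.
    by apply: Rmult_lt_compat_l => //; lra.
  have := L1 (vadd x v); have := L1 (vsub x v); rewrite vdist_addr vdist_subr => /Rabs_le_both [? ?] /Rabs_le_both [? ?].
  have [? ?] := Kd v ltac:(lra).
  by rewrite Rmult_0_l /sd /f1 Q1 Q2 !Rmax_right; lra.
(* At a positive tie some coordinate l of x_W is nonzero, so [Qh] is locally affine in it; tilting
   x_P along l makes [Qh] follow the tangent majorant of [bump]. *)
have [l [Hl Hl0]] : exists l, ~~ (l < j)%nat /\ relc x0 x l <> 0.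
  apply: NNPP => Hn; have : Qh j x0 x = 0; last lra.
  apply: sumI_0 => l; case: (boolP (l < j)%nat) => // Hl.
  have -> : relc x0 x l = 0 by apply: NNPP => Hne; apply: Hn; exists l.
  exact: Rabs_R0.
pose s := if Rle_dec 0 (relc x0 x l) then 1 else -1.
have Es : Rabs (relc x0 x l) = s * relc x0 x l.
  by rewrite /s /Rabs; case: Rle_dec => ? /=; case: Rcase_abs => ?; lra.
have Ess : s * s = 1 by rewrite /s; case: Rle_dec => ? /=; lra.
pose tau := - s * (2 * eps * relc x0 x i1).
exists (fun v => forall i, ~~ (i < j)%nat -> v i = if i == l then tau * v i1 else 0).
split; first exact: dim_P_tilt.
exists (Rmin d (Rabs (relc x0 x l))); split; first by apply: Rmin_pos => //; exact: Rabs_pos_lt.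
have := Rmin_l d (Rabs (relc x0 x l)); have := Rmin_r d (Rabs (relc x0 x l)) => ? ? v Hv Hvn.
have Evl : s * v l = - (2 * eps * relc x0 x i1 * v i1).
  rewrite Hv // eqxx /tau (_ : s * (- s * (2 * eps * relc x0 x i1) * v i1) = - (s * s) * (2 * eps * relc x0 x i1 * v i1)); last ring.
  by rewrite Ess; ring.
have Hvl : Rabs (v l) < Rabs (relc x0 x l) by apply: Rle_lt_trans (coord_le v l) _; lra.
have absE t : Rabs t < Rabs (relc x0 x l) -> Rabs (relc x0 x l + t) = Rabs (relc x0 x l) + s * t.
  by rewrite /s /Rabs; case: Rle_dec => ? /=; do !case: Rcase_abs => ?; lra.
have Qsum y t : (forall i, ~~ (i < j)%nat -> relc x0 y i = relc x0 x i + if i == l then t else 0) ->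
    Rabs t < Rabs (relc x0 x l) -> Qh j x0 y = Qh j x0 x + s * t.
  move=> Hy Ht; rewrite -(sumI_delta l (fun=> s * t)) /Qh /sumW -sumI_add; apply: sumI_ext => i.
  case: (boolP (i < j)%nat) => Hi.
    by case: eqP => [E|_]; [rewrite -E Hi in Hl|ring].
  rewrite (Hy i Hi); case: eqP => [->|_]; first exact: absE.
  by rewrite !Rplus_0_r.
have Q1 : Qh j x0 (vadd x v) = Qh j x0 x + s * v l.
  apply: Qsum => // i Hi; rewrite /relc /vadd; case: eqP => [->|/eqP Hne]; first ring.
  by rewrite (Hv i Hi) (negbTE Hne); ring.
have Q2 : Qh j x0 (vsub x v) = Qh j x0 x + s * - v l.
  apply: Qsum; last by rewrite Rabs_Ropp.
  move=> i Hi; rewrite /relc /vsub; case: eqP => [->|/eqP Hne]; first ring.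
  by rewrite (Hv i Hi) (negbTE Hne); ring.
have [K1 K2] := Kd v ltac:(lra).
have F1 : f1 (vadd x v) <= f1 x - 2 * eps * relc x0 x i1 * v i1.
  by rewrite /f1 Q1 Evl -Hlt (Rmax_left (Qh j x0 x)); [apply: Rmax_lub; lra|lra].
have Es2 : s * - v l = 2 * eps * relc x0 x i1 * v i1 by rewrite -Ropp_mult_distr_r Evl; ring.
have F2 : f1 (vsub x v) <= f1 x + 2 * eps * relc x0 x i1 * v i1.
  by rewrite /f1 Q2 Es2 -Hlt (Rmax_left (Qh j x0 x)); [apply: Rmax_lub; lra|lra].
by rewrite Rmult_0_l /sd; lra.
Qed.

(** Under the dilation of x_P by 1 + c the supremum m becomes (1 + c) m, and the second difference
    is - 2 eps c^2 m^2. At the centre, m is at most vnorm v in every direction. *)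
Lemma bump_sub x : 0 < bump x -> sdge (N.+1 - j) bump x (- (2 * eps)).
Proof.
move=> Hb; have [Hm Eb] := bump_pos Hb.
exists (fun v => (exists i, (i < j)%nat /\ relc x0 x i <> 0) -> exists c, forall i, (i < j)%nat -> v i = c * relc x0 x i).
split; first exact: dim_radial.
have [i1 [Pi1 Ei1]] := @supI_attained IP x (ex_intro _ j0 (Hj1 : IP j0)).
case: (classic (exists i : 'I_N, (i < j)%nat /\ relc x0 x i <> 0)) => [Hex|Hn].
  have Hm0 : 0 < supI IP x.
    by have [i [Hi Hne]] := Hex; apply: Rlt_le_trans (supI_ge x (Hi : IP i)); exact: Rabs_pos_lt.
  exists (Rmin (h - supI IP x) (supI IP x)); split; first by apply: Rmin_pos; lra.
  have := Rmin_l (h - supI IP x) (supI IP x); have := Rmin_r (h - supI IP x) (supI IP x) => ? ? v /(_ Hex) [c Hc] Hv.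
  have Evi : Rabs (v i1) = Rabs c * supI IP x by rewrite (Hc i1 Pi1) Rabs_mult Ei1.
  have Hc1 : Rabs c < 1.
    apply: (Rmult_lt_reg_r (supI IP x)) => //; rewrite -Evi.
    by apply: Rle_lt_trans (coord_le v i1) _; lra.
  have [? ?] := Rabs_def2 _ _ Hc1.
  have M1 : supI IP (vadd x v) = (1 + c) * supI IP x.
    by apply: supI_homogeneous; [lra|move=> i /Hc E; rewrite /relc /vadd E /relc; ring].
  have M2 : supI IP (vsub x v) = (1 - c) * supI IP x.
    by apply: supI_homogeneous; [lra|move=> i /Hc E; rewrite /relc /vsub E /relc; ring].
  have N1 := supI_lip IP (vadd x v) x; have N2 := supI_lip IP (vsub x v) x.
  rewrite vdist_addr in N1; rewrite vdist_subr in N2.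
  rewrite /sd Eb !bump_below; try lra.
  rewrite M1 M2.
  have : c * c * (supI IP x * supI IP x) <= dot v v.
    apply: Rle_trans (coord_le_dot v i1).
    have -> : v i1 * v i1 = Rabs (v i1) * Rabs (v i1) by rewrite Rabs_sq.
    have E : Rabs c * Rabs c = c * c by rewrite Rabs_sq.
    by rewrite Evi -E; lra.
  by move=> H; have := Rmult_le_compat_l (2 * eps) _ _ ltac:(lra) H; lra.
have M0 : supI IP x = 0.
  apply: Rle_antisym (supI_ge0 IP x); apply: supI_le; first lra.
  move=> i Hi; rewrite (_ : relc x0 x i = 0) ?Rabs_R0; first lra.
  by apply: NNPP => Hne; apply: Hn; exists i.
exists h; split => // v _ Hv.
have N1 := supI_lip IP (vadd x v) x; have N2 := supI_lip IP (vsub x v) x.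
rewrite vdist_addr M0 in N1; rewrite vdist_subr M0 in N2.
have P1 := supI_ge0 IP (vadd x v); have P2 := supI_ge0 IP (vsub x v).
rewrite /sd Eb !bump_below; try lra.
have Hn0 := vnorm_ge0 v; rewrite M0 -vnorm_sq.
have S1 : supI IP (vadd x v) * supI IP (vadd x v) <= vnorm v * vnorm v by apply: Rmult_le_compat; lra.
have S2 : supI IP (vsub x v) * supI IP (vsub x v) <= vnorm v * vnorm v by apply: Rmult_le_compat; lra.
have := Rmult_le_compat_l eps _ _ ltac:(lra) S1; have := Rmult_le_compat_l eps _ _ ltac:(lra) S2; lra.
Qed.

(** Where the perturbation is visible, [breather] coincides with [bump] at x and stays above it
    nearby. *)
Lemma breather_sub x : zbar x < breather x -> sdge (N.+1 - j) breather x (- (2 * eps)).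
Proof.
move=> Hlt.
have Hq : Qh j x0 x < bump x by apply: Rnot_le_lt => /breather_eq; lra.
have Hb : 0 < bump x by have := Qh_ge0 j x0 x; lra.
have Ex : breather x = bump x.
  apply: Rle_antisym (bump_le_breather Hb); apply: Rle_trans (Rmin_l _ _) _.
  by rewrite Rmax_right; lra.
apply: sdge_touch (bump_sub Hb) _.
have Heh : 0 < eps * (2 * h) by apply: Rmult_lt_0_compat; lra.
exists (bump x / (eps * (2 * h))); split; first exact: Rdiv_lt_0_compat.
move=> y Hy; rewrite Ex; suff: bump y <= breather y by lra.
apply: bump_le_breather.
have := Rmult_lt_compat_l _ _ _ Heh Hy; have := bump_lip x y; rewrite vdist_sym.
have -> : eps * (2 * h) * (bump x / (eps * (2 * h))) = bump x by field; lra.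
lra.
Qed.

Context (Lam : mat N -> R) (HL : elliptic j Lam) (O : vec N -> Prop) (HO : is_open O) (bO : bounded_set O) (Ox0 : O x0).
Context (D : R) (HD : 0 < D) (HDx : forall x, clos O x -> vdist x x0 <= D) (HkD : 4 * D < k * h).
Context (cube : forall x, (forall i, Rabs (relc x0 x i) <= h) -> O x) (Hepsh : eps * h <= 1).

Lemma ww_bound x : clos O x -> Rabs (ww x) <= D.
Proof. by move=> Cx; apply: Rle_trans (vdist_coord x x0 iw) (HDx Cx). Qed.

(** Where the bump exceeds [Qh], x_P is within h, and eps h <= 1 gives Qh < bump <= h, so x lies in
    the cube contained in [O]. *)
Lemma breather_off x : ~ O x -> zbar x = breather x.
Proof.
move=> Ox; apply: esym; apply: breather_eq; apply: Rnot_lt_le => Hq; apply: Ox; apply: cube => i.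
have Hb : 0 < bump x by have := Qh_ge0 j x0 x; lra.
have [Hm Eb] := bump_pos Hb.
case: (boolP (i < j)%nat) => Hi; first by have := supI_ge x (Hi : IP i); lra.
have := @sumW_term N j (fun i => Rabs (relc x0 x i)) i (fun _ _ => Rabs_pos _) Hi; rewrite -/(Qh j x0 x) => H1.
have : bump x <= h; last lra.
rewrite Eb; have := Rle_0_sqr (supI IP x); rewrite /Rsqr => H2.
have := Rmult_le_pos _ _ (Rlt_le _ _ Heps) H2; have := Rmult_le_compat_r h _ _ (Rlt_le _ _ Hh) Hepsh; lra.
Qed.

(** A smooth stationary minorant adjusted to x: exact at x, below [zbar] elsewhere thanks to a
    quadratic penalty in the coordinates of [I]. The penalty is invisible along x_W and the spare
    index i2, where the function is affine. *)
Lemma lower_barrier u sg I i1 i2 x : sol_par Lam O breather breather u -> (sg = 1 \/ sg = -1) ->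
  I i1 -> (forall i, I i -> (i < j)%nat) -> (i2 < j)%nat -> ~~ I i2 ->
  (forall y, Rmin (sg * ww y) (slope I y) <= zeta y) ->
  clos O x -> (forall i, (i < j)%nat -> Rabs (relc x0 x i) <= h / 2) ->
  forall t, 0 <= t -> sg * ww x + Qt x <= u x t.
Proof.
move=> Su Hsg Ii1 HI Hi2 I2 Hz Cx Hx t Ht.
pose s i := if (j < i)%nat then (if Rle_dec 0 (relc x0 x i) then 1 else -1) else 0.
(* Once a coordinate of [I] has moved by h / 4 the penalty is at least 2 D and pushes the minorant
   below - |w|. Before that, [slope] is at least k h / 4 > D, so the branch sg * w is active. *)
pose K' := 32 * D / (h * h).
have HK' : 0 < K' by apply: Rdiv_lt_0_compat; nra.
pose T y := sumI (fun i => if I i then (y i - x i) * (y i - x i) else 0).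
pose L y := sumI (fun i => s i * relc x0 y i).
pose th y := sg * ww y - K' * T y + L y.
have LQ y : L y <= Qt y.
  apply: sumI_le => i; rewrite /s; case: (j < i)%nat; last lra.
  case: (Rle_dec 0 (relc x0 x i)) => ? /=; have := Rle_abs (relc x0 y i); first lra.
  by have := Rle_abs (- relc x0 y i); rewrite Rabs_Ropp; lra.
have T0 y : 0 <= T y by apply: sumI_ge0 => i; case: ifP => _; [exact: Rle_0_sqr|lra].
have <- : th x = sg * ww x + Qt x.
  rewrite /th; have -> : T x = 0 by apply: sumI_0 => i; case: ifP => _ //; ring.
  rewrite Rmult_0_r Rminus_0_r; congr Rplus; apply: sumI_ext => i; rewrite /s.
  case: (j < i)%nat; last ring.
  by case: (Rle_dec 0 (relc x0 x i)) => ? /=; rewrite /Rabs; case: Rcase_abs => ?; lra.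
have thz y : clos O y -> th y <= zbar y.
  move=> Cy; suff: sg * ww y - K' * T y <= zeta y by rewrite /th /zbar; have := LQ y; lra.
  have Wy := ww_bound Cy.
  have Wsg : sg * ww y <= Rabs (ww y).
    have := Rle_abs (ww y); have := Rle_abs (- ww y); rewrite Rabs_Ropp; case: Hsg => ->; lra.
  case: (classic (exists i, I i /\ h / 4 < Rabs (y i - x i))) => [[i [Ii Hi]]|Hn].
    apply: Rle_trans (Rmax_l _ _).
    have HT : h * h / 16 <= T y.
      have := @sumI_term N (fun i => if I i then (y i - x i) * (y i - x i) else 0) i.
      rewrite Ii -/(T y) => H; apply: Rle_trans (H _).
        have -> : (y i - x i) * (y i - x i) = Rabs (y i - x i) * Rabs (y i - x i).
          by rewrite Rabs_sq.
        have : h / 4 * (h / 4) <= Rabs (y i - x i) * Rabs (y i - x i) by apply: Rmult_le_compat; lra.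
        lra.
      by move=> l; case: ifP => _; [exact: Rle_0_sqr|lra].
    have : 2 * D <= K' * T y; last lra.
    have -> : 2 * D = K' * (h * h / 16) by rewrite /K'; field; lra.
    by apply: Rmult_le_compat_l; lra.
  apply: Rle_trans (Hz y); have HKT := Rmult_le_pos _ _ (Rlt_le _ _ HK') (T0 y).
  rewrite Rmin_left; first lra.
  apply: Rle_trans Wsg _; apply: Rle_trans Wy _.
  rewrite /slope; have [i [Ii ->]] := supI_attained y (ex_intro _ i1 Ii1).
  have Hi : Rabs (y i - x i) <= h / 4 by apply: Rnot_lt_le => Hlt; apply: Hn; exists i.
  have := Rabs_triang (y i - x i) (relc x0 x i).
  rewrite (_ : y i - x i + relc x0 x i = relc x0 y i); last by rewrite /relc; ring.
  move=> H; have := Hx i (HI i Ii) => H2.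
  have : k * (h / 4) <= k * (h - Rabs (relc x0 y i)) by apply: Rmult_le_compat_l; lra.
  lra.
apply: (compare_static HL (leqW HjN1) HO bO Su) => //.
- apply: smooth_plus.
    apply: smooth_minus; first by apply: smooth_mult; [exact: smooth_const|exact: relc_smooth].
    apply: smooth_mult; first exact: smooth_const.
    apply: smooth_sum => i; case: (I i); last exact: smooth_const.
    by apply: smooth_mult; apply: smooth_minus; by [exact: smooth_coord|exact: smooth_const].
  by apply: smooth_sum => i; apply: smooth_mult; [exact: smooth_const|exact: relc_smooth].
- move=> y _.
  exists (fun v => forall l, ~~ (~~ (l < j)%nat || (l == i2)) -> v l = 0); split.
    apply: dim_ge_weaken (dim_ge_graph (fun _ _ => 0) (card_W1 HjN1 Hi2)) _ => v H l Hl.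
    by rewrite (H l Hl) sumI_0 // => i; case: ifP => _; ring.
  exists 1; split; first lra.
  move=> v Hv _; rewrite Rmult_0_l; right; rewrite /sd /th.
  have TE r : (forall i, I i -> r i = y i) -> T r = T y.
    by move=> Hr; apply: sumI_ext => i; case: (boolP (I i)) => // /Hr ->.
  have HvI i : I i -> v i = 0.
    move=> Ii; apply: Hv; rewrite negb_or negbK (HI i Ii) /=.
    by apply: contra I2 => /eqP <-.
  rewrite !TE; last first.
  + by move=> i /HvI E; rewrite /vadd E; ring.
  + by move=> i /HvI E; rewrite /vsub E; ring.
  have -> : L (vsub y v) = 2 * L y - L (vadd y v).
    rewrite /L -sumI_scal -[X in _ = _ - X]Rmult_1_l -[X in _ - X]sumI_scal.
    have -> A B : A - B = A + -1 * B by move=> *; ring.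
    rewrite -sumI_scal -sumI_add; apply: sumI_ext => i; rewrite /relc /vadd /vsub; ring.
  have [-> ->] := ww_sd sg y v; ring.
- by move=> y [Cy _]; apply: Rle_trans (thz y Cy) (zbar_le_breather y).
by move=> y Oy; apply: Rle_trans (thz y (clos_sub Oy)) (zbar_le_breather y).
Qed.

Lemma intermediate_gap_aux : exponential_gap Lam O x0.
Proof.
have [L1 L2] := lips.
have Hrho : 0 < h / 2 by lra.
have He0 : 0 < eps * (3 / 4 * (h * h)) by apply: Rmult_lt_0_compat => //; nra.
have cube' x : (forall i, Rabs (relc x0 x i) <= h / 2) -> O x.
  by move=> H; apply: cube => i; have := H i; lra.
apply: (@exponential_gap_intro N j Lam O x0 KK zbar breather breather (2 * eps)
   (mudecay (h / 2)) (kdecay (h / 2) (eps * (3 / 4 * (h * h))))) => //.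
- exact: leqW.
- by move=> x; have := zbar_le_breather x; lra.
- exact: breather_off.
- move=> x Ox; apply: zbar_sub; have := ww_bound (clos_sub Ox); lra.
- by move=> x _; exact: breather_super.
- lra.
- by move=> x _; exact: breather_sub.
- by move=> x _; lra.
- by apply: Rdiv_lt_0_compat; [lra|nra].
- exact: Rmin_pos.
- move=> z Sz; apply: (static_le0 HjN1 HL bO Ox0 Sz).
  by move=> x [_ Ox]; rewrite -breather_off //; exact: zbar_le_Qh.
move=> u Su; apply: (dynamic_lower Hj1 HjN1 HL bO Hrho He0 cube' Su).
- move=> x t Cx Ht Hx; rewrite Qh_split.
  (* The two signs bound [u] below by w + Qt and - w + Qt, hence by Qh = |w| + Qt. *)
  have B1 := @lower_barrier u 1 I0 j0 j1 x Su (or_introl erefl) I0j0 (fun i => @I0P i) Hj isT.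
  have B2 := @lower_barrier u (-1) I1 j1 j0 x Su (or_intror erefl) I1j1 (fun i => @I1P i) Hj1 isT.
  have := B1 _ Cx Hx t Ht; have := B2 _ Cx Hx t Ht.
  rewrite /Rabs; case: Rcase_abs => ? H2 H1.
    suff: -1 * ww x + Qt x <= u x t by lra.
    apply: H2 => y; rewrite (_ : -1 * ww y = - ww y); last ring.
    by apply: Rle_trans (Rmax_r _ _); exact: Rmax_r.
  suff: 1 * ww x + Qt x <= u x t by lra.
  by apply: H1 => y; rewrite Rmult_1_l; apply: Rle_trans (Rmax_r _ _); exact: Rmax_l.
move=> x Hx.
have Hm : supI IP x <= h / 2 by apply: supI_le; [lra|move=> i _; exact: Hx].
have Hm0 := supI_ge0 IP x.
have Hmh : supI IP x <= h by lra.
have H1 : eps * (3 / 4 * (h * h)) <= bump x.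
  have : supI IP x * supI IP x <= h / 2 * (h / 2) by apply: Rmult_le_compat.
  by move=> Hs; rewrite (bump_below Hmh); apply: Rmult_le_compat_l; lra.
have Hb : 0 < bump x by lra.
by have := bump_le_breather Hb; lra.
Qed.
End Intermediate.

Lemma intermediate_gap N j (x0 : vec N) Lam O : (1 < j)%nat -> (j < N)%nat -> elliptic j Lam ->
  is_open O -> bounded_set O -> O x0 -> exponential_gap Lam O x0.
Proof.
move=> Hj HjN HL HO bO Ox0.
have [h [Hh cube]] := small_cube HO Ox0.
have [D [HD HDx]] := bounded_dist x0 (clos_bounded bO).
(* With eps = 1 / h one needs k >= 2 and k h > 4 D. *)
pose k := 2 + (4 * D + 1) / h.
have Hkh : k * h = 2 * h + 4 * D + 1 by rewrite /k; field; lra.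
have Hq : 0 < (4 * D + 1) / h by apply: Rdiv_lt_0_compat; lra.
apply: (@intermediate_gap_aux N j Hj HjN x0 h k (/ h) Hh _ _ _ Lam HL O HO bO Ox0 D HD HDx) => //.
- by rewrite /k; lra.
- exact: Rinv_0_lt_compat.
- by rewrite Rmult_assoc Rinv_l /k; lra.
- lra.
by rewrite Rinv_l; lra.
Qed.

(** * The last eigenvalue *)

Lemma Un_cv_sum n (u : nat -> 'I_n -> R) (l : 'I_n -> R) :
  (forall i, Un_cv (fun k => u k i) (l i)) -> Un_cv (fun k => sumI (u k)) (sumI l).
Proof.
move=> H; rewrite /sumI; elim: (enum _) => [|a s IH] /=.
  by move=> e He; exists O => m _; rewrite /R_dist Rminus_diag Rabs_R0.
exact: (CV_plus (fun k => u k a)).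
Qed.

Lemma Un_cv_const c : Un_cv (fun _ => c) c.
Proof. by move=> e He; exists O => m _; rewrite /R_dist Rminus_diag Rabs_R0. Qed.

Lemma sumI_recl n (f : 'I_n.+1 -> R) : sumI f = f ord0 + sumI (fun i => f (lift ord0 i)).
Proof.
rewrite /sumI enum_ordSl /=; congr Rplus.
by elim: (enum 'I_n) => [|a s IH] //=; rewrite IH.
Qed.

Lemma dot_affine N (s b : vec N) t :
  dot (vadd (vscale (1 - t) s) (vscale t b)) (vadd (vscale (1 - t) s) (vscale t b)) =
  (1 - t) * (1 - t) * dot s s + 2 * t * (1 - t) * dot s b + t * t * dot b b.
Proof. by rewrite dot_addl !dot_addr !dot_scall !dot_scalr (dotC b s); ring. Qed.

Lemma dot_sub_ge0 N (s b : vec N) : 0 <= dot s s - 2 * dot s b + dot b b.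
Proof. by have := dot_ge0 (vsub s b); rewrite dot_subl !dot_subr (dotC b s); lra. Qed.

(** * Convex hulls of compact sets *)

Section ConvexHull.
Context (N : nat) (C : vec N -> Prop).
Implicit Types (x y p e s : vec N).

Definition hull n y : Prop := exists (th : 'I_n -> R) (p : 'I_n -> vec N),
  (forall i, 0 <= th i) /\ sumI th = 1 /\ (forall i, C (p i)) /\ y = lincomb p th.

Context (clC : closed_set_v C) (bC : bounded_set C) (neC : exists p, C p).

Lemma hull_nonempty n : exists y, hull n.+1 y.
Proof.
have [p Cp] := neC; exists p; exists (fun i => if i == ord0 then 1 else 0), (fun=> p).
split; first by move=> i; case: eqP; lra.
split; first exact: (sumI_delta ord0 (fun=> 1)).
by split => //; rewrite (lincomb_delta (fun=> p)).
Qed.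

(** With the number of points fixed, combinations are parametrised by a compact set of weights and
    points, so a minimising sequence converges after extraction. *)
Lemma hull_nearest n x : exists y, hull n.+1 y /\
  forall y', hull n.+1 y' -> dot (vsub y x) (vsub y x) <= dot (vsub y' x) (vsub y' x).
Proof.
pose d y := dot (vsub y x) (vsub y x).
pose E r := exists y, hull n.+1 y /\ r = d y.
have E0 r : E r -> 0 <= r by move=> [y [_ ->]]; exact: dot_ge0.
have [y0 Hy0] := hull_nonempty n.
pose m := Inf E.
have mle y : hull n.+1 y -> m <= d y by move=> Hy; apply: (Inf_le E0); exists y.
have ex k : exists q : ('I_n.+1 -> R) * ('I_n.+1 -> vec N),
    (forall i, 0 <= q.1 i) /\ sumI q.1 = 1 /\ (forall i, C (q.2 i)) /\ d (lincomb q.2 q.1) < m + / (INR k + 1).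
  apply: NNPP => Hn; have Hk : 0 < / (INR k + 1) by apply: Rinv_0_lt_compat; have := pos_INR k; lra.
  have : m + / (INR k + 1) <= m; last lra.
  apply: Inf_ge; first by exists (d y0), y0.
  move=> r [y [[th [p [H1 [H2 [H3 ->]]]]] ->]]; apply: Rnot_lt_le => Hlt.
  by apply: Hn; exists (th, p).
have [q Hq] := choice _ ex.
have [M HM] := bC.
(* All scalar sequences involved, weights and coordinates of points, for one simultaneous
   extraction. *)
pose us := ([seq (fun k => (q k).1 i) | i <- enum 'I_n.+1] ++
  [seq (fun k => (q k).2 il.1 il.2) | il <- enum {: prod 'I_n.+1 'I_N}])%SEQ.
have inmap (I : finType) (f : I -> nat -> R) i : List.In (f i) (map f (enum I)).
  have : i \in enum I by rewrite mem_enum.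
  by elim: (enum I) => [|a s IH] //=; rewrite in_cons => /orP [/eqP ->|/IH H]; [left|right].
have inapp (l1 l2 : seq (nat -> R)) f : List.In f (l1 ++ l2)%SEQ <-> List.In f l1 \/ List.In f l2.
  by elim: l1 => [|a s IH] /=; [tauto|rewrite IH; tauto].
have [|g [Hg1 Hg2]] := @BW_list us (Rmax 1 M).
  move=> f /inapp [].
    elim: (enum 'I_n.+1) => [|a s IH] //= [<- k|/IH //].
    have [H1 [H2 _]] := Hq k; rewrite Rabs_pos_eq //.
    by apply: Rle_trans (Rmax_l _ _); rewrite -H2; apply: sumI_term.
  elim: (enum {: prod 'I_n.+1 'I_N}) => [|a s IH] //= [<- k|/IH //].
  have [_ [_ [H3 _]]] := Hq k; apply: Rle_trans (Rmax_r _ _).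
  exact: Rle_trans (coord_le _ _) (HM _ (H3 _)).
have cvth i : exists l, Un_cv (fun k => (q (g k)).1 i) l.
  apply: (Hg2 (fun k => (q k).1 i)); apply/inapp; left.
  exact: (inmap _ (fun i k => (q k).1 i)).
have [th Hth] := choice _ cvth.
have cvP (il : 'I_n.+1 * 'I_N) : exists l, Un_cv (fun k => (q (g k)).2 il.1 il.2) l.
  apply: (Hg2 (fun k => (q k).2 il.1 il.2)); apply/inapp; right.
  exact: (inmap _ (fun il k => (q k).2 il.1 il.2)).
have [P' HP'] := choice _ cvP.
pose P i : vec N := fun l => P' (i, l).
have HP i l : Un_cv (fun k => (q (g k)).2 i l) (P i l) by exact: (HP' (i, l)).
have HN := pos_INR N.
have CP i : C (P i).
  apply: clC => e He; have He' : 0 < e / (2 * (INR N + 1)) by apply: Rdiv_lt_0_compat; lra.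
  have [k0 Hk0] := Un_cv_finite (u := fun k => (q (g k)).2 i) (HP i) He'.
  have [_ [_ [H3 _]]] := Hq (g k0); exists ((q (g k0)).2 i); split => //.
  apply: (Rle_lt_trans _ ((INR N + 1) * (e / (2 * (INR N + 1))))).
    by apply: vnorm_le_coord; [lra|move=> l; left; apply: Hk0].
  have -> : (INR N + 1) * (e / (2 * (INR N + 1))) = e / 2 by field; lra.
  lra.
have th0 i : 0 <= th i.
  apply: Rnot_lt_le => Hlt; have [k0 Hk0] := Hth i (- th i) ltac:(lra).
  have := Hk0 k0 (le_n _); rewrite /R_dist => /Rabs_def2 [? ?].
  by have [/(_ i) H1 _] := Hq (g k0); lra.
have th1 : sumI th = 1.
  apply: (UL_sequence _ _ _ (Un_cv_sum Hth)).
  move=> e He; exists O => k _; have [_ [-> _]] := Hq (g k).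
  by rewrite /R_dist Rminus_diag Rabs_R0.
have HY : hull n.+1 (lincomb P th) by exists th, P.
exists (lincomb P th); split => // y' /mle; apply: Rle_trans.
have cvd : Un_cv (fun k => d (lincomb (q (g k)).2 (q (g k)).1)) (d (lincomb P th)).
  rewrite /d /dot.
  have cvl l : Un_cv (fun k => lincomb (q (g k)).2 (q (g k)).1 l - x l) (lincomb P th l - x l).
    apply: CV_minus; last exact: Un_cv_const.
    by apply: (@Un_cv_sum _ (fun k i => (q (g k)).1 i * (q (g k)).2 i l)) => i; apply: CV_mult.
  by apply: (@Un_cv_sum _ (fun k l => vsub (lincomb (q (g k)).2 (q (g k)).1) x l * vsub (lincomb (q (g k)).2 (q (g k)).1) x l)) => l; apply: CV_mult; exact: cvl.
apply: Rnot_lt_le => Hlt; pose r := (d (lincomb P th) - m) / 2.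
have Hr : 0 < r by rewrite /r /d; lra.
have [k0 Hk0] := cvd r Hr; have [k1 [Hk1 Hk1']] := archimed_cor1 r Hr.
pose k := max k0 k1.
have := Hk0 k ltac:(rewrite /k; lia); rewrite /R_dist => /Rabs_def2 [B1 B2].
have [_ [_ [_ H4]]] := Hq (g k).
have gk i : (i <= g i)%coq_nat by elim: i => [|i IH]; [lia|have := Hg1 i; lia].
have : / (INR (g k) + 1) < r.
  apply: Rle_lt_trans Hk1; apply: Rinv_le_contravar; first exact: lt_0_INR.
  have := le_INR k1 (g k) ltac:(have := gk k; rewrite /k; lia); lra.
rewrite /r in B2 *; lra.
Qed.

(* Caratheodory with the point itself as the nearest point: a minimiser of the
   distance among combinations of [N+1] points can be rewritten with a vanishing
   weight, which is then available for a better point of [C]. *)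
Lemma mem_hull x : (forall e, exists p, C p /\ 0 <= dot e (vsub p x)) -> hull N.+1 x.
Proof.
move=> Hx; have [y [Hy Hmin]] := hull_nearest N x.
case: (classic (vsub y x = (fun=> 0))) => [E|Hs].
  suff <- : y = x by [].
  by apply: functional_extensionality => i; have := f_equal (fun f => f i) E; rewrite /vsub; lra.
pose s := vsub y x.
have Hss : 0 < dot s s.
  case: (dot_ge0 s) => // E0; case: Hs; apply: functional_extensionality => i.
  by apply: (@vnorm0_eq N s); rewrite /vnorm -E0 sqrt_0.
(* First order condition at the minimiser y, with s = y - x: a segment that starts at y towards w
   inside the hull cannot decrease the distance to x. *)
have step (th : 'I_N.+1 -> R) (p : 'I_N.+1 -> vec N) w : (forall i, 0 <= th i) -> sumI th = 1 -> (forall i, C (p i)) ->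
    y = lincomb p th -> (exists d, 0 < d /\ forall t, 0 < t < d -> hull N.+1 (fun l => (1 - t) * y l + t * w l)) ->
    dot s s <= dot s (vsub w x).
  move=> _ _ _ _ [d [Hd Hh]]; apply: Rnot_lt_le => Hlt.
  pose b := vsub w x; have Hb := dot_ge0 b; rewrite -/b in Hlt.
  pose t0 := (dot s s - dot s b) / (dot s s - 2 * dot s b + dot b b + 1).
  have Hden : 0 <= dot s s - 2 * dot s b + dot b b.
    exact: dot_sub_ge0.
  have Ht0 : 0 < t0 by apply: Rdiv_lt_0_compat; lra.
  pose t := Rmin d t0 / 2.
  have := Rmin_l d t0; have := Rmin_r d t0; have := Rmin_pos _ _ Hd Ht0 => ? ? ?.
  have := Hmin _ (Hh t ltac:(rewrite /t; lra)); rewrite -/s.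
  have -> : vsub (fun l => (1 - t) * y l + t * w l) x = vadd (vscale (1 - t) s) (vscale t b).
    by apply: functional_extensionality => l; rewrite /s /b /vadd /vscale /vsub; ring.
  rewrite dot_affine.
  have Et0 : t0 * (dot s s - 2 * dot s b + dot b b + 1) = dot s s - dot s b by rewrite /t0; field; lra.
  set a := dot s s in Hden Et0 Hlt *; set c := dot s b in Hden Et0 Hlt *; set e := dot b b in Hden Et0 *.
  have Ht : 0 < t by rewrite /t; lra.
  have Htt : t < t0 by rewrite /t; lra.
  have : t * (a - 2 * c + e) < 2 * (a - c).
    have : t * (a - 2 * c + e) <= t0 * (a - 2 * c + e) by apply: Rmult_le_compat_r; lra.
    rewrite -/c in Hlt; lra.
  move=> K; have := Rmult_lt_compat_l _ _ _ Ht K; lra.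
(* A vanishing weight frees a slot for the point w supplied by the hypothesis with e = - s, for
   which dot s (w - x) <= 0 < dot s s. *)
have zero (th : 'I_N.+1 -> R) (p : 'I_N.+1 -> vec N) i : (forall i, 0 <= th i) -> sumI th = 1 -> (forall i, C (p i)) ->
    y = lincomb p th -> th i = 0 -> False.
  move=> H1 H2 H3 H4 Hi; have [w [Cw Hw]] := Hx (vscale (-1) s).
  rewrite dot_scall in Hw; have := @step th p w H1 H2 H3 H4; move=> /(_ _).
  suff Hh : exists d, 0 < d /\ forall t, 0 < t < d -> hull N.+1 (fun l => (1 - t) * y l + t * w l).
    by move=> /(_ Hh); lra.
  exists 1; split; first lra.
  move=> t Ht; exists (fun k => (1 - t) * th k + (if k == i then t else 0)), (fun k => if k == i then w else p k).
  split; first by move=> k; have := H1 k; case: eqP => _ ?; nra.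
  split; first by rewrite sumI_add sumI_scal H2 (sumI_delta i (fun=> t)); ring.
  split; first by move=> k; case: eqP.
  apply: functional_extensionality => l; rewrite H4 /lincomb -sumI_scal -(sumI_delta i (fun=> t * w l)) -sumI_add.
  by apply: sumI_ext => k; case: eqP => [->|_]; rewrite ?Hi; ring.
have [th [p [H1 [H2 [H3 H4]]]]] := Hy.
case: (classic (exists i, th i = 0)) => [[i Hi]|Hn]; first by case: (zero th p i).
have Hpos i : 0 < th i by case: (H1 i) => // E; case: Hn; exists i.
have Hge i : dot s s <= dot s (vsub (p i) x).
  apply: (@step th p) => //; exists 1; split; first lra.
  move=> t Ht; exists (fun k => (1 - t) * th k + (if k == i then t else 0)), p.
  split; first by move=> k; have := H1 k; case: eqP => _ ?; nra.
  split; first by rewrite sumI_add sumI_scal H2 (sumI_delta i (fun=> t)); ring.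
  split=> //; apply: functional_extensionality => l.
  rewrite {1}H4 /lincomb -sumI_scal -(sumI_delta i (fun k => t * p k l)) -sumI_add.
  by apply: sumI_ext => k; case: eqP => [->|_]; ring.
have Hsum : sumI (fun i => th i * (dot s (vsub (p i) x) - dot s s)) = 0.
  have -> : sumI (fun i => th i * (dot s (vsub (p i) x) - dot s s)) =
     sumI (fun i => th i * dot s (p i)) + - (dot s x + dot s s) * sumI th.
    by rewrite -sumI_scal -sumI_add; apply: sumI_ext => i; rewrite dot_subr; ring.
  have -> : sumI (fun i => th i * dot s (p i)) = dot s y.
    rewrite /dot (sumI_ext (g := fun i => sumI (fun l => s l * (th i * p i l)))).
      by rewrite sumI_exch; apply: sumI_ext => l; rewrite sumI_scal H4.
    by move=> i; rewrite -sumI_scal; apply: sumI_ext => l; ring.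
  have Ess : dot s s = dot s y - dot s x by rewrite -dot_subr.
  by rewrite H2 Ess; ring.
have Heq i : dot s (vsub (p i) x) = dot s s.
  apply: Rle_antisym (Hge i); have := @sumI_term _ (fun i => th i * (dot s (vsub (p i) x) - dot s s)) i.
  rewrite Hsum => /(_ _) H; have {}H : th i * (dot s (vsub (p i) x) - dot s s) <= 0.
    by apply: H => k; apply: Rmult_le_pos; [exact: H1|have := Hge k; lra].
  by apply: Rnot_lt_le => Hlt; have : 0 < th i * (dot s (vsub (p i) x) - dot s s); [apply: Rmult_lt_0_compat; [exact: Hpos|lra]|lra].
(* N + 1 vectors in dimension N are dependent; since all have the same positive product with s, the
   coefficients sum to 0 and can be added to convex weights. *)
have [ga [[i0 Hi0] Hga]] := @linear_dependence N N.+1 (fun i => vsub (p i) x) (ltnSn N).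
have Sga : sumI ga = 0.
  have : sumI (fun i => ga i * dot s (vsub (p i) x)) = 0.
    have -> : sumI (fun i => ga i * dot s (vsub (p i) x)) = sumI (fun l => s l * lincomb (fun i => vsub (p i) x) ga l).
      rewrite (sumI_ext (g := fun i => sumI (fun l => s l * (ga i * vsub (p i) x l)))).
        by rewrite sumI_exch; apply: sumI_ext => l; rewrite sumI_scal.
      by move=> i; rewrite -sumI_scal; apply: sumI_ext => l; ring.
    by apply: sumI_0 => l; rewrite Hga; ring.
  rewrite (sumI_ext (g := fun i => dot s s * ga i)); last by move=> i; rewrite Heq; ring.
  by rewrite sumI_scal => /Rmult_integral []; lra.
have [i1 Hi1] : exists i, 0 < ga i.
  apply: NNPP => Hno; have Hle i : ga i <= 0 by apply: Rnot_lt_le => Hlt; apply: Hno; exists i.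
  have := @sumI_term _ (fun i => - ga i) i0; rewrite sumI_opp Sga => H.
  have : - ga i0 <= - 0 by apply: H => k; have := Hle k; lra.
  by have := Hle i0; lra.
(* Subtracting the least ratio times [ga] makes one weight vanish and keeps the others
   nonnegative. *)
have [i2 [Hi2 Hbest]] : exists i, 0 < ga i /\ forall k, 0 < ga k -> th i / ga i <= th k / ga k.
  have [i2 [_ [Hi2 Hb]]] : exists i, i \in i1 :: enum 'I_N.+1 /\ 0 < ga i /\ forall k, k \in i1 :: enum 'I_N.+1 -> 0 < ga k -> th i / ga i <= th k / ga k.
    elim: (enum _) => [|a l [i [Hi [Hgi Hb]]]].
      by exists i1; rewrite mem_seq1 eqxx; split => //; split => // k; rewrite mem_seq1 => /eqP ->; lra.
    case: (classic (0 < ga a /\ th a / ga a < th i / ga i)) => [[Ha Hlt]|Hno].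
      exists a; rewrite !in_cons eqxx orbT; split => //; split => // k.
      rewrite !in_cons => /or3P [/eqP E|/eqP ->|Hk] Hgk; [|lra|]; apply: Rlt_le; apply: Rlt_le_trans Hlt _; apply: Hb => //; by rewrite in_cons ?E ?eqxx ?Hk ?orbT.
    exists i; split; first by move: Hi; rewrite !in_cons => /orP [->//|->]; rewrite !orbT.
    split => // k; rewrite !in_cons => /or3P [/eqP E|/eqP E|Hk] Hgk.
    - by apply: Hb => //; rewrite E in_cons eqxx.
    - by rewrite E in Hgk *; apply: Rnot_lt_le => Hlt; apply: Hno.
    by apply: Hb => //; rewrite in_cons Hk orbT.
  by exists i2; split => // k; apply: Hb; rewrite in_cons mem_enum orbT.
pose t := th i2 / ga i2.
have Ht : 0 < t by apply: Rdiv_lt_0_compat.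
case: (zero (fun i => th i + - t * ga i) p i2) => //.
- move=> i; case: (Rlt_le_dec 0 (ga i)) => Hg.
    have := Hbest i Hg; rewrite -/t => Hb.
    have : t * ga i <= th i / ga i * ga i by apply: Rmult_le_compat_r; lra.
    have -> : th i / ga i * ga i = th i by field; lra.
    lra.
  by have := H1 i; nra.
- by rewrite sumI_add sumI_scal Sga H2; ring.
- apply: functional_extensionality => l; rewrite {1}H4 /lincomb.
  have -> : sumI (fun k => (th k + - t * ga k) * p k l) = sumI (fun k => th k * p k l) + - t * sumI (fun k => ga k * p k l).
    by rewrite -sumI_scal -sumI_add; apply: sumI_ext => k; ring.
  have -> : sumI (fun k => ga k * p k l) = lincomb (fun i => vsub (p i) x) ga l + x l * sumI ga.
    by rewrite -sumI_scal /lincomb -sumI_add; apply: sumI_ext => k; rewrite /vsub; ring.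
  by rewrite Hga Sga; ring.
by rewrite /t; field; lra.
Qed.
End ConvexHull.

(** * A touching ball adapted to the given point *)

Section TouchingBall.
Context (N : nat) (HN : (1 <= N)%nat) (O : vec N -> Prop) (HO : is_open O) (bO : bounded_set O).
Context (x0 : vec N) (Ox0 : O x0).

Definition contact (c : vec N) rho p : Prop := ~ O p /\ vdist p c = rho.

Lemma dot_quad (a b : vec N) t : dot (vadd a (vscale t b)) (vadd a (vscale t b)) =
  dot a a + 2 * t * dot a b + t * t * dot b b.
Proof. by rewrite dot_addl !dot_addr !dot_scall !dot_scalr (dotC b a); ring. Qed.

Lemma compl_closed p : (forall e, 0 < e -> exists y, ~ O y /\ vdist y p < e) -> ~ O p.
Proof. by move=> H Op; have [r [Hr K]] := HO Op; have [y [Oy Hy]] := H r Hr; apply: Oy; exact: K. Qed.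

(* Maximises [dist(c, complement)^2 - |x0 - c|^2] over [c]: the first order
   condition puts [x0] in the convex hull of the contact points. *)
Lemma touching_ball : exists c rho, vdist x0 c < rho /\ (forall y, vdist y c < rho -> O y) /\
  forall e, exists p, contact c rho p /\ 0 <= dot e (vsub p x0).
Proof.
have Lz : lip 0 (fun _ : vec N => 0) by move=> x y; lra.
(* For the zero function and K = 0 the McShane extension is the distance to the complement, with a
   nearest point attached to each x. *)
have [m [Lm [Em [m0 Hm]]]] := mcshane HO (bounded_complement HN bO) Lz (Rle_refl 0).
have mle x p : ~ O p -> m x <= vdist x p by move=> Op; have := Lm x p; rewrite (Em p Op); lra.
have matt x : exists p, ~ O p /\ m x = vdist x p.
  by have [p [Op [E _]]] := Hm x; exists p; split => //; lra.
pose F c := m c * m c - vdist x0 c * vdist x0 c.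
have Fx0 : 0 < F x0.
  have [p [Op E]] := matt x0; rewrite /F vdist_self E.
  have : 0 < vdist x0 p; last by nra.
  case: (vdist_ge0 x0 p) => // E0; case: Op.
  by rewrite -(vdist_eq0 (esym E0)).
have [D [HD HDx]] := bounded_dist x0 bO.
have [||||c [t [[Hc _] Hmax]]] := @EVT_max N (fun c t => vdist c x0 <= D /\ t = 0) (fun c _ => F c) (vnorm x0 + D).
- by exists x0, 0; rewrite vdist_self; split; [lra|].
- move=> x s [Hx ->]; rewrite Rabs_R0; have := vnorm_ge0 x0 => ?; split; last lra.
  have -> : x = vadd x0 (vsub x x0) by vec_ring.
  by apply: Rle_trans (vnorm_triang _ _) _; rewrite -/(vdist x x0); lra.
- move=> x s H; split.
    apply: Rnot_lt_le => Hlt; have [y [q [[Hy _] [Hyx _]]]] := H (vdist x x0 - D) ltac:(lra).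
    by have := vdist_triang x y x0; rewrite (vdist_sym x y); lra.
  apply: NNPP => Ht; have [y [q [[_ ->] [_]]]] := H (Rabs s) (Rabs_pos_lt _ Ht).
  by rewrite Rminus_0_l Rabs_Ropp; lra.
- have cm : cont_on2 (fun (c : vec N) t => vdist c x0 <= D /\ t = 0) (fun c _ => m c).
    by apply: (@lipschitz_cont N _ (0 + 1) 0) => x y s q; have := Lm x y; lra.
  have cd : cont_on2 (fun (c : vec N) t => vdist c x0 <= D /\ t = 0) (fun c _ => vdist x0 c).
    by apply: (@lipschitz_cont N _ 1 0) => x y s q; have := vdist_triang x0 y x; rewrite (vdist_sym y x); lra.
  by apply: cont_on2_minus; apply: cont_on2_mult.
have Fmax c' : F c' <= F c.
  case: (Rle_lt_dec (vdist c' x0) D) => Hd; first exact: (Hmax c' 0).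
  have H1 : F x0 <= F c by apply: (Hmax x0 0); rewrite vdist_self; split; [lra|].
  have Oc : ~ O c' by move=> /HDx; lra.
  rewrite {1}/F (Em _ Oc); have := Rle_0_sqr (vdist x0 c'); rewrite /Rsqr; lra.
pose rho := m c.
have Hrho : 0 <= rho by exact: m0.
have Hxc : vdist x0 c < rho.
  have H1 := Fmax x0; have := vdist_ge0 x0 c => H2.
  by apply: Rnot_le_lt => H3; have : rho * rho <= vdist x0 c * vdist x0 c; [apply: Rmult_le_compat|rewrite /F -/rho in H1 Fx0; lra].
exists c, rho; split => //; split.
  move=> y Hy; apply: NNPP => Oy; have := mle c y Oy; rewrite vdist_sym -/rho; lra.
move=> e; pose eta n := / (INR n + 1).
have Heta n : 0 < eta n by apply: Rinv_0_lt_compat; have := pos_INR n; lra.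
(* Move the centre by eta e and take a nearest point p of the complement. In the maximality
   inequality the eta^2 terms of the two squared distances cancel, which leaves dot e (p - x0) >= 0
   exactly; a cluster point of these p is a contact point. *)
have ex n : exists p, ~ O p /\ rho <= vdist c p <= rho + 2 * eta n * vnorm e /\ 0 <= dot e (vsub p x0).
  pose c' := vadd c (vscale (eta n) e); have [p [Op E]] := matt c'.
  exists p; split => //; have Hp := mle c p Op; rewrite -/rho in Hp.
  have Hn := Heta n; have He := vnorm_ge0 e.
  have Ecc : vdist c' c = eta n * vnorm e by rewrite vdist_addr vnorm_scale Rabs_pos_eq; lra.
  split.
    split => //; have := Lm c' c; rewrite -/rho Ecc E.
    by have := vdist_triang c c' p; rewrite (vdist_sym c c') Ecc; lra.
  have := Fmax c'; rewrite /F -/rho E !vnorm_sq.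
  have -> : vsub c' p = vadd (vsub c p) (vscale (eta n) e).
    by apply: functional_extensionality => i; rewrite /c' /vsub /vadd; ring.
  have -> : vsub x0 c' = vadd (vsub x0 c) (vscale (- eta n) e).
    by apply: functional_extensionality => i; rewrite /c' /vsub /vadd /vscale; ring.
  rewrite !dot_quad -(vnorm_sq (vsub c p)) -/(vdist c p).
  have : rho * rho <= vdist c p * vdist c p by apply: Rmult_le_compat.
  have -> : dot e (vsub p x0) = - dot (vsub c p) e - dot (vsub x0 c) e.
    by rewrite (dotC e) !dot_subl; ring.
  move=> H1 H2; have : 0 <= 2 * eta n * (- dot (vsub c p) e - dot (vsub x0 c) e) by lra.
  by move=> H3; apply: (Rmult_le_reg_l (2 * eta n)); lra.
have [q Hq] := choice _ ex.
have He := vnorm_ge0 e.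
have eta1 n : eta n <= 1.
  rewrite /eta -Rinv_1; apply: Rinv_le_contravar; first lra.
  by have := pos_INR n; lra.
have [||p [s Hp]] := @BW_vec N q (fun=> 0) (vnorm c + rho + 2 * vnorm e).
- move=> n; have [_ [[_ H1] _]] := Hq n.
  have -> : q n = vadd c (vsub (q n) c) by vec_ring.
  apply: Rle_trans (vnorm_triang _ _) _; rewrite -/(vdist (q n) c) vdist_sym.
  have := eta1 n; nra.
- by move=> n; rewrite Rabs_R0; have := vnorm_ge0 c; lra.
exists p; split; last first.
  apply: Rnot_lt_le => Hlt; pose d := - dot e (vsub p x0) / (vnorm e + 1).
  have Hd : 0 < d by apply: Rdiv_lt_0_compat; lra.
  have [n [_ [Hn _]]] := Hp d Hd 0%nat; have [_ [_ H]] := Hq n.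
  have : dot e (vsub (q n) p) <= vnorm e * d.
    by apply: Rle_trans (cauchy_schwarz _ _) _; apply: Rmult_le_compat_l => //; rewrite -/(vdist (q n) p); lra.
  have -> : dot e (vsub (q n) p) = dot e (vsub (q n) x0) - dot e (vsub p x0) by rewrite !dot_subr; ring.
  have : (vnorm e + 1) * d = - dot e (vsub p x0) by rewrite /d; field; lra.
  lra.
have Op : ~ O p.
  apply: compl_closed => d Hd; have [n [_ [Hn _]]] := Hp d Hd 0%nat.
  by exists (q n); split => //; have [] := Hq n.
split => //; apply: Rle_antisym; last by rewrite vdist_sym; exact: mle.
apply: Rnot_lt_le => Hlt; pose r := (vdist p c - rho) / 2.
have Hr : 0 < r by rewrite /r; lra.
have Hr' : 0 < r / (2 * vnorm e + 1) by apply: Rdiv_lt_0_compat; lra.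
have [n0 [Hn0 Hn0']] := archimed_cor1 _ Hr'.
have [n [Hn [Hn1 _]]] := Hp r Hr n0.
have [_ [[_ H1] _]] := Hq n.
have : eta n <= r / (2 * vnorm e + 1).
  left; apply: Rle_lt_trans Hn0; apply: Rinv_le_contravar; first exact: lt_0_INR.
  by have := le_INR _ _ Hn; lra.
move=> H2; have : (2 * vnorm e + 1) * eta n <= r.
  have -> : r = (2 * vnorm e + 1) * (r / (2 * vnorm e + 1)) by field; lra.
  by apply: Rmult_le_compat_l; lra.
have := vdist_triang p (q n) c; rewrite (vdist_sym p (q n)) (vdist_sym (q n) c).
have := Heta n; rewrite /r in Hn1 *; lra.
Qed.
End TouchingBall.

(** * Lower bounds along chords for the last eigenvalue *)

(** On the compact set where f <= 0 the penalty tau has a positive minimum, so a large multiple of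
    it compensates the minimum of f. *)
Lemma penalize N (C : vec N -> R -> Prop) (f tau : vec N -> R -> R) M :
  (forall x t, C x t -> vnorm x <= M /\ Rabs t <= M) ->
  (forall x t, (forall e, 0 < e -> exists y s, C y s /\ vdist y x < e /\ Rabs (s - t) < e) -> C x t) ->
  cont_on2 C f -> cont_on2 C tau -> (forall x t, C x t -> 0 <= tau x t) ->
  (forall x t, C x t -> tau x t = 0 -> 0 < f x t) ->
  exists K, 0 <= K /\ forall x t, C x t -> 0 <= f x t + K * tau x t.
Proof.
move=> HM Hcl cf ct Ht0 Hf.
pose C' x t := C x t /\ f x t <= 0.
case: (classic (exists x t, C' x t)) => [Hne|Hno]; last first.
  exists 0; split; first lra.
  move=> x t Cxt; rewrite Rmult_0_l Rplus_0_r; apply: Rnot_lt_le => Hlt.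
  by apply: Hno; exists x, t; split => //; lra.
have HM' x t : C' x t -> vnorm x <= M /\ Rabs t <= M by move=> [/HM].
have Hcl' x t : (forall e, 0 < e -> exists y s, C' y s /\ vdist y x < e /\ Rabs (s - t) < e) -> C' x t.
  move=> H; have Cxt : C x t by apply: Hcl => e /H [y [s [[Cy _] K]]]; exists y, s.
  split => //; apply: Rnot_lt_le => Hlt; have [d [Hd K]] := cf x t Cxt (f x t) Hlt.
  have [y [s [[Cy Hy] [H1 H2]]]] := H d Hd.
  by have /Rabs_def2 := K y s Cy H1 H2; lra.
have C'C x t : C' x t -> C x t by case.
have [x1 [t1 [[C1 F1] Hmin1]]] := EVT_min Hne HM' Hcl' (cont_on2_sub C'C ct).
have [x2 [t2 [_ Hmin2]]] := EVT_min Hne HM' Hcl' (cont_on2_sub C'C cf).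
have Htau : 0 < tau x1 t1.
  by case: (Ht0 _ _ C1) => // E; have := Hf _ _ C1 (esym E); lra.
exists (Rabs (f x2 t2) / tau x1 t1); split.
  by apply: Rle_mult_inv_pos => //; exact: Rabs_pos.
have HK0 : 0 <= Rabs (f x2 t2) / tau x1 t1 by apply: Rle_mult_inv_pos => //; exact: Rabs_pos.
move=> x t Cxt; case: (Rlt_le_dec 0 (f x t)) => Hfx.
  by have := Rmult_le_pos _ _ HK0 (Ht0 _ _ Cxt); lra.
have := Hmin1 x t (conj Cxt Hfx); have := Hmin2 x t (conj Cxt Hfx) => H2 H1.
have := Rmult_le_compat_l _ _ _ HK0 H1.
have -> : Rabs (f x2 t2) / tau x1 t1 * tau x1 t1 = Rabs (f x2 t2) by field; lra.
by have := Rle_abs (- f x2 t2); rewrite Rabs_Ropp; lra.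
Qed.

Section LastEigenvalue.
Context (N : nat) (HN : (1 <= N)%nat) (Lam : mat N -> R) (HL : elliptic N Lam).
Context (O : vec N -> Prop) (HO : is_open O) (bO : bounded_set O).
Context (c : vec N) (rho : R) (Hrho : 0 < rho) (ball : forall y, vdist y c < rho -> O y).
Context (U : vec N -> R) (HU : forall x, clos O x -> U x = rho * rho - vdist x c * vdist x c).

Definition stays_nonneg y : Prop :=
  forall u, sol_par Lam O U U u -> forall t, 0 <= t -> 0 <= u y t.
Definition stays_pos y : Prop := exists mu k, 0 < mu /\ 0 < k /\
  forall u, sol_par Lam O U U u -> forall t, 0 <= t -> k * exp (- mu * t) <= u y t.

Lemma stays_pos_nonneg y : stays_pos y -> stays_nonneg y.
Proof.
move=> [mu [k [_ [Hk H]]]] u Su t Ht; apply: Rle_trans (H u Su t Ht).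
by left; apply: Rmult_lt_0_compat => //; exact: exp_pos.
Qed.

Lemma ball_clos y : vdist y c <= rho -> clos O y.
Proof.
move=> Hy r Hr; have Hd := vdist_ge0 y c.
case: (Rlt_le_dec (vdist y c) rho) => H; first by exists y; split; [exact: ball|rewrite vdist_self].
have E : vdist y c = rho by lra.
pose t := Rmin 1 (r / (2 * rho)).
have Hq : 0 < r / (2 * rho) by apply: Rdiv_lt_0_compat; lra.
have Ht : 0 < t by apply: Rmin_pos; lra.
have T1 := Rmin_l 1 (r / (2 * rho)); have T2 := Rmin_r 1 (r / (2 * rho)); rewrite -/t in T1 T2.
exists (vadd y (vscale (- t) (vsub y c))); split.
  apply: ball; have -> : vdist (vadd y (vscale (- t) (vsub y c))) c = (1 - t) * vdist y c.
    rewrite -(Rabs_pos_eq (1 - t)) -?vnorm_scale; last lra.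
    by rewrite /vdist; congr vnorm; vec_ring.
  rewrite E; nra.
rewrite vdist_addr vnorm_scale Rabs_Ropp Rabs_pos_eq; last lra.
rewrite -/(vdist y c) E.
have : t * rho <= r / (2 * rho) * rho by apply: Rmult_le_compat_r; lra.
have -> : r / (2 * rho) * rho = r / 2 by field; lra.
lra.
Qed.

Lemma init_U u x : sol_par Lam O U U u -> clos O x -> u x 0 = U x.
Proof.
move=> Su Cx; case: (clos_cases Cx) => [Ox|Bx]; last exact: sol_par_init Su Bx.
by have [_ [_ [H _]]] := Su; exact: H.
Qed.

Lemma contact_nonneg p : contact O c rho p -> stays_nonneg p.
Proof.
move=> [Op Ep] u Su t Ht; have Cp : clos O p by apply: ball_clos; lra.
have U0 : U p = 0 by rewrite HU // Ep; ring.
case: Ht => [Ht|<-]; last by rewrite (init_U Su Cp) U0; lra.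
by have [_ [H _]] := Su; rewrite H //; lra.
Qed.

(** Stewart's identity; the last term measures how far a chord point lies inside the ball. *)
Lemma segment_dist (A B : vec N) s :
  let y := vadd A (vscale s (vsub B A)) in
  vdist y c * vdist y c = (1 - s) * (vdist A c * vdist A c) + s * (vdist B c * vdist B c)
    - s * (1 - s) * dot (vsub B A) (vsub B A).
Proof.
rewrite /= !vnorm_sq.
have -> : vsub (vadd A (vscale s (vsub B A))) c = vadd (vscale (1 - s) (vsub A c)) (vscale s (vsub B c)).
  by vec_ring.
have -> : vsub B A = vadd (vsub B c) (vscale (-1) (vsub A c)).
  by vec_ring.
move: (vsub A c) (vsub B c) => a b; rewrite dot_affine dot_quad (dotC b a); ring.
Qed.

(* On a chord of the ball the function [s (1 - s)] squared decays under the one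
   dimensional heat flow at a rate fixed by the length of the chord; transversal
   deviations are penalised, which is free because only the direction of the
   chord is used as a test direction. *)
Lemma segment_pos A B th : A <> B -> vdist A c <= rho -> vdist B c <= rho ->
  stays_nonneg A -> stays_nonneg B -> 0 < th < 1 -> stays_pos (vadd A (vscale th (vsub B A))).
Proof.
move=> HAB HA HB NA NB Hth.
pose d := vsub B A; pose L := dot d d.
have HL2 : 0 < L.
  case: (dot_ge0 d) => // E; case: HAB; apply: vdist_eq0; rewrite vdist_sym /vdist /vnorm -/d -E; exact: sqrt_0.
(* With p = s (1 - s), the second difference of p^2 is b^2 (2 - 12 p) + 2 b^4, and 2 - 12 p + 18 p^2
   = 2 (3 p - 1)^2. *)
pose mu := 18 / L; have Hmu : 0 < mu by apply: Rdiv_lt_0_compat; lra.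
have EmuL : mu * L = 18 by rewrite /mu; field; lra.
exists mu, (L * (th * (1 - th) * (th * (1 - th)))); split => //; split.
  by apply: Rmult_lt_0_compat => //; apply: Rmult_lt_0_compat; apply: Rmult_lt_0_compat; lra.
move=> u Su t1 Ht1; apply: Rnot_lt_le => Hlt.
pose y0 := vadd A (vscale th d).
(* Half of the assumed violation: the tolerance gives strict positivity on the chord for [penalize]
   and still leaves a contradiction at y0. *)
pose e := (L * (th * (1 - th) * (th * (1 - th))) * exp (- mu * t1) - u y0 t1) / 2.
have He : 0 < e by rewrite /e /y0 /d; lra.
pose T := t1 + 1.
(* [s] is the position of the orthogonal projection on the line through A and B, and [tau] below the
   squared distance to that line, which is constant along [d]. *)
pose s x := dot (vsub x A) d / L.
pose E t := exp (- mu * t).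
pose tau x := dot (vsub x A) (vsub x A) - s x * s x * L.
pose p x := s x * (1 - s x).
have smA i : smooth (fun x (_ : R) => vsub x A i) by apply: smooth_minus; [exact: smooth_coord|exact: smooth_const].
have sms : smooth (fun x (_ : R) => s x).
  apply: smooth_mult; last exact: smooth_const.
  by apply: smooth_sum => i; apply: smooth_mult; [exact: smA|exact: smooth_const].
have smt : smooth (fun x (_ : R) => tau x).
  apply: smooth_minus; first by apply: smooth_sum => i; apply: smooth_mult; exact: smA.
  by apply: smooth_mult; [exact: smooth_mult|exact: smooth_const].
have smp : smooth (fun x (_ : R) => p x).
  by apply: smooth_mult => //; apply: smooth_minus => //; exact: smooth_const.
have DE r : derivable_pt_lim E r (- mu * E r).
  rewrite /E Rmult_comm; apply: (derivable_pt_lim_comp (fun s => - mu * s) exp).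
    rewrite -{2}(Rmult_1_r (- mu)); apply: derivable_pt_lim_scal; exact: derivable_pt_lim_id.
  exact: derivable_pt_lim_exp.
have Epos r : 0 < E r by exact: exp_pos.
have smE : smooth (fun (_ : vec N) t => E t).
  apply: (@smooth_time N E (fun r => - mu * E r)) => //.
  by apply: continuity_scal => r; apply: derivable_continuous_pt; exists (- mu * E r); exact: DE.
have E1 r : 0 <= r -> E r <= 1.
  move=> Hr; rewrite /E -exp_0; case: (Req_dec r 0) => [->|Hne]; first by rewrite Rmult_0_r; lra.
  by left; apply: exp_increasing; nra.
pose psi x t := E t * (L * (p x * p x)).
have smpsi : smooth psi.
  by apply: smooth_mult => //; apply: smooth_mult; [exact: smooth_const|exact: smooth_mult].
pose S x := vdist x c <= rho /\ 0 <= s x <= 1.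
have tauE x : tau x = dot (vsub x (vadd A (vscale (s x) d))) (vsub x (vadd A (vscale (s x) d))).
  have -> : vsub x (vadd A (vscale (s x) d)) = vadd (vsub x A) (vscale (- s x) d).
    by vec_ring.
  rewrite dot_quad -/L /tau; have -> : dot (vsub x A) d = s x * L by rewrite /s; field; lra.
  ring.
have tau0 x : 0 <= tau x by rewrite tauE; exact: dot_ge0.
have tauz x : tau x = 0 -> x = vadd A (vscale (s x) d).
  by rewrite tauE => Hz; apply: vdist_eq0; rewrite /vdist /vnorm Hz; exact: sqrt_0.
have onseg r : s (vadd A (vscale r d)) = r.
  rewrite /s; have -> : vsub (vadd A (vscale r d)) A = vscale r d.
    by vec_ring.
  by rewrite dot_scall -/L; field; lra.
(* Hence U >= L p >= L p^2 on the chord, which is the comparison at time 0. *)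
have segU x : S x -> tau x = 0 -> vdist x c * vdist x c <= rho * rho - p x * L.
  move=> [_ Hs] /tauz Ex; have := segment_dist A B (s x); rewrite /= -/d -Ex -/L -/(p x) => ->.
  have QA : vdist A c * vdist A c <= rho * rho by have := vdist_ge0 A c; nra.
  have QB : vdist B c * vdist B c <= rho * rho by have := vdist_ge0 B c; nra.
  have : (1 - s x) * (vdist A c * vdist A c) <= (1 - s x) * (rho * rho) by apply: Rmult_le_compat_l; lra.
  have : s x * (vdist B c * vdist B c) <= s x * (rho * rho) by apply: Rmult_le_compat_l; lra.
  rewrite /p; lra.
have p01 x : S x -> 0 <= p x <= 1 by move=> [_ Hs]; rewrite /p; nra.
have SO x : S x -> clos O x by move=> [H _]; exact: ball_clos.
have cs : cont_on (fun _ => True) s.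
  by apply: (@cont_on_slice N _ (fun _ _ => True) (fun x _ => s x) 0) => //; exact: smooth_cont.
have clS : closed_set_v S.
  move=> x H; split; last split; apply: Rnot_lt_le => Hl.
  - have [y [[Hy _] Hyx]] := H (vdist x c - rho) ltac:(lra).
    by have := vdist_triang x y c; rewrite (vdist_sym x y); lra.
  - have [r [Hr K]] := cs x I (- s x) ltac:(lra); have [y [[_ Hy] Hyx]] := H r Hr.
    by have /Rabs_def2 := K y I Hyx; lra.
  have [r [Hr K]] := cs x I (s x - 1) ltac:(lra); have [y [[_ Hy] Hyx]] := H r Hr.
  by have /Rabs_def2 := K y I Hyx; lra.
have bS : bounded_set S by have [M HM] := clos_bounded bO; exists M => x /SO; exact: HM.
(* Parabolic boundary of the region. On the chord it consists of time 0 and the ends A and B, since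
   p = 0 where the chord meets the sphere; there u exceeds psi - e strictly. *)
pose C x t := S x /\ 0 <= t <= T /\ (t = 0 \/ s x = 0 \/ s x = 1 \/ vdist x c = rho).
have [K [HK0 HK]] : exists K, 0 <= K /\ forall x t, C x t -> 0 <= (u x t - (psi x t - e)) + K * tau x.
  have [M HM] := bS.
  apply: (@penalize N C (fun x t => u x t - (psi x t - e)) (fun x _ => tau x) (Rabs M + T)).
  - move=> x t [/HM Hx [Ht _]]; have := Rle_abs M; have := Rabs_pos M; rewrite (Rabs_pos_eq t); last lra.
    by rewrite /T in Ht *; split; lra.
  - move=> x t H.
    have Sx : S x by apply: clS => r /H [y [q [[Sy _] [Hy _]]]]; exists y.
    have Ht : 0 <= t <= T.
      split; apply: Rnot_lt_le => Hl.
        by have [y [q [[_ [Hq _]] [_ /Rabs_def2 ?]]]] := H (- t) ltac:(lra); lra.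
      by have [y [q [[_ [Hq _]] [_ /Rabs_def2 ?]]]] := H (t - T) ltac:(lra); lra.
    split => //; split => //; apply: NNPP => Hno.
    have [N1 [N2 [N3 N4]]] : t <> 0 /\ s x <> 0 /\ s x <> 1 /\ vdist x c <> rho by tauto.
    have [r [Hr Kr]] := cs x I (Rmin (s x) (1 - s x)) ltac:(apply: Rmin_pos; have := proj2 Sx; lra).
    have M1 := Rmin_l (s x) (1 - s x); have M2 := Rmin_r (s x) (1 - s x).
    have Hrho' : 0 < rho - vdist x c by have := proj1 Sx; lra.
    pose r' := Rmin (Rmin r t) (rho - vdist x c).
    have Hr' : 0 < r' by do !apply: Rmin_pos => //; lra.
    have R1 := Rmin_l (Rmin r t) (rho - vdist x c); have R2 := Rmin_r (Rmin r t) (rho - vdist x c).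
    have R3 := Rmin_l r t; have R4 := Rmin_r r t.
    have [y [q [[Sy [Hq Hor]] [Hy /Rabs_def2 Hqt]]]] := H r' Hr'; rewrite /r' in Hy Hqt.
    have /Rabs_def2 Hsy := Kr y I ltac:(lra).
    by have := vdist_triang y x c; case: Hor => [|[|[|]]]; lra.
  - have [cu _] := Su; apply: cont_on2_minus.
      by apply: cont_on2_sub cu => x t [Sx [Ht _]]; split; [exact: SO|lra].
    by apply: cont_on2_minus; [exact: smooth_cont|exact: cont_on2_const].
  - exact: smooth_cont.
  - by move=> x t _.
  move=> x t [Sx [Ht Hor]] Htau.
  have Hseg := segU x Sx Htau; have [P0 P1] := p01 x Sx.
  have Hz : s x = 0 \/ s x = 1 -> 0 < u x t - (psi x t - e).
    have Ex := tauz x Htau.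
    move=> [] Es; have -> : psi x t = 0 by [rewrite /psi /p Es; ring].
      have -> : x = A by rewrite Ex Es; vec_ring.
      by have := NA u Su t (proj1 Ht); lra.
    have -> : x = B by rewrite Ex Es; apply: functional_extensionality => i; rewrite /d /vadd /vscale /vsub; ring.
    by have := NB u Su t (proj1 Ht); lra.
  case: Hor => [Et|[Es|[Es|Er]]]; try by apply: Hz; tauto.
    rewrite Et (init_U Su (SO x Sx)) (HU (SO x Sx)).
    have -> : psi x 0 = L * (p x * p x) by rewrite /psi /E Rmult_0_r exp_0; ring.
    have : L * (p x * p x) <= L * p x by apply: Rmult_le_compat_l; nra.
    lra.
  apply: Hz; have : p x * L <= 0 by rewrite Er in Hseg; lra.
  move=> Hp; have : p x = 0 by nra.
  by rewrite /p => /Rmult_integral []; lra.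
pose phi x t := psi x t - e - K * tau x.
have smphi : smooth phi.
  apply: smooth_minus; first by apply: smooth_minus => //; exact: smooth_const.
  by apply: smooth_mult => //; exact: smooth_const.
have HNS : (N <= N.+1)%nat by exact: leqnSn.
have main : phi y0 t1 <= u y0 t1.
  have Sy0 : S y0.
    split; last by rewrite onseg; lra.
    have := segment_dist A B th; rewrite /= -/d -/y0 -/L => Q.
    have QA : vdist A c * vdist A c <= rho * rho by have := vdist_ge0 A c; nra.
    have QB : vdist B c * vdist B c <= rho * rho by have := vdist_ge0 B c; nra.
    have Q1 : (1 - th) * (vdist A c * vdist A c) <= (1 - th) * (rho * rho) by apply: Rmult_le_compat_l; lra.
    have Q2 : th * (vdist B c * vdist B c) <= th * (rho * rho) by apply: Rmult_le_compat_l; lra.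
    have Q3 : 0 < th * (1 - th) * L by apply: Rmult_lt_0_compat => //; apply: Rmult_lt_0_compat; lra.
    by apply: Rnot_lt_le => Hgt; have : rho * rho < vdist y0 c * vdist y0 c; [apply: Rmult_le_0_lt_compat; lra|lra].
  apply: (compare_lower_horizon (T0 := T) HNS HL Su clS bS SO smphi) => //; last by rewrite /T; lra.
  - move=> x t Sx Ht.
    case: (classic (s x = 0 \/ s x = 1 \/ vdist x c = rho)) => [Hor|Hno].
      left; have := HK x t; rewrite /phi => H; suff: 0 <= u x t - (psi x t - e) + K * tau x by lra.
      by apply: H; split => //; split; [lra|tauto].
    right.
    have [N2 [N3 N4]] : s x <> 0 /\ s x <> 1 /\ vdist x c <> rho by tauto.
    have Hin : vdist x c < rho by have := proj1 Sx; lra.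
    split; first exact: ball.
    split.
      have [r [Hr Kr]] := cs x I (Rmin (s x) (1 - s x)) ltac:(apply: Rmin_pos; have := proj2 Sx; lra).
      have M1 := Rmin_l (s x) (1 - s x); have M2 := Rmin_r (s x) (1 - s x).
      exists (Rmin r (rho - vdist x c)); split; first by apply: Rmin_pos; lra.
      have R1 := Rmin_l r (rho - vdist x c); have R2 := Rmin_r r (rho - vdist x c).
      move=> y Hy; have /Rabs_def2 Hsy := Kr y I ltac:(lra).
      by have := vdist_triang y x c; split; lra.
    exists (- mu * psi x t), (- mu * psi x t); split; last split; last lra.
      have := derivable_pt_lim_minus _ _ _ _ _ (derivable_pt_lim_scal E (L * (p x * p x)) t _ (DE t))
        (derivable_pt_lim_const (e + K * tau x) t).
      have -> : L * (p x * p x) * (- mu * E t) - 0 = - mu * psi x t by rewrite /psi; ring.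
      congr derivable_pt_lim; apply: functional_extensionality => r.
      by rewrite /phi /psi /minus_fct /mult_real_fct /fct_cte; ring.
    have [i Hi] : exists i, d i <> 0.
      apply: NNPP => Hz; have : L = 0; last lra.
      by apply: sumI_0 => i; have -> : d i = 0; [apply: NNPP => Hne; apply: Hz; exists i|ring].
    have -> : (N.+1 - N = 1)%nat by rewrite subSnn.
    exists (fun v => exists b, v = vscale b d); split; first exact: dim_line Hi.
    exists 1; split; first lra.
    move=> v [b ->] _.
    have sE r : s (vadd x (vscale r d)) = s x + r.
      rewrite /s; have -> : vsub (vadd x (vscale r d)) A = vadd (vsub x A) (vscale r d).
        by vec_ring.
      by rewrite dot_addl dot_scall -/L; field; lra.
    have tE r : tau (vadd x (vscale r d)) = tau x.
      rewrite !tauE sE; congr dot; vec_ring.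
    have vE : vsub x (vscale b d) = vadd x (vscale (- b) d).
      by vec_ring.
    rewrite /sd vE /phi !tE /psi /p !sE dot_scale2 -/L.
    set q := s x.
    have -> : - mu * (E t * (L * (q * (1 - q) * (q * (1 - q))))) * (b * b * L) =
       E t * L * (- (mu * L) * (q * (1 - q) * (q * (1 - q))) * (b * b)) by ring.
    have -> : E t * (L * ((q + b) * (1 - (q + b)) * ((q + b) * (1 - (q + b))))) - e - K * tau x +
       (E t * (L * ((q + - b) * (1 - (q + - b)) * ((q + - b) * (1 - (q + - b))))) - e - K * tau x) -
       2 * (E t * (L * (q * (1 - q) * (q * (1 - q)))) - e - K * tau x) =
       E t * L * ((b * b) * (2 - 12 * (q * (1 - q))) + 2 * (b * b * (b * b))) by ring.
    apply: Rmult_le_compat_l; first by have := Rmult_lt_0_compat _ _ (Epos t) HL2; lra.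
    rewrite EmuL.
    have B0 : 0 <= b * b by exact: Rle_0_sqr.
    have B1 : 0 <= b * b * (b * b) by exact: Rmult_le_pos.
    have := Rmult_le_pos _ _ B0 (Rle_0_sqr (3 * (q * (1 - q)) - 1)); rewrite /Rsqr; lra.
  move=> x Sx; have := HK x 0; rewrite /phi => H; suff: 0 <= u x 0 - (psi x 0 - e) + K * tau x by lra.
  by apply: H; split => //; split; [rewrite /T; lra|left].
have : phi y0 t1 = L * (th * (1 - th) * (th * (1 - th))) * exp (- mu * t1) - e.
  rewrite /phi /psi /p onseg.
  have -> : tau y0 = 0.
    rewrite tauE onseg; apply: sumI_0 => i; rewrite /y0 /vsub; ring.
  by rewrite /E; ring.
rewrite /e in main *; rewrite -/y0 in Hlt; lra.
Qed.

(** Induction on the number of points: a combination lies on the segment from one contact point to a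
    combination of the others. Both ends stay nonnegative, and [segment_pos] makes everything
    strictly between them positive. *)
Lemma hull_pos n : forall th (p : 'I_n -> vec N), (forall i, 0 <= th i) -> sumI th = 1 ->
  (forall i, contact O c rho (p i)) ->
  vdist (lincomb p th) c <= rho /\ (contact O c rho (lincomb p th) \/ stays_pos (lincomb p th)).
Proof.
elim: n => [|n IH] th p H0 H1 Hp.
  by rewrite /sumI enum_ord0 /= in H1; lra.
have E1 := sumI_recl th; rewrite H1 in E1.
set r := sumI _ in E1.
have Hr : 0 <= r by apply: sumI_ge0.
have El i : lincomb p th i = th ord0 * p ord0 i + sumI (fun k => th (lift ord0 k) * p (lift ord0 k) i).
  by rewrite /lincomb sumI_recl.
have Hpc : vdist (p ord0) c <= rho by have [_ ->] := Hp ord0; lra.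
case: (Req_dec r 0) => Er.
  have -> : lincomb p th = p ord0.
    apply: functional_extensionality => i; rewrite El (sumI_0 (f := fun k => _ * _)).
      by rewrite (_ : th ord0 = 1); [ring|lra].
    move=> k; have := @sumI_term _ (fun k => th (lift ord0 k)) k; rewrite -/r Er => H.
    by have -> : th (lift ord0 k) = 0; [apply: Rle_antisym => //; apply: H => l|ring].
  by split => //; left.
have Hrp : 0 < r by lra.
pose y := lincomb (fun k => p (lift ord0 k)) (fun k => / r * th (lift ord0 k)).
have [|||Hy Hcy] := IH (fun k => / r * th (lift ord0 k)) (fun k => p (lift ord0 k)).
- by move=> i; apply: Rmult_le_pos => //; left; exact: Rinv_0_lt_compat.
- by rewrite sumI_scal -/r Rinv_l.
- by move=> i; exact: Hp.
rewrite -/y in Hy Hcy.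
have -> : lincomb p th = vadd (p ord0) (vscale r (vsub y (p ord0))).
  apply: functional_extensionality => i; rewrite El /vadd /vscale /vsub.
  have -> : r * (y i - p ord0 i) = r * y i - r * p ord0 i by ring.
  have -> : r * y i = sumI (fun k => th (lift ord0 k) * p (lift ord0 k) i).
    by rewrite /y /lincomb -sumI_scal; apply: sumI_ext => k; field.
  by rewrite (_ : th ord0 = 1 - r); [ring|lra].
have Hr1 : r <= 1 by have := H0 ord0; lra.
have Hball : vdist (vadd (p ord0) (vscale r (vsub y (p ord0)))) c <= rho.
  have := segment_dist (p ord0) y r => /= Q.
  have QA : vdist (p ord0) c * vdist (p ord0) c <= rho * rho by have := vdist_ge0 (p ord0) c; nra.
  have QB : vdist y c * vdist y c <= rho * rho by have := vdist_ge0 y c; nra.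
  have Q1 : (1 - r) * (vdist (p ord0) c * vdist (p ord0) c) <= (1 - r) * (rho * rho) by apply: Rmult_le_compat_l; lra.
  have Q2 : r * (vdist y c * vdist y c) <= r * (rho * rho) by apply: Rmult_le_compat_l; lra.
  have Q3 : 0 <= r * (1 - r) * dot (vsub y (p ord0)) (vsub y (p ord0)).
    by apply: Rmult_le_pos; [apply: Rmult_le_pos; lra|exact: dot_ge0].
  apply: Rnot_lt_le => Hgt.
  have := Rmult_le_0_lt_compat _ _ _ _ (Rlt_le _ _ Hrho) (Rlt_le _ _ Hrho) Hgt Hgt; lra.
split => //.
case: (classic (y = p ord0)) => [E|Hne].
  left; have -> : vadd (p ord0) (vscale r (vsub y (p ord0))) = p ord0; last exact: Hp.
  by rewrite E; vec_ring.
have NY : stays_nonneg y by case: Hcy => [/contact_nonneg|/stays_pos_nonneg].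
case: (Req_dec r 1) => Er1.
  have -> : vadd (p ord0) (vscale r (vsub y (p ord0))) = y; last exact: Hcy.
  by rewrite Er1; vec_ring.
right; apply: segment_pos => //; last lra.
- by move=> E; apply: Hne.
exact: contact_nonneg (Hp ord0).
Qed.
End LastEigenvalue.

(** The paraboloid itself is the initial datum and the upper barrier; the lower one is the reversed
    McShane extension, convex along one line, which is all that N + 1 - j = 1 asks. *)
Lemma last_eigenvalue_gap N (x0 : vec N) Lam O : (1 <= N)%nat -> elliptic N Lam ->
  is_open O -> bounded_set O -> O x0 -> exponential_gap Lam O x0.
Proof.
move=> HN HL HO bO Ox0.
have [c [rho [Hxc [ball Hcon]]]] := touching_ball HN HO bO Ox0.
have Hrho : 0 < rho by have := vdist_ge0 x0 c; lra.
have [D [HD HDx]] := bounded_dist c (clos_bounded bO).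
(* The truncation lies at least 1 beyond the closure of [O], so second differences with vnorm v < 1
   see the exact paraboloid, and M > rho keeps [U] nonpositive outside [O]. *)
pose M := D + rho + 1.
have HM : 0 < M by rewrite /M; lra.
have Hd x : 0 <= vdist x c by exact: vdist_ge0.
pose K := 2 * M * 1; have HK : 0 <= K by rewrite /K; lra.
pose cp := cap M (fun x => vdist x c).
have Lc : lip K cp := cap_lip HM Rle_0_1 Hd (lip_vdist c).
pose U x := cp x - (M * M - rho * rho).
have LU : lip K U by move=> x y; have := Lc x y; rewrite /U; lra.
have Uin x : vdist x c <= M -> U x = rho * rho - vdist x c * vdist x c.
  by move=> Hx; rewrite /U /cp; have [[_ ->]|[H _]] := @cap_cases N M (fun x => vdist x c) x HM (Hd x); lra.
have Uout x : ~ O x -> U x <= 0.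
  move=> Ox; have Hx : rho <= vdist x c by apply: Rnot_lt_le => /ball.
  have [[_ E]|[_ E]] := @cap_cases N M (fun x => vdist x c) x HM (Hd x); rewrite /U /cp E.
    by have : rho * rho <= vdist x c * vdist x c; [apply: Rmult_le_compat; lra|lra].
  by have : rho * rho <= M * M; [apply: Rmult_le_compat; rewrite /M; lra|lra].
have HU x : clos O x -> U x = rho * rho - vdist x c * vdist x c.
  by move=> /HDx Hx; apply: Uin; rewrite /M; lra.
have sdU x v : O x -> vnorm v < 1 -> sd U x v = - 2 * dot v v.
  move=> Ox Hv; have := HDx x (clos_sub Ox) => Hx.
  have T1 := vdist_triang (vadd x v) x c; have T2 := vdist_triang (vsub x v) x c.
  rewrite vdist_addr in T1; rewrite vdist_subr in T2.
  rewrite /sd !Uin; try by rewrite /M; lra.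
  rewrite !vnorm_sq.
  have -> : vsub (vadd x v) c = vadd (vsub x c) (vscale 1 v).
    by vec_ring.
  have -> : vsub (vsub x v) c = vadd (vsub x c) (vscale (-1) v).
    by vec_ring.
  by rewrite !dot_quad; ring.
have Lneg : lip K (fun x => - U x).
  by move=> x y; have := LU y x; rewrite (vdist_sym y x); lra.
have [m [Lm [Em [Um Hm]]]] := mcshane HO (bounded_complement HN bO) Lneg HK.
have [mu [k [Hmu [Hk Hpos]]]] : stays_pos Lam O U x0.
  have clC : closed_set_v (contact O c rho).
    move=> p H; split.
      by apply: (compl_closed HO) => e /H [y [[Oy _] Hy]]; exists y.
    apply: Rle_antisym; apply: Rnot_lt_le => Hl.
      have [y [[_ Ey] Hy]] := H (vdist p c - rho) ltac:(lra).
      by have := vdist_triang p y c; rewrite (vdist_sym p y); lra.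
    have [y [[_ Ey] Hy]] := H (rho - vdist p c) ltac:(lra).
    by have := vdist_triang y p c; lra.
  have bC : bounded_set (contact O c rho).
    exists (vnorm c + rho) => p [_ Ep].
    have -> : p = vadd c (vsub p c) by vec_ring.
    by apply: Rle_trans (vnorm_triang _ _) _; rewrite -/(vdist p c) Ep; lra.
  have neC : exists p, contact O c rho p by have [p [Cp _]] := Hcon x0; exists p.
  have [th [p [H0 [H1 [Hp Ex]]]]] : hull (contact O c rho) N.+1 x0 by exact: mem_hull.
  (* The point [x0] cannot itself be a contact point, since it lies in [O]. *)
  by have [_] := hull_pos HL bO Hrho ball HU H0 H1 Hp; rewrite -Ex => -[[]|].
apply: (@exponential_gap_intro N N Lam O x0 (K + 1) (fun x => - m x) U U 2 mu k) => //.
- by move=> x y; have := Lm y x; rewrite (vdist_sym y x); lra.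
- by apply: lip_weaken LU; lra.
- by apply: lip_weaken LU; lra.
- by move=> x; have := Um x; lra.
- by move=> x Ox; rewrite Em //; ring.
- move=> x Ox; rewrite subSnn -Ropp_0; apply/sdle_opp.
  apply: (@cone_sdle N O m (K + 1)); first lra.
    by move=> y; have [p [Op [E Hy]]] := Hm y; exists p; split => //; exists (- U p).
  exact: Ox.
- move=> x Ox; exists (fun=> True); split; first exact: dim_all.
  exists 1; split; first lra.
  by move=> v _ Hv; rewrite sdU //; have := dot_ge0 v; lra.
- lra.
- move=> x Ox _; exists (fun=> True); split; first by apply: dim_all; rewrite subSnn.
  exists 1; split; first lra.
  by move=> v _ Hv; rewrite sdU //; lra.
- by move=> x _; lra.
move=> z Sz; apply: Rnot_lt_le => Hz.
have HDD : 0 < D * D by nra.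
(* The paraboloid [f] is strictly concave, nonnegative on the closure, where the distance to c is at
   most D, and at most eta D^2 = z(x0) / 2 at [x0]. *)
pose eta := z x0 / (2 * (D * D)).
have Heta : 0 < eta by apply: Rdiv_lt_0_compat; lra.
pose f x := eta * (D * D - dot (vsub x c) (vsub x c)).
have sf : smooth (fun x (_ : R) => f x).
  apply: smooth_mult; first exact: smooth_const.
  apply: smooth_minus; first exact: smooth_const.
  apply: smooth_sum => i; apply: smooth_mult; apply: smooth_minus;
   by [exact: smooth_coord|exact: smooth_const].
have : z x0 <= f x0.
  apply: (compare_upper HL bO Sz sf); last exact: clos_sub.
    move=> x _; exists (- (2 * eta)); split; first lra.
    exists (fun=> True); split; first exact: dim_all.
    exists 1; split; first lra.
    move=> v _ _; rewrite /sd /f.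
    have -> : vsub (vadd x v) c = vadd (vsub x c) (vscale 1 v).
      by vec_ring.
    have -> : vsub (vsub x v) c = vadd (vsub x c) (vscale (-1) v).
      by vec_ring.
    by rewrite !dot_quad; lra.
  move=> x [Cx Ox]; apply: Rle_trans (Uout x Ox) _; apply: Rmult_le_pos; first lra.
  have := HDx x Cx; rewrite -vnorm_sq -/(vdist x c); have := Hd x; nra.
rewrite /f; have : eta * (D * D) = z x0 / 2 by rewrite /eta; field; lra.
have := Rmult_le_pos _ _ (Rlt_le _ _ Heta) (dot_ge0 (vsub x0 c)); lra.
Qed.

(** * Duality and conclusion *)

Lemma elliptic_gap N j (Lam : mat N -> R) O x0 : (1 <= j)%nat -> (j <= N)%nat -> elliptic j Lam ->
  is_open O -> bounded_set O -> O x0 -> exponential_gap Lam O x0.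
Proof.
move=> Hj HjN HL HO bO Ox0.
case: (eqVneq j 1%nat) HL => [->|Hj1] HL.
  have HN := leq_trans Hj HjN. exact (first_eigenvalue_gap HN HL HO bO Ox0).
case: (eqVneq j N) HL => [->|HjN1] HL.
  exact (last_eigenvalue_gap (leq_trans Hj HjN) HL HO bO Ox0).
apply: (@intermediate_gap N j) => //; first by rewrite ltn_neqAle eq_sym Hj1.
by rewrite ltn_neqAle HjN1.
Qed.

Section Duality.
Context (N : nat).
Implicit Types (Lam : mat N -> R) (O : vec N -> Prop) (g z : vec N -> R).

Lemma cont_on2_opp S (f : vec N -> R -> R) : cont_on2 S f -> cont_on2 S (fun x t => - f x t).
Proof.
move=> H; have := cont_on2_minus (cont_on2_const (S := S) 0) H.
by congr cont_on2; apply: functional_extensionality => x; apply: functional_extensionality => t; ring.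
Qed.

Lemma cont_on_opp S (f : vec N -> R) : cont_on S f -> cont_on S (fun x => - f x).
Proof.
move=> H; apply: (@cont_on_slice N S (fun x _ => S x) (fun x _ => - f x) 0) => //.
by apply: cont_on2_opp; exact: (@cont_on_static N S).
Qed.

Lemma C21_opp phi (H : vec N -> R -> mat N) T : C21 phi H T ->
  C21 (fun x t => - phi x t) (fun x t i k => - H x t i k) (fun x t => - T x t).
Proof.
move=> [G [A1 [A2 [A3 [A4 A5]]]]]; exists (fun i x t => - G i x t).
split; first by move=> i x t; apply: derivable_pt_lim_opp; exact: A1.
split; first by move=> i k x t; apply: derivable_pt_lim_opp; exact: A2.
split; first by move=> x t; apply: derivable_pt_lim_opp; exact: A3.
by split; [move=> i k|]; apply: cont_on2_opp.
Qed.

Lemma C2_hess_opp f (H : vec N -> mat N) : C2_hess f H -> C2_hess (fun x => - f x) (fun x i k => - H x i k).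
Proof. by move=> /C21_static /C21_opp /C21_slice; apply; exact: 0. Qed.

Lemma dual_opK Lam : dual_op (dual_op Lam) = Lam.
Proof.
apply: functional_extensionality => A; rewrite /dual_op Ropp_involutive; congr Lam.
by apply: functional_extensionality => i; apply: functional_extensionality => k; rewrite Ropp_involutive.
Qed.

Lemma sol_par_dual Lam O g u0 u : sol_par Lam O g u0 u ->
  sol_par (dual_op Lam) O (fun x => - g x) (fun x => - u0 x) (fun x t => - u x t).
Proof.
move=> [H1 [H2 [H3 [H4 H5]]]]; split; first exact: cont_on2_opp.
split; first by move=> x t Bx Ht; rewrite H2.
split; first by move=> x Ox; rewrite H3.
split; move=> x t phi H T Ox Ht C [r [Hr K]]; rewrite /dual_op.
  have := H5 x t _ _ _ Ox Ht (C21_opp C); set L := Lam _ => H6.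
  suff: - T x t - L >= 0 by lra.
  apply: H6; exists r; split => // y s Oy Hs Hy Hst; have := K y s Oy Hs Hy Hst; lra.
have := H4 x t _ _ _ Ox Ht (C21_opp C); set L := Lam _ => H6.
suff: - T x t - L <= 0 by lra.
apply: H6; exists r; split => // y s Oy Hs Hy Hst; have := K y s Oy Hs Hy Hst; lra.
Qed.

Lemma sol_ell_dual Lam O g z : sol_ell Lam O g z ->
  sol_ell (dual_op Lam) O (fun x => - g x) (fun x => - z x).
Proof.
move=> [H1 [H2 [H3 H4]]]; split; first exact: cont_on_opp.
split; first by move=> x Bx; rewrite H2.
split; move=> x phi H Ox C [r [Hr K]]; rewrite /dual_op.
  have := H4 x _ _ Ox (C2_hess_opp C); set L := Lam _ => H6.
  suff: L <= 0 by lra.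
  by apply: H6; exists r; split => // y Oy Hy; have := K y Oy Hy; lra.
have := H3 x _ _ Ox (C2_hess_opp C); set L := Lam _ => H6.
suff: 0 <= L by lra.
by apply: H6; exists r; split => // y Oy Hy; have := K y Oy Hy; lra.
Qed.
End Duality.

Theorem theorem3p5 (N : nat) (O : vec N -> Prop) (j : nat) (x0 : vec N) :
  is_domain O -> bounded_set O -> (1 <= j)%nat -> (j <= N)%nat -> O x0 ->
  (exists (g u0 : vec N -> R) (mu1 k : R),
     cont_on (bdry O) g /\ cont_on (clos O) u0 /\
     (forall x, bdry O x -> u0 x = g x) /\ 0 < mu1 /\ 0 < k /\
     (exists u, visc_sol_par j O g u0 u) /\ (exists z, visc_sol_ell j O g z) /\
     (forall u z, visc_sol_par j O g u0 u -> visc_sol_ell j O g z ->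
        forall t, 0 < t -> u x0 t >= z x0 + k * exp (- mu1 * t)))
  /\
  (exists (g u0 : vec N -> R) (mu1 k : R),
     cont_on (bdry O) g /\ cont_on (clos O) u0 /\
     (forall x, bdry O x -> u0 x = g x) /\ 0 < mu1 /\ 0 < k /\
     (exists u, visc_sol_par j O g u0 u) /\ (exists z, visc_sol_ell j O g z) /\
     (forall u z, visc_sol_par j O g u0 u -> visc_sol_ell j O g z ->
        forall t, 0 < t -> u x0 t <= z x0 - k * exp (- mu1 * t))).
Proof.
move=> [HO _] bO Hj HjN Ox0; have HL := lambda_elliptic Hj HjN.
split; first exact: elliptic_gap Hj HjN HL HO bO Ox0.
have Hd : (1 <= N.+1 - j)%nat by rewrite subn_gt0 ltnS.
have HdN : (N.+1 - j <= N)%nat by rewrite leq_subLR -addn1 addnC leq_add2r.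
have [g [u0 [mu [k [cg [cu [Hg [Hmu [Hk [[u Hu] [[z Hz] Hgap]]]]]]]]]]] :=
  elliptic_gap Hd HdN (dual_elliptic Hj HjN HL) HO bO Ox0.
have opp2 (f : vec N -> R) : (fun x => - - f x) = f.
  by apply: functional_extensionality => x; rewrite Ropp_involutive.
exists (fun x => - g x), (fun x => - u0 x), mu, k.
split; first exact: cont_on_opp.
split; first exact: cont_on_opp.
split; first by move=> x Bx; rewrite Hg.
split => //; split => //; split.
  by exists (fun x t => - u x t); have := sol_par_dual Hu; rewrite dual_opK.
split; first by exists (fun x => - z x); have := sol_ell_dual Hz; rewrite dual_opK.
move=> u' z' Su Sz t Ht.
(* Arbitrary solutions are carried to the dual problem, where the data are those supplied by the
   first half after a double negation. *)
have := @sol_par_dual N (lambda j) O _ _ u' Su; rewrite !opp2 => Su'.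
have := @sol_ell_dual N (lambda j) O _ z' Sz; rewrite !opp2 => Sz'.
have := Hgap _ _ Su' Sz' t Ht; lra.
Qed.
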